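(* \textsc{Max Min FVS} can be solved in time $9.34^{k} n^{O(1)}$, where $n$ is the number of vertices of the input graph.
   Context: A feedback vertex set of a graph $G$ is a set $S\subseteq V(G)$ such that $G-S$ is acyclic; it is minimal if no proper subset of $S$ is a feedback vertex set. \textsc{Max Min FVS}: given a graph $G$ and an integer $k$, decide whether $G$ has a minimal feedback vertex set of size at least $k$. *)

(* Defs.v *)
From mathcomp Require Import all_boot.
Set Implicit Arguments.
Unset Strict Implicit.
Unset Printing Implicit Defensive.

(** ** Feedback vertex sets

   A finite simple graph is a symmetric irreflexive relation on a [finType];
   both hypotheses are carried by the theorems that use these notions. *)

(* [ucycle] asks for a duplicate-free cyclic sequence.  In a simple graph a
   cycle has at least three vertices; shorter sequences do satisfy [ucycle]
   (e.g. the two endpoints of an edge), whence the size condition. *)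
Definition acyclic (T : finType) (e : rel T) : Prop :=
  forall c : seq T, 2 < size c -> ~ ucycle e c.

Definition del_vertices (T : finType) (e : rel T) (S : {set T}) :
    rel {x : T | x \notin S} :=
  fun x y => e (val x) (val y).

Definition fvs (T : finType) (e : rel T) (S : {set T}) : Prop :=
  acyclic (del_vertices e (S := S)).

Definition minimal_fvs (T : finType) (e : rel T) (S : {set T}) : Prop :=
  fvs e S /\ forall S' : {set T}, S' \proper S -> ~ fvs e S'.

Definition max_min_fvs (T : finType) (e : rel T) (k : nat) : Prop :=
  exists S : {set T}, minimal_fvs e S /\ k <= #|S|.

(** ** Random access machines with logarithmic cost

   A program addresses registers directly and memory indirectly, through an
   address held in a register; the two are separate so that the program's
   registers do not collide with an input of variable length. *)

Inductive instr : Type :=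
| IConst (d c : nat)      (* R[d] := c *)
| IMove  (d a : nat)      (* R[d] := R[a] *)
| IAdd   (d a b : nat)    (* R[d] := R[a] + R[b] *)
| ISub   (d a b : nat)    (* R[d] := R[a] - R[b], truncated at 0 *)
| ILoad  (d a : nat)      (* R[d] := M[R[a]] *)
| IStore (a b : nat)      (* M[R[a]] := R[b] *)
| IJumpz (a l : nat).     (* if R[a] = 0 then goto l *)

Definition program : Type := seq instr.

Record state : Type := State { pc : nat; regs : nat -> nat; memory : nat -> nat }.

(* The machine stops when the program counter leaves the program. *)
Definition halted (p : program) (s : state) : bool := size p <= pc s.

Definition exec (i : instr) (s : state) : state :=
  let: State l R M := s in
  match i with
  | IConst d c => State l.+1 [eta R with d |-> c] M
  | IMove d a => State l.+1 [eta R with d |-> R a] M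
  | IAdd d a b => State l.+1 [eta R with d |-> R a + R b] M
  | ISub d a b => State l.+1 [eta R with d |-> R a - R b] M
  | ILoad d a => State l.+1 [eta R with d |-> M (R a)] M
  | IStore a b => State l.+1 R [eta M with R a |-> R b]
  | IJumpz a l' => State (if R a == 0 then l' else l.+1) R M
  end.

(* Number of binary digits of [n], with [bitlen 0 = 0]. *)
Definition bitlen (n : nat) : nat := up_log 2 n.+1.

(* Logarithmic cost: an instruction is charged for the lengths of the numbers
   and of the memory addresses it handles, so arithmetic on long numbers is not
   free.  Register indices are constants of the program and are not charged. *)
Definition instr_cost (i : instr) (s : state) : nat :=
  let: State _ R M := s in
  1 + match i with
      | IConst _ c => bitlen c
      | IMove _ a => bitlen (R a)
      | IAdd _ a b => bitlen (R a) + bitlen (R b)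
      | ISub _ a b => bitlen (R a) + bitlen (R b)
      | ILoad _ a => bitlen (R a) + bitlen (M (R a))
      | IStore a b => bitlen (R a) + bitlen (R b)
      | IJumpz a _ => bitlen (R a)
      end.

Definition step (p : program) (s : state) : state :=
  if onth p (pc s) is Some i then exec i s else s.

Definition step_cost (p : program) (s : state) : nat :=
  if onth p (pc s) is Some i then instr_cost i s else 0.

(* Started in [s], [p] halts after total time [t] and its answer is [b]; the
   answer is yes iff R[0] is nonzero.  A halted state is a fixed point of
   [step] with cost 0, so [t] does not depend on the choice of [m]. *)
Definition halts_with (p : program) (s : state) (b : bool) (t : nat) : Prop :=
  exists m : nat,
    [/\ halted p (iter m (step p) s),
        b = (regs (iter m (step p) s) 0 != 0)
      & t = \sum_(i < m) step_cost p (iter i (step p) s)].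

(* Input (G, k), for G a graph on the vertex set {0, ..., n-1}: R[0] = n,
   R[1] = k, M[i * n + j] = 1 if i and j are adjacent; everything else is 0. *)
Definition input (n : nat) (e : rel 'I_n) (k : nat) : state :=
  State 0
    [eta fun=> 0 with 0 |-> n, 1 |-> k]
    (fun a => [exists i : 'I_n, exists j : 'I_n, (a == i * n + j) && e i j]).

(* Main.v *)
Require Import Defs.
From mathcomp Require Import all_boot all_order all_algebra.
From mathcomp Require Import zify ring lra.
Set Implicit Arguments.
Unset Strict Implicit.
Unset Printing Implicit Defensive.

(** A minimal feedback vertex set is the complement of a maximal induced forest [M]: every vertex
    outside [M] is [blocked], having two neighbours in one tree of [M] ([max_min_fvsP]). A greedy
    maximal forest [X] settles the question if at least [k] vertices lie outside it. Otherwise fewer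
    than [k] do, and [M :\: X] can be guessed. From then on [F] holds the vertices decided to be in
    [M], [U] the undecided ones, which form a forest because [X] does, and the remaining vertices
    are discarded; right guesses keep [M] between [F] and [F :|: U]. A tree of [U] with at most one
    edge to [F] meets no cycle of [F :|: U], so it lies in [M] and is absorbed by [F].

    While some tree of [U] has three or more edges to [F], the search branches on a pivot of that
    tree ([pivot_exists]). Let cc be the number of vertices minus the number of edges of the forest,
    and consider the number of trees with exactly two edges to [F], plus the number of discarded
    vertices, minus cc. Both branches raise this potential by at least one and take one unit from
    the budget [L], initially [k + #|M :\: X|]. When [L] is spent, at least k + cc disjoint
    connected sets are attached to the forest by two edges each; a forest keeps at most cc of them
    whole, so every forest containing [F] omits at least [k] vertices ([bushes_out], [phase1_leaf]).

    When all trees of [U] have exactly two edges to [F], a cycle can leave an undecided vertex in at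
    most two directions. An exchange argument then shows that all maximal forests between [F] and
    [F :|: U] have the same size and connect the same vertices of [F] ([maximal_card],
    [maximal_spans]). What is lost inside [U] is thus determined, and the remaining concern is
    discarded vertices that could return to the forest. One is safe when two of its neighbours in
    [F] are connected in [F :|: U]. Rule A forces a vertex into [M] ([ruleA_M]); rules B and C
    branch so as either to discard one more vertex or to make a discarded one safe; [K] counts the
    vertices still wanted. When [L] or [K] is spent, or no rule applies, the greedy forest that
    prefers [F], next [U], omits [k] vertices ([phase2_leaf]). Each leaf is tested with this greedy
    forest, which is maximal whatever was guessed, so acceptance is sound; the leaf reached by
    answering according to [M] accepts ([hasok_algo]).

    Leaves are counted by weights: 3^K (4/3)^L bounds the second phase and does not grow in the
    first, and each guessed vertex outside [X] contributes a factor 7/3, whence at most 2 (28/3)^k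
    leaves ([leaves_algo]).

    On the machine, recursion is replaced by replay: each turn of a single loop follows a stored
    path from the root of the decision tree to a leaf, tests the leaf and computes the next path. A
    turn is polynomial, and the lengths of the numbers bring in a factor k + 1 ([program_time]),
    which the gap between 28/3 and 9.34 absorbs ([power_slack]). *)

(** * Connectivity in induced subgraphs, and forests *)

Section Connectivity.
Variables (T : finType) (e : rel T).
Hypotheses (sym_e : symmetric e) (irr_e : irreflexive e).
Implicit Types (X Y Z F U : {set T}) (x y z u v w f g : T).

Definition inrel Y : rel T := [rel x y | [&& x \in Y, y \in Y & e x y]].
(** Reflexive even at vertices outside [Y]; [compt] therefore tests membership, so that the
    component of an outside vertex is empty. *)
Definition conn Y : rel T := connect (inrel Y).
Definition compt Y x : {set T} := [set z in Y | conn Y x z].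
Definition acyc Y : Prop :=
  forall c, 2 < size c -> {subset c <= Y} -> ~ ucycle e c.
(** The local obstruction to adding [u] to the forest [Y]: two neighbours in one component close a
    cycle. *)
Definition blocked Y u : bool :=
  [exists y, [exists y', [&& y != y', e u y, e u y', y \in Y, y' \in Y
                           & conn Y y y']]].

Lemma blockedP Y u :
  reflect (exists y y', [/\ y != y', e u y /\ e u y', y \in Y, y' \in Y
                          & conn Y y y']) (blocked Y u).
Proof.
apply: (iffP existsP) => [[y /existsP[y' /and3P[? ? /and4P[*]]]]|].
  by exists y, y'.
case=> y [y' [? [uy uy'] ? ? ?]].
by exists y; apply/existsP; exists y'; apply/and3P; split=> //; apply/and4P.
Qed.

Lemma inrel_sym Y : symmetric (inrel Y).
Proof. by move=> x y; rewrite /inrel /= sym_e andbCA. Qed.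

Lemma conn_sym Y : symmetric (conn Y).
Proof. exact: sym_connect_sym (inrel_sym Y). Qed.

Lemma conn0 Y x : conn Y x x.
Proof. exact: connect0. Qed.

Lemma conn_trans Y x y z : conn Y x y -> conn Y y z -> conn Y x z.
Proof. exact: connect_trans. Qed.

Lemma conn1 Y x y : x \in Y -> y \in Y -> e x y -> conn Y x y.
Proof. by move=> xY yY xy; apply: connect1; rewrite /inrel /= xY yY. Qed.

Lemma conn_mono Y Z x y : Y \subset Z -> conn Y x y -> conn Z x y.
Proof.
move=> sYZ; apply: connect_sub => a b /and3P[aY bY ab].
by apply: conn1; rewrite ?(subsetP sYZ).
Qed.

Lemma path_inrel Y x p : path (inrel Y) x p -> all (mem Y) p.
Proof.
by elim: p x => //= y p IHp x /andP[/and3P[_ -> _] /IHp].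
Qed.

Lemma conn_in Y x y : conn Y x y -> x != y -> (x \in Y) && (y \in Y).
Proof.
case/connectP=> [[|z p] /=]; first by move=> _ ->; rewrite eqxx.
case/andP=> /and3P[-> zY _] /path_inrel pY -> _ /=.
by case: p pY => //= a p /andP[aY /allP pY]; have := mem_last a p;
   rewrite inE => /predU1P[->|/pY].
Qed.

Lemma conn_inr Y x y : conn Y x y -> x \in Y -> y \in Y.
Proof.
by move=> cxy xY; have [<-//|/(conn_in cxy)/andP[]] := eqVneq x y.
Qed.

Lemma mem_comp Y x z : (z \in compt Y x) = (z \in Y) && conn Y x z.
Proof. by rewrite inE. Qed.

Lemma comp_sub Y x : compt Y x \subset Y.
Proof. by apply/subsetP=> z /[!inE] /andP[]. Qed.

Lemma comp_id Y x : x \in Y -> x \in compt Y x.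
Proof. by rewrite mem_comp conn0 => ->. Qed.

Lemma comp_eq Y x y : conn Y x y -> compt Y x = compt Y y.
Proof.
move=> cxy; apply/setP=> z; rewrite !mem_comp; congr (_ && _).
by apply/idP/idP; apply: conn_trans => //; rewrite conn_sym.
Qed.

Lemma comp_notin Y x : x \notin Y -> compt Y x = set0.
Proof.
move=> xY; apply/setP=> z; rewrite mem_comp inE; apply/negP=> /andP[zY cxz].
by move: xY; rewrite (conn_inr _ zY) // conn_sym.
Qed.

Lemma comp_closed Y x y z :
  y \in compt Y x -> z \in Y -> e y z -> z \in compt Y x.
Proof.
rewrite !mem_comp => /andP[yY cxy] zY yz; rewrite zY.
exact: conn_trans cxy (conn1 yY zY yz).
Qed.

Lemma closed_conn (A Y : {set T}) x y :
  (forall a b, a \in A -> a \in Y -> b \in Y -> e a b -> b \in A) ->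
  x \in A -> conn Y x y -> y \in A.
Proof.
move=> clA xA /connectP[p pP ->].
elim: p x xA pP => //= z p IHp x xA /andP[/and3P[xY zY xz]] /IHp; apply.
exact: clA xY zY xz.
Qed.

Lemma acyc_mono Y Z : Y \subset Z -> acyc Z -> acyc Y.
Proof.
by move=> sYZ aZ c c2 cY; apply: aZ => // z /cY; apply: (subsetP sYZ).
Qed.

Lemma conn_uniq_path Y x y : conn Y x y -> x \in Y ->
  exists p, [/\ path e x p, uniq (x :: p), {subset x :: p <= Y}
              & last x p = y].
Proof.
move=> /connectP[p0 p0P ->] xY; case/shortenP: p0P => p pP Up _.
exists p; split=> //.
  by apply: sub_path pP => a b /and3P[].
by move=> z /[!inE] /predU1P[->//|]; move/allP: (path_inrel pP); apply.
Qed.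

Lemma path_conn Y x p :
  path e x p -> {subset x :: p <= Y} -> conn Y x (last x p).
Proof.
move=> pP pY; apply/connectP; exists p => //.
elim: p x pP pY => //= y p IHp x /andP[xy pP] pY.
rewrite /inrel /= xy !pY ?inE ?eqxx ?orbT //=; apply: IHp => // z zp.
by apply: pY; rewrite inE zp orbT.
Qed.

Lemma blocked_mono Y Z u : Y \subset Z -> blocked Y u -> blocked Z u.
Proof.
move=> sYZ /blockedP[y [y' [nyy [uy uy'] yY y'Y cyy]]]; apply/blockedP.
by exists y, y'; split; rewrite ?(subsetP sYZ) //; apply: conn_mono cyy.
Qed.

Lemma blocked_cyclic Y u : u \notin Y -> blocked Y u -> ~ acyc (u |: Y).
Proof.
move=> uY /blockedP[y [y' [nyy [uy uy'] yY y'Y cyy]]] aY.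
have [p [pP Up pY lp]] := conn_uniq_path cyy yY.
apply: (aY (u :: y :: p)).
- by case: p lp {pP Up pY} => //= eyy; rewrite eyy eqxx in nyy.
- by move=> z; rewrite inE => /predU1P[->|/pY zY]; rewrite !inE ?eqxx ?zY ?orbT.
rewrite /ucycle /= rcons_path uy pP lp sym_e uy' /=.
by rewrite -/(uniq (y :: p)) Up andbT; apply: contra uY; apply: pY.
Qed.

(** A new cycle passes through [u]; rotated to begin there, its second and last vertices are
    neighbours of [u] joined by the rest of the cycle inside [Y]. *)
Lemma acyc_add Y u : u \notin Y -> acyc Y -> ~~ blocked Y u -> acyc (u |: Y).
Proof.
move=> uY aY nb c c2 cY /andP[cyc Uc].
have [uc|uNc] := boolP (u \in c); last first.
  apply: (aY c c2) => [z zc|]; last by rewrite /ucycle cyc.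
  by move: (cY z zc) (zc); rewrite !inE => /predU1P[->|//]; rewrite (negPf uNc).
case/rot_to: uc => i c' ec.
have Uc' : uniq (u :: c') by rewrite -ec rot_uniq.
have cyc' : cycle e (u :: c') by rewrite -ec rot_cycle.
have c'Y : {subset c' <= Y}.
  move=> z zc'; have := cY z; rewrite -(mem_rot i) ec inE zc' orbT => /(_ isT).
  by rewrite !inE => /predU1P[ezu|//]; move: Uc'; rewrite /= -ezu zc'.
have sc' : 2 < size (u :: c') by rewrite -ec size_rot.
case: c' {ec} Uc' cyc' c'Y sc' => [|a [|b c']] //= Uc' + c'Y _.
rewrite rcons_path => /and3P[ua ab /andP[bc' lu]].
case/negP: nb; apply/blockedP; exists a, (last b c'); split=> //.
- by case/and3P: Uc' => _ aN _; apply: contraNneq aN => ->; apply: mem_last.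
- by rewrite ua sym_e lu.
- by apply: c'Y; rewrite inE eqxx.
- by apply: c'Y; rewrite inE mem_last orbT.
- by rewrite -[last b c']/(last a (b :: c')); apply: path_conn; rewrite //= ab.
Qed.

Lemma acyc_unblocked Y u : acyc Y -> u \in Y -> ~~ blocked (Y :\ u) u.
Proof.
move=> aY uY; apply/negP=> /blocked_cyclic; apply; first by rewrite !inE eqxx.
by rewrite setD1K.
Qed.

Lemma acyc0 : acyc set0.
Proof.
by case=> // x c _ c0; have := c0 x; rewrite inE eqxx inE => /(_ isT).
Qed.

(** Around a vertex of a forest, each piece contains exactly one neighbour of it. *)
Lemma acyc_ninj Y u w w' : acyc Y -> u \in Y -> w \in Y -> w' \in Y ->
  e u w -> e u w' -> conn (Y :\ u) w w' -> w = w'.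
Proof.
move=> aY uY wY w'Y uw uw' cww; apply/eqP; apply: contraT => nww.
have nu x : e u x -> x != u by apply: contraTneq => ->; rewrite irr_e.
case/negP: (acyc_unblocked aY uY); apply/blockedP; exists w, w'.
by split; rewrite // !inE ?wY ?w'Y ?nu.
Qed.

(** Follow the path up to its first visit to [u]: the vertex before it is the required neighbour. *)
Lemma conn_first Y u x y : u \notin Y -> x \in Y -> conn (u |: Y) x y ->
  conn Y x y \/ exists z, [/\ e u z, z \in Y & conn Y x z].
Proof.
move=> uY xY /connectP[p pP ->]; elim: p x xY pP => [|z p IHp] x xY /=.
  by left; apply: conn0.
case/andP=> /and3P[_ zuY xz] pP; have [ezu|nzu] := eqVneq z u.
  by right; exists x; rewrite sym_e -ezu; split=> //; apply: conn0.
have zY : z \in Y by move: zuY; rewrite !inE (negPf nzu).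
have cxz := conn1 xY zY xz.
case: (IHp z zY pP) => [czl|[t [ut tY czt]]]; [left|right].
  exact: conn_trans czl.
by exists t; split=> //; apply: conn_trans czt.
Qed.

Lemma conn_via Y u x y : u \notin Y -> x \in Y -> y \in Y ->
  conn (u |: Y) x y -> conn Y x y \/
  exists z z', [/\ e u z /\ e u z', z \in Y, z' \in Y, conn Y x z
                 & conn Y z' y].
Proof.
move=> uY xY yY c; case: (conn_first uY xY c) => [|[z [uz zY cz]]]; first by left.
move: c; rewrite conn_sym => /(conn_first uY yY)[|[z' [uz' z'Y cz']]].
  by left; rewrite conn_sym.
by right; exists z, z'; split=> //; rewrite conn_sym.
Qed.

(* A path between two vertices of a forest is unique. *)
Lemma acyc_cut Y w y y' p : acyc Y -> path e y p -> uniq (y :: p) ->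
  {subset y :: p <= Y} -> last y p = y' -> w \in y :: p -> y != y' ->
  ~~ conn (Y :\ w) y y'.
Proof.
move=> aY pP Up pY lp wp nyy; apply/negP=> cyy.
have /andP[] := conn_in cyy nyy; rewrite !inE => /andP[nyw yY] /andP[nyw' y'Y].
have {}wp : w \in p by move: wp; rewrite inE eq_sym (negPf nyw).
case/splitPr: wp pP Up pY lp => p1 p2.
rewrite cat_path last_cat => /andP[p1P /andP[lw p2P]] Up pY /= lp.
case: p2 Up pY lp p2P => [|b p2] Up pY lp /=; first by rewrite -lp eqxx in nyw'.
case/andP=> wb p2P.
have wY : w \in Y by apply: pY; rewrite inE mem_cat inE eqxx !orbT.
move: Up; rewrite -cat_cons cat_uniq => /and3P[U1 /hasPn h12 /= /andP[wb2 U2]].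
have c1 : conn (Y :\ w) y (last y p1).
  apply: path_conn => // z zp; have zY : z \in Y.
    by apply: pY; rewrite -cat_cons mem_cat zp.
  by rewrite !inE zY andbT; apply: contraTneq zp => ->; apply: h12; rewrite inE eqxx.
have c2 : conn (Y :\ w) b (last b p2).
  apply: path_conn => // z zp; have zY : z \in Y.
    by apply: pY; rewrite -cat_cons mem_cat inE zp !orbT.
  by rewrite !inE zY andbT; apply: contraTneq zp => ->.
(* The predecessor and the successor of [w] on the path are neighbours of [w] that would be
   connected without [w]; they coincide, against uniqueness of the path. *)
have ab : last y p1 = b.
  apply: (@acyc_ninj Y w) => //; rewrite ?[e w (last _ _)]sym_e //.
  - by apply: pY; rewrite -cat_cons mem_cat mem_last.
  - by apply: pY; rewrite inE mem_cat !inE eqxx !orbT.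
  apply: conn_trans (_ : conn _ _ y) _; first by rewrite conn_sym.
  by apply: conn_trans cyy _; rewrite conn_sym -lp.
have := h12 b; rewrite !inE eqxx orbT -ab -in_cons mem_last => /(_ isT); done.
Qed.

End Connectivity.

(** * Pieces of a tree around a vertex, and pivots *)

Section Pieces.
Variables (T : finType) (e : rel T).
Hypotheses (sym_e : symmetric e) (irr_e : irreflexive e).
Implicit Types (X Y Z F U A B : {set T}) (x y z u v w f g p : T).
Local Notation conn := (conn e).
Local Notation compt := (compt e).
Local Notation acyc := (acyc e).
Local Notation blocked := (blocked e).

Definition nb Y u : {set T} := [set y in Y | e u y].
(** Ordered pairs are counted, so [ed A A] is twice the number of edges inside [A]. *)
Definition ed A B := \sum_(z in A) #|nb B z|.
(** Taking [p] into [F] joins its forest neighbours through [p] and gives a second forest edge to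
    every piece that had one; at least two such effects are required. *)
Definition pivot F U p :=
  2 <= #|nb F p| + #|[set w in nb U p | ed (compt (U :\ p) w) F == 1]|.
(** Pieces with at most one forest edge get absorbed, so a discarded light vertex keeps at most one
    undecided neighbour. *)
Definition light F U p := #|[set w in nb U p | 2 <= ed (compt (U :\ p) w) F]| <= 1.

Lemma in_nb Y u y : (y \in nb Y u) = (y \in Y) && e u y.
Proof. by rewrite inE. Qed.

Lemma nb_sub Y Z u : Y \subset Z -> nb Y u \subset nb Z u.
Proof.
move=> sYZ; apply/subsetP=> y; rewrite !in_nb => /andP[yY ->].
by rewrite (subsetP sYZ).
Qed.

Lemma nbD1 Y u : nb (Y :\ u) u = nb Y u.
Proof.
by apply/setP=> y; rewrite !in_nb !inE; case: eqP => // ->; rewrite irr_e !andbF.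
Qed.

Lemma nb_neq Y u y : y \in nb Y u -> y != u.
Proof. by rewrite in_nb => /andP[_]; apply: contraTneq => ->; rewrite irr_e. Qed.

Lemma nb_in Y u y : y \in nb Y u -> y \in Y :\ u.
Proof. by move=> h; rewrite !inE (nb_neq h); move: h; rewrite in_nb => /andP[]. Qed.

Lemma comp_mono Y Z x : Y \subset Z -> compt Y x \subset compt Z x.
Proof.
move=> sYZ; apply/subsetP=> z; rewrite !mem_comp => /andP[zY c].
by rewrite (subsetP sYZ z zY); apply: conn_mono c.
Qed.

Lemma conn_del U p u x : p \notin compt U u -> u \in U -> conn U u x ->
  conn (U :\ p) u x.
Proof.
move=> pc uU /connectP[q qP ->]; rewrite -/(conn _ _ _).
have sub a r : a \in U -> conn U u a -> path (inrel e U) a r ->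
    {subset a :: r <= compt U u}.
  elim: r a => [|y r IHr] a aU cua /=.
    by move=> _ z; rewrite inE => /eqP->; rewrite mem_comp aU.
  case/andP=> /and3P[_ yU ay] rP.
  have cuy : conn U u y by apply: conn_trans cua (conn1 aU yU ay).
  move=> z; rewrite inE => /predU1P[->|]; first by rewrite mem_comp aU.
  exact: IHr.
have sq := sub u q uU (conn0 e U u) qP.
apply: path_conn.
  by apply: sub_path qP => a b /and3P[].
move=> z /sq zc; rewrite !inE; move: (zc); rewrite mem_comp => /andP[-> _].
by rewrite andbT; apply: contraNneq pc => <-.
Qed.

Lemma comp_del U p u : p \notin compt U u -> compt (U :\ p) u = compt U u.
Proof.
move=> pc; have [uU|uU] := boolP (u \in U); last first.
  by rewrite !comp_notin // inE (negPf uU) andbF.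
apply/eqP; rewrite eqEsubset comp_mono ?subsetDl //=.
apply/subsetP=> z; rewrite !mem_comp => /andP[zU cuz].
rewrite (conn_del pc uU cuz) !inE zU !andbT.
by apply: contraNneq pc => <-; rewrite mem_comp zU.
Qed.

Lemma piece_nin U p w w' : acyc U -> p \in U -> w \in nb U p -> w' \in nb U p ->
  w' \in compt (U :\ p) w -> w' = w.
Proof.
move=> aU pU; rewrite !in_nb mem_comp => /andP[wU pw] /andP[w'U pw'].
by case/andP=> _ /(acyc_ninj sym_e irr_e aU pU wU w'U pw pw').
Qed.

Lemma piece_ex U p z : p \in U -> z \in compt U p -> z != p ->
  exists2 w, w \in nb U p & z \in compt (U :\ p) w.
Proof.
move=> pU; rewrite mem_comp => /andP[zU cpz] nzp.
have zU' : z \in U :\ p by rewrite !inE nzp.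
have pU' : p \notin U :\ p by rewrite !inE eqxx.
have: conn (p |: (U :\ p)) z p by rewrite setD1K // conn_sym.
case/(conn_first sym_e pU' zU') => [c|[w [pw wU czw]]].
  by case/andP: (conn_in c nzp) => _; rewrite (negPf pU').
exists w; first by rewrite in_nb pw andbT; move: wU; rewrite inE => /andP[].
by rewrite mem_comp zU' conn_sym.
Qed.

Lemma piece_sub U p w : p \in U -> w \in nb U p ->
  compt (U :\ p) w \subset compt U p :\ p.
Proof.
move=> pU; rewrite in_nb => /andP[wU pw]; apply/subsetP=> z; rewrite mem_comp !inE.
case/andP=> /andP[-> zU] c; rewrite zU /=; apply: conn_trans (conn1 pU wU pw) _.
by apply: conn_mono c; apply: subsetDl.
Qed.

(** In a forest the component of [p] is the disjoint union of [p] and of one piece per neighbour. *)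
Lemma sum_pieces U p (h : T -> nat) : acyc U -> p \in U ->
  \sum_(z in compt U p) h z =
  h p + \sum_(w in nb U p) \sum_(z in compt (U :\ p) w) h z.
Proof.
move=> aU pU; rewrite (bigD1 p) ?comp_id //=; congr (_ + _).
under [RHS]eq_bigr do rewrite big_mkcond /=.
rewrite exchange_big [LHS]big_mkcond /=; apply: eq_bigr => z _.
case: ifP => [/andP[zc nzp]|zNc].
  have [w0 w0p zw0] := piece_ex pU zc nzp.
  rewrite (bigD1 w0) //= zw0 big1 ?addn0 // => w /andP[wp nww].
  case: ifP => // zw; case/eqP: nww; apply: (piece_nin aU pU w0p wp).
  move: zw zw0; rewrite !mem_comp => /andP[_ c] /andP[_ c'].
  rewrite (nb_in wp) /=; apply: conn_trans c' _; rewrite conn_sym //.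
rewrite big1 // => w wp; case: ifP => // /(subsetP (piece_sub pU wp)).
by rewrite !inE -/(conn _ _ _) -mem_comp andbC zNc.
Qed.

Lemma ed_pieces F U p : acyc U -> p \in U ->
  ed (compt U p) F = #|nb F p| + \sum_(w in nb U p) ed (compt (U :\ p) w) F.
Proof. exact: sum_pieces. Qed.

Lemma ed_subl A B F : A \subset B -> ed A F <= ed B F.
Proof.
move=> sAB; rewrite /ed [X in _ <= X](big_setID A) /= (setIidPr sAB).
exact: leq_addr.
Qed.

Lemma ed_comp_nb F U x : x \in U -> ed (compt U x) F = 0 -> #|nb F x| = 0.
Proof.
by move=> xU /eqP; rewrite sum_nat_eq0 => /forall_inP /(_ x (comp_id e xU))/eqP.
Qed.

Lemma card_nb_le1 U F p (N : {set T}) :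
  {in N, forall w, ed (compt (U :\ p) w) F <= 1} ->
  \sum_(w in N) ed (compt (U :\ p) w) F =
  #|[set w in N | ed (compt (U :\ p) w) F == 1]|.
Proof.
move=> le1; rewrite -sum1_card big_mkcond [RHS]big_mkcond /=.
apply: eq_bigr => w _; rewrite inE; case: ifP => // wN.
by move: (le1 w wN); case: (ed _ _) => [|[|]].
Qed.

(** The pieces around [y] other than that of [x] lie beyond the edge from [x] to [y], so removing
    [x] as well does not affect them. *)
Lemma piece_step U x y w : acyc U -> x \in U -> y \in nb U x ->
  w \in nb U y -> w != x -> compt (U :\ x :\ y) w = compt (U :\ y) w.
Proof.
move=> aU xU yx wy nwx.
have yU : y \in U by move: yx; rewrite in_nb => /andP[].
have xy : x \in nb U y by rewrite in_nb xU sym_e; move: yx; rewrite in_nb => /andP[].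
have -> : U :\ x :\ y = U :\ y :\ x by apply/setP=> z; rewrite !inE andbCA.
apply: comp_del; apply/negP=> /(piece_nin aU yU wy xy) xw.
by rewrite xw eqxx in nwx.
Qed.

Lemma ed_piece F U x y : acyc U -> x \in U -> y \in nb U x ->
  ed (compt (U :\ x) y) F =
  #|nb F y| + \sum_(w in nb U y :\ x) ed (compt (U :\ y) w) F.
Proof.
move=> aU xU yx.
have yU' : y \in U :\ x := nb_in yx.
rewrite ed_pieces //; last exact: acyc_mono (subsetDl _ _) aU.
have -> : nb (U :\ x) y = nb U y :\ x.
  by apply/setP=> z; rewrite !inE andbA.
congr (_ + _); apply: eq_bigr => w; rewrite !inE => /andP[nwx wy].
by rewrite piece_step // in_nb.
Qed.

(* The vertex next to the smallest heavy piece is a pivot: the other pieces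
   around it are proper parts of that piece, hence not heavy. *)
Lemma pivot_exists F U u : acyc U -> u \in U -> 2 <= ed (compt U u) F ->
  exists p, [/\ p \in compt U u, pivot F U p & light F U p].
Proof.
move=> aU uU Eu.
have [nh|] := boolP [forall w in nb U u, ed (compt (U :\ u) w) F <= 1].
  have le1 : {in nb U u, forall w, ed (compt (U :\ u) w) F <= 1}.
    by move=> w wu; apply: (implyP (forallP nh w)).
  exists u; split; first exact: comp_id.
    by rewrite /pivot -card_nb_le1 // -ed_pieces.
  rewrite /light (_ : [set w in _ | _] = set0) ?cards0 //.
  by apply/setP=> w; rewrite in_set in_set0; apply/negP=> /andP[/le1 h1 h2]; lia.
rewrite negb_forall => /existsP[w0]; rewrite negb_imply -ltnNge => /andP[w0u Ew0].
(* A pair stands for a directed edge and thereby for the piece at its far end. *)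
pose heavy (a : T * T) := [&& a.1 \in compt U u, a.2 \in nb U a.1 &
   2 <= ed (compt (U :\ a.1) a.2) F].
have h0 : heavy (u, w0) by rewrite /heavy /= comp_id ?w0u.
case: (arg_minnP (fun a : T * T => #|compt (U :\ a.1) a.2|) h0).
move=> [x y] /and3P[/= xc yx Exy] minxy.
have xU : x \in U by apply: (subsetP (comp_sub e U u)).
have yU : y \in U by move: yx; rewrite in_nb => /andP[].
have yc : y \in compt U u.
  by apply: comp_closed xc yU _; move: yx; rewrite in_nb => /andP[].
have le1 : {in nb U y :\ x, forall w, ed (compt (U :\ y) w) F <= 1}.
  move=> w; rewrite !in_setD1 => /andP[nwx wy]; rewrite leqNgt; apply/negP=> hw.
  have := minxy (y, w); rewrite /heavy /= yc wy hw => /(_ isT); apply/negP.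
  rewrite -ltnNge; apply: proper_card; rewrite -(piece_step aU xU yx wy nwx).
  have yU' : y \in U :\ x := nb_in yx.
  have wy' : w \in nb (U :\ x) y.
    by move: wy; rewrite !in_nb !inE nwx => /andP[-> ->].
  apply: sub_proper_trans (piece_sub yU' wy') _.
  by apply: properD1; apply: comp_id.
exists y; split=> //.
  rewrite /pivot; apply: leq_trans Exy _; rewrite ed_piece // card_nb_le1 // leq_add2l.
  apply: subset_leq_card; apply/subsetP=> w; rewrite !inE.
  by case/andP=> /andP[_ ->] ->.
rewrite /light -[X in _ <= X](cards1 x); apply: subset_leq_card.
apply/subsetP=> w; rewrite in_set in_set1 => /andP[wy hw].
apply: contraTT hw => nwx; rewrite -ltnNge ltnS; apply: le1.
by rewrite in_setD1 nwx.
Qed.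

(* In a tree with exactly two edges to [F], the pivots are the vertices of the
   path joining these edges; [y] hangs at the pivot [v]. *)
Lemma serve_exists F U y : acyc U -> y \in U -> ed (compt U y) F = 2 ->
  exists v, [/\ v \in U, pivot F U v & ed (compt (U :\ v) y) F = 0].
Proof.
move=> aU yU Ey.
(* [y] is itself a candidate, its component after its own removal being empty; the candidate leaving
   [y] in the largest piece turns out to be a pivot. *)
pose cand v := (v \in compt U y) && (ed (compt (U :\ v) y) F == 0).
have y0 : cand y.
  by rewrite /cand comp_id // comp_notin ?inE ?eqxx // /ed big_set0.
case: (arg_maxnP (fun v => #|compt (U :\ v) y|) y0) => v.
case/andP=> vc /eqP Ev maxv.
have vU : v \in U by apply: (subsetP (comp_sub e U y)).
exists v; split=> //; apply: contraT => np.
have ev : compt U y = compt U v by apply: comp_eq => //; move: vc; rewrite mem_comp => /andP[].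
have [le1|] := boolP [forall w in nb U v, ed (compt (U :\ v) w) F <= 1].
  case/negP: np; rewrite /pivot -card_nb_le1 -?ed_pieces -?ev ?Ey // => w wv.
  exact: (implyP (forallP le1 w)).
rewrite negb_forall => /existsP[w]; rewrite negb_imply -ltnNge => /andP[wv Ew].
have wU : w \in U by move: wv; rewrite in_nb => /andP[].
have vw : v \in nb U w by rewrite in_nb vU sym_e; move: wv; rewrite in_nb => /andP[].
have E2 : ed (compt U w) F = 2.
  rewrite -Ey ev -(comp_eq sym_e (_ : conn U v w)) //; apply: conn1 => //.
  by move: wv; rewrite in_nb => /andP[].
(* Both edges to [F] lie beyond [w], hence none on the side of [v]. *)
have Evw : ed (compt (U :\ w) v) F = 0.
  have := ed_pieces F aU wU; rewrite E2 (big_setD1 v) //= addnCA -ed_piece //.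
  by move: Ew; rewrite /=; lia.
have sub : compt (U :\ v) y \subset compt (U :\ w) v :\ v.
  have [->|nyv] := eqVneq y v.
    by rewrite comp_notin ?sub0set // !inE eqxx.
  have yc : y \in compt U v by rewrite -ev comp_id.
  have [x0 x0v yx0] := piece_ex vU yc nyv.
  have ex0 : compt (U :\ v) y = compt (U :\ v) x0.
    by apply/esym/comp_eq => //; move: yx0; rewrite mem_comp => /andP[].
  have nx0w : x0 != w.
    by apply: contraTneq Ew => <-; rewrite -ex0 Ev.
  rewrite ex0 -(piece_step aU wU vw x0v nx0w); apply: piece_sub.
    exact: nb_in vw.
  by move: x0v; rewrite !in_nb !inE nx0w => /andP[-> ->].
have cvw : compt (U :\ w) y = compt (U :\ w) v.
  have [->//|nyv] := eqVneq y v.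
  have yy : y \in compt (U :\ v) y by rewrite comp_id // !inE nyv.
  have := subsetP sub _ yy; rewrite !inE => /and3P[_ _ c].
  by apply/esym/comp_eq.
have wc : w \in compt U y.
  by rewrite ev; apply: comp_closed (comp_id e vU) wU _; move: wv; rewrite in_nb => /andP[].
have {maxv}: #|compt (U :\ w) y| <= #|compt (U :\ v) y|.
  by apply: maxv; rewrite /cand wc cvw Evw.
rewrite cvw leqNgt => /negP[]; apply: proper_card; apply: sub_proper_trans sub _; apply: properD1.
by apply: comp_id; apply: nb_in.
Qed.

End Pieces.

(** * Exchange when every undecided tree has at most two edges to the forest *)

Section Narrow.
Variables (T : finType) (e : rel T).
Hypotheses (sym_e : symmetric e) (irr_e : irreflexive e).
Variables (F U : {set T}).
Hypotheses (acU : acyc e U) (disFU : [disjoint F & U])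
  (narrow : {in U, forall u, ed e (compt e U u) F <= 2}).
Implicit Types (Y Z : {set T}) (x y z u v w f g p : T).
Local Notation conn := (conn e).
Local Notation comp := (compt e).
Local Notation acyc := (acyc e).
Local Notation blocked := (blocked e).
Local Notation H := (F :|: U).

(** The directions in which a cycle can leave [u]: all other neighbours lead into pieces cut off
    from [F]. *)
Definition exits u : {set T} :=
  [set y in nb e H u | (y \in F) || (0 < ed e (comp (U :\ u) y) F)].

Lemma notinF u : u \in U -> u \notin F.
Proof. by move=> uU; apply: contraTN disFU => uF; apply/pred0Pn; exists u; apply/andP. Qed.

Lemma exits_le u : u \in U -> #|exits u| <= ed e (comp U u) F.
Proof.
move=> uU; rewrite ed_pieces //.
apply: leq_trans (_ : #|nb e F u :|: [set w in nb e U u | 0 < ed e (comp (U :\ u) w) F]| <= _).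
  apply: subset_leq_card; apply/subsetP=> y; rewrite !inE -andbA.
  by case/and3P=> h1 -> h2; move: h1 h2; do 2!case: (y \in _).
apply: leq_trans (leq_card_setU _ _) _; rewrite leq_add2l -sum1_card.
rewrite big_mkcond [leqRHS]big_mkcond /=; apply: leq_sum => w _.
by rewrite inE; case: (w \in _) => //=; case: ifP.
Qed.

Lemma exits_le2 u : u \in U -> #|exits u| <= 2.
Proof. by move=> uU; apply: leq_trans (exits_le uU) (narrow uU). Qed.

(** A piece without edges to [F] is a whole component of what remains after deleting [u]. *)
Lemma hanging_closed u y z : y \in U :\ u -> ed e (comp (U :\ u) y) F = 0 ->
  conn (H :\ u) y z -> z \in comp (U :\ u) y.
Proof.
move=> yU E0; apply: closed_conn; last exact: comp_id.
move=> a b aC _ /setD1P[nbu /setUP[bF|bU]] ab; last first.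
  by apply: comp_closed aC _ ab; rewrite // !inE nbu.
have := E0; move/eqP; rewrite sum_nat_eq0 => /forall_inP /(_ a aC).
by rewrite cards_eq0 => /eqP/setP/(_ b); rewrite !inE bF ab.
Qed.

Lemma light_closed u y z : u \in U -> y \in nb e H u -> y \notin exits u ->
  conn (H :\ u) y z -> z \in comp (U :\ u) y.
Proof.
move=> uU yH; rewrite inE yH /= negb_or -leqNgt leqn0 => /andP[yF /eqP E0].
have yU : y \in U :\ u.
  rewrite !inE (nb_neq irr_e yH); move: yH; rewrite in_nb inE (negPf yF) /=.
  by case/andP.
exact: hanging_closed.
Qed.

Lemma exits_F u y f : u \in U -> y \in nb e H u -> f \in F ->
  conn (H :\ u) y f -> y \in exits u.
Proof.
move=> uU yH fF cyf; apply: contraT => ye.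
have := light_closed uU yH ye cyf; rewrite mem_comp !inE => /andP[/andP[_ fU] _].
by have := notinF fU; rewrite fF.
Qed.

Lemma exits_pair u y y' : u \in U -> y \in nb e H u -> y' \in nb e H u ->
  y != y' -> conn (H :\ u) y y' -> y \in exits u.
Proof.
move=> uU yH y'H nyy cyy; apply: contraT => ye.
have := light_closed uU yH ye cyy; rewrite mem_comp => /andP[y'U c].
have /andP[yU _] := conn_in c nyy.
move: yU y'U yH y'H nyy; rewrite !inE => /andP[_ yU] /andP[_ y'U] /andP[_ uy] /andP[_ uy'].
by rewrite (acyc_ninj sym_e irr_e acU uU yU y'U uy uy' c) eqxx.
Qed.

Lemma exits_eq u y y' z z' : u \in U ->
  y \in exits u -> y' \in exits u -> z \in exits u -> z' \in exits u ->
  y != y' -> z != z' -> (y = z /\ y' = z') \/ (y = z' /\ y' = z).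
Proof.
move=> uU ey ey' ez ez' nyy nzz.
have eD : [set z; z'] = exits u.
  apply/eqP; rewrite eqEcard cards2 nzz exits_le2 // andbT.
  by apply/subsetP=> t /set2P[->|->].
move: ey ey' nyy; rewrite -eD => /set2P[->|->] /set2P[->|->]; rewrite ?eqxx //; auto.
Qed.

(** A cycle through [u] uses two exits. As there are at most two, all sets that block [u] connect
    the same pair; this drives both exchange results below. *)
Lemma blocked_exits Y u : u \in U -> Y \subset H :\ u -> blocked Y u ->
  exists z z', [/\ z \in exits u, z' \in exits u, z != z' & conn Y z z'].
Proof.
move=> uU sYH /blockedP[z [z' [nzz [uz uz'] zY z'Y c]]].
have nbz t : t \in Y -> e u t -> t \in nb e H u.
  by move=> /(subsetP sYH); rewrite !inE => /andP[_ ->] ->.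
exists z, z'; split=> //.
  by apply: (exits_pair uU (nbz z _ _) (nbz z' _ _) nzz) => //; apply: conn_mono c.
apply: (exits_pair uU (nbz z' _ _) (nbz z _ _)) => //; first by rewrite eq_sym.
by rewrite conn_sym //; apply: conn_mono c.
Qed.

(** The vertices outside [Y] are removed one by one. A path using such a vertex enters and leaves it
    by its exits, and these are connected in [Y] because [Y] blocks the vertex, so the path can be
    rerouted. *)
Lemma maximal_spans Y f g : F \subset Y -> Y \subset H ->
  {in H :\: Y, forall u, blocked Y u} -> f \in F -> g \in F ->
  conn H f g -> conn Y f g.
Proof.
move=> sFY sYH bl fF gF.
have gen n Z : #|Z :\: Y| = n -> Y \subset Z -> Z \subset H ->
    conn Z f g -> conn Y f g; last exact: gen (erefl _) sYH (subxx _).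
elim: n Z => [|n IHn] Z cZ sYZ sZH cfg.
  have -> // : Y = Z.
  by apply/eqP; rewrite eqEsubset sYZ -setD_eq0 -cards_eq0 cZ.
have /card_gt0P[u] : 0 < #|Z :\: Y| by rewrite cZ.
rewrite inE => /andP[uY uZ].
have uH : u \in H := subsetP sZH u uZ.
have uF : u \notin F by apply: contra uY; apply: (subsetP sFY).
have uU : u \in U by move: uH; rewrite inE (negPf uF).
have sYZu : Y \subset Z :\ u.
  apply/subsetP=> t tY; rewrite !inE (subsetP sYZ) // andbT.
  by apply: contraNneq uY => <-.
have sZuH : Z :\ u \subset H :\ u by apply: setSD.
have sZuH' : Z :\ u \subset H by apply: subset_trans sZuH (subsetDl _ _).
have cZu : #|(Z :\ u) :\: Y| = n.
  move: cZ; rewrite (cardsD1 u) inE uY uZ /= => -[<-]; congr #|pred_of_set _|.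
  by apply/setP=> t; rewrite !inE andbCA.
apply: (IHn _ cZu sYZu sZuH').
have fZ : f \in Z :\ u by apply: (subsetP sYZu); apply: (subsetP sFY).
have gZ : g \in Z :\ u by apply: (subsetP sYZu); apply: (subsetP sFY).
have uZu : u \notin Z :\ u by rewrite !inE eqxx.
move: cfg; rewrite -{1}(setD1K uZ) => /(conn_via sym_e uZu fZ gZ)[//|].
case=> y [y' [[uy uy'] yZ y'Z cfy cy'g]].
have [eyy|nyy] := eqVneq y y'; first by apply: conn_trans cfy _; rewrite eyy.
have nbH t : t \in Z :\ u -> e u t -> t \in nb e H u.
  by move=> /(subsetP sZuH'); rewrite !inE => ->.
have ey : y \in exits u.
  by apply: (@exits_F _ _ f) => //; rewrite ?nbH // conn_sym //; apply: conn_mono cfy.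
have ey' : y' \in exits u.
  by apply: (@exits_F _ _ g) => //; rewrite ?nbH //; apply: conn_mono cy'g.
have buY : blocked Y u by apply: bl; rewrite inE uY.
have sYHu : Y \subset H :\ u := subset_trans sYZu sZuH.
have [z [z' [ez ez' nzz czz]]] := blocked_exits uU sYHu buY.
have cyy : conn (Z :\ u) y y'.
  have [[-> ->]|[-> ->]] := exits_eq uU ey ey' ez ez' nyy nzz.
    exact: conn_mono czz.
  by rewrite conn_sym //; apply: conn_mono czz.
by apply: conn_trans cfy _; apply: conn_trans cyy _.
Qed.

(* Exchange: a vertex of the maximal forest missing from [Y'] closes at most one
   cycle with [Y'], and this cycle leaves the maximal forest somewhere. *)
Lemma maximal_card Y Y' : F \subset Y -> Y \subset H -> acyc Y ->
  {in H :\: Y, forall u, blocked Y u} ->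
  F \subset Y' -> Y' \subset H -> acyc Y' -> #|Y'| <= #|Y|.
Proof.
move=> sFY sYH aY bl; have [n] := ubnP #|Y :\: Y'|.
elim: n Y' => // n IHn Y'; rewrite ltnS => cY sFY' sY'H aY'.
have [/eqP|/set0Pn[u]] := boolP (Y :\: Y' == set0).
  move/eqP; rewrite setD_eq0 => sYY'.
  apply: subset_leq_card; apply/subsetP=> w wY'; apply: contraT => wY.
  have bw : blocked Y w by apply: bl; rewrite inE wY (subsetP sY'H).
  case/negP: (acyc_unblocked sym_e aY' wY'); apply: blocked_mono bw.
  apply/subsetP=> t tY; rewrite !inE (subsetP sYY') // andbT.
  by apply: contraNneq wY => <-.
rewrite inE => /andP[uY' uY].
have uF : u \notin F by apply: contra uY'; apply: (subsetP sFY').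
have uH := subsetP sYH u uY.
have uU : u \in U by move: uH; rewrite inE (negPf uF).
have sY'Hu : Y' \subset H :\ u.
  apply/subsetP=> t tY; rewrite !inE (_ : t != u); last first.
    by apply: contraNneq uY' => <-.
  by have := subsetP sY'H t tY; rewrite inE.
have cD Z : Z \subset Y' -> Y' :\: Z \subset ~: Y -> #|Y :\: (u |: Z)| < n.
  move=> sZ sZY; apply: leq_trans cY; rewrite [ltnRHS](cardsD1 u) inE uY uY' add1n ltnS.
  apply: subset_leq_card; apply/subsetP=> t; rewrite !inE negb_or -andbA.
  case/and3P=> -> tZ tY; rewrite tY andbT /=.
  by apply: contraL tY => tY'; have := subsetP sZY t; rewrite !inE tZ tY' => ->.
have [bu|nbu] := boolP (blocked Y' u); last first.
  apply: leq_trans (IHn (u |: Y') _ _ _ _); first by rewrite cardsU1 uY' leq_addl.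
  - by apply: cD; rewrite // setDv sub0set.
  - by apply: subset_trans sFY' (subsetUr _ _).
  - by rewrite subUset sub1set uH.
  - exact: acyc_add.
have [z [z' [ez ez' nzz czz]]] := blocked_exits uU sY'Hu bu.
have /andP[zY' z'Y'] := conn_in czz nzz.
have [p [pP Up pY lp]] := conn_uniq_path czz zY'.
have uz : e u z by move: ez; rewrite !inE => /andP[/andP[]].
have uz' : e u z' by move: ez'; rewrite !inE => /andP[/andP[]].
(* If the whole path between the exits lay in [Y], it would block [u] inside the forest [Y]. *)
have /allPn[w wp wY] : ~~ all (mem Y) (z :: p).
  apply/negP=> /allP pYY; case/negP: (acyc_unblocked sym_e aY uY); apply/blockedP.
  have pYu : {subset z :: p <= Y :\ u}.
    move=> t tp; have tY : t \in Y := pYY t tp; rewrite !inE tY andbT.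
    by apply: contraNneq uY' => <-; apply: pY.
  exists z, z'; split=> //.
  - by apply: pYu; rewrite inE eqxx.
  - by apply: pYu; rewrite -lp mem_last.
  - by rewrite -lp; apply: path_conn.
have wY' := pY w wp.
have wF : w \notin F by apply: contra wY; apply: (subsetP sFY).
have sw : Y' :\ w \subset Y' := subsetDl _ _.
have uYw : u \notin Y' :\ w by rewrite !inE (negPf uY') andbF.
have ncut := acyc_cut sym_e irr_e aY' pP Up pY lp wp nzz.
apply: leq_trans (IHn (u |: (Y' :\ w)) _ _ _ _).
- by rewrite cardsU1 uYw [leqLHS](cardsD1 w) wY'.
- apply: cD => //; apply/subsetP=> t; rewrite !inE.
  by case/andP; rewrite negb_and negbK => /orP[/eqP->|/negP].
- apply/subsetP=> t tF; rewrite !inE (subsetP sFY') // andbT.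
  by apply/orP; right; apply: contraNneq wF => <-.
- by rewrite subUset sub1set uH (subset_trans sw).
(* [u] can only be blocked through [z] and [z'], which the removal of [w] has separated. *)
- apply: acyc_add => //; first exact: acyc_mono sw aY'.
  apply/negP=> /(blocked_exits uU (subset_trans sw sY'Hu)) [y [y' [ey ey' nyy c]]].
  case/negP: ncut.
  have [[<- <-]|[<- <-]] := exits_eq uU ey ey' ez ez' nyy nzz; first by [].
  by rewrite conn_sym.
Qed.

End Narrow.

(** * Counting edges of forests *)

Section Euler.
Variables (T : finType) (e : rel T).
Hypotheses (sym_e : symmetric e) (irr_e : irreflexive e).
Implicit Types (A B C F W Y Z : {set T}) (x y z u : T) (P : {set {set T}}).

Definition connected C := forall x y, x \in C -> y \in C -> conn e C x y.

Lemma edE A B : ed e A B = \sum_(a in A) \sum_(b in B) e a b.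
Proof.
apply: eq_bigr => a _; rewrite -sum1_card big_mkcond [RHS]big_mkcond /=.
by apply: eq_bigr => b _; rewrite inE; case: (b \in B); case: (e a b).
Qed.

Lemma edC A B : ed e A B = ed e B A.
Proof.
rewrite !edE exchange_big /=; apply: eq_bigr => b _; apply: eq_bigr => a _.
by rewrite sym_e.
Qed.

Lemma ed_setUl A B C : [disjoint A & B] -> ed e (A :|: B) C = ed e A C + ed e B C.
Proof. by move=> dAB; rewrite /ed -bigU //; apply: eq_bigl => z; rewrite !inE. Qed.

Lemma ed_setU A B : [disjoint A & B] ->
  ed e (A :|: B) (A :|: B) = ed e A A + ed e B B + 2 * ed e B A.
Proof.
move=> dAB; rewrite ed_setUl // ![ed e _ (A :|: B)]edC !ed_setUl //.
by rewrite [ed e A B]edC; lia.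
Qed.

Lemma ed1 x A : ed e [set x] A = #|nb e A x|.
Proof. by rewrite /ed big_set1. Qed.

Lemma ed11 x : ed e [set x] [set x] = 0.
Proof.
rewrite ed1; apply: eq_card0 => y; rewrite !inE.
by apply/negP=> /andP[/eqP-> ]; rewrite irr_e.
Qed.

Lemma ed_add x Y : x \notin Y ->
  ed e (x |: Y) (x |: Y) = ed e Y Y + 2 * #|nb e Y x|.
Proof.
move=> xY; rewrite setUC ed_setU; last by rewrite disjoint_sym disjoints1.
by rewrite ed11 ed1 addn0.
Qed.

Lemma path_conn_mem Y x p z : path e x p -> {subset x :: p <= Y} ->
  z \in x :: p -> conn e Y x z.
Proof.
move=> pP pY; rewrite inE => /predU1P[->|zp]; first exact: conn0.
case/splitPr: zp pP pY => p1 p2; rewrite -cat_rcons cat_path => /andP[p1P _] pY.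
rewrite -[z](last_rcons x p1); apply: path_conn => // t tp.
by apply: pY; rewrite -cat_cons mem_cat tp.
Qed.

(** Otherwise paths could be prolonged for ever: the end vertex has a neighbour other than its
    predecessor, and in a forest this neighbour is not yet on the path. *)
Lemma forest_leaf Y : acyc e Y -> Y != set0 -> exists2 x, x \in Y & #|nb e Y x| <= 1.
Proof.
move=> aY /set0Pn[x0 x0Y]; have [/exists_inP//|] := boolP [exists x in Y, #|nb e Y x| <= 1].
rewrite negb_exists_in => /forall_inP deg2; exfalso.
have long n : exists x p, [/\ path e x p, uniq (x :: p), {subset x :: p <= Y}
                            & size p = n].
  elim: n => [|n [x [p [pP Up pY sp]]]].
    by exists x0, [::]; split=> // z; rewrite inE => /eqP->.
  have xY : x \in Y by apply: pY; rewrite inE eqxx.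
  (* Paths grow at the front. For the one-vertex path the default [x] removes nothing from the
     neighbourhood. *)
  have : 0 < #|nb e Y x :\ head x p|.
    have := deg2 x xY; rewrite -ltnNge (cardsD1 (head x p)).
    by case: (_ \in _) => //=; lia.
  case/card_gt0P=> z; rewrite in_setD1 in_nb => /and3P[nzh zY xz].
  have nzx : z != x by apply: contraTneq xz => ->; rewrite irr_e.
  have zp : z \notin x :: p.
    rewrite inE negb_or nzx /=; apply/negP=> zp.
    case: p pP Up pY {sp} nzh zp => //= h p /andP[xh pP] /andP[xp Up] pY nzh zp.
    case/negP: (acyc_unblocked sym_e aY xY); apply/blockedP.
    have pYx : {subset h :: p <= Y :\ x}.
      move=> t tp; rewrite !inE pY ?andbT; last by rewrite inE tp orbT.
      by apply: contraNneq xp => <-.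
    exists h, z; split; rewrite ?pYx ?inE ?eqxx //; first by rewrite eq_sym.
    exact: path_conn_mem pP pYx zp.
  exists z, (x :: p); split=> //=; last by rewrite sp.
  - by rewrite sym_e xz.
  - by rewrite zp.
  - by move=> t; rewrite inE => /predU1P[->|/pY].
have [x [p [_ Up pY sp]]] := long #|Y|.
have := uniq_leq_size Up (_ : {subset _ <= enum Y}); rewrite -cardE /= sp ltnn.
by move=> h; apply: notF; apply: h => t /pY; rewrite mem_enum.
Qed.

Lemma forest_edges Y : acyc e Y -> ed e Y Y <= 2 * #|Y|.
Proof.
have [n] := ubnP #|Y|; elim: n Y => // n IHn Y; rewrite ltnS => cY aY.
have [->|/(forest_leaf aY)[x xY dx]] := eqVneq Y set0; first by rewrite /ed big_set0.
have xYx : x \notin Y :\ x by rewrite !inE eqxx.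
have eY : ed e Y Y = ed e (Y :\ x) (Y :\ x) + 2 * #|nb e Y x|.
  by rewrite -{1 2}(setD1K xY) ed_add // nbD1.
have := IHn (Y :\ x); move: cY; rewrite eY (cardsD1 x) xY add1n => cY.
move/(_ cY (acyc_mono (subsetDl _ _) aY)); lia.
Qed.

(** A subset grows from one vertex; while it is proper, connectedness provides an outside vertex
    with a neighbour in it, and adding that vertex adds an edge. *)
Lemma connected_edges C : connected C -> 2 * #|C| <= ed e C C + 2.
Proof.
move=> cC; have [->|/set0Pn[x xC]] := eqVneq C set0; first by rewrite cards0.
suff gen n : n < #|C| -> exists A, [/\ A \subset C, x \in A, #|A| = n.+1
    & 2 * #|A| <= ed e A A + 2].
  have C0 : 0 < #|C| by apply/card_gt0P; exists x.
  have [|A [sAC _ cA hA]] := gen #|C|.-1; first by rewrite prednK.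
  rewrite prednK // in cA.
  suff <- : A = C by [].
  by apply/eqP; rewrite eqEcard sAC cA leqnn.
elim: n => [|n IHn] ltn.
  by exists [set x]; rewrite sub1set xC set11 cards1; split=> //; lia.
have [A [sAC xA cA hA]] := IHn (ltnW ltn).
have [|] := boolP [exists b in C :\: A, 0 < #|nb e A b|].
  case/exists_inP=> b; rewrite inE => /andP[bA bC] db.
  exists (b |: A); rewrite subUset sub1set bC sAC !inE xA orbT.
  by split=> //; rewrite ?ed_add // cardsU1 bA ?cA //; lia.
rewrite negb_exists_in => /forall_inP noedge.
have /card_gt0P[b] : 0 < #|C :\: A|.
  by have := cardsID A C; rewrite (setIidPr sAC) cA; lia.
rewrite inE => /andP[bA bC]; case/negP: (bA).
apply: (closed_conn (Y := C)) xA (cC x b xC bC) => a c aA aC c0C ac.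
apply: contraT => cNA; have := noedge c; rewrite inE cNA c0C => /(_ isT)/negP[].
by apply/card_gt0P; exists a; rewrite in_nb aA sym_e.
Qed.

(** Disjoint connected sets, each attached to [F] by at least [m] edges. *)
Definition bushes m F P := [/\ trivIset P, {in P, forall C, connected C},
  {in P, forall C, [disjoint F & C]} & {in P, forall C, m <= ed e C F}].

(** In terms of vertices minus edges: adding the bushes lowers this quantity by at least m - 1 for
    each of them. *)
Lemma bushes_edges m F P : bushes m F P ->
  2 * #|F :|: cover P| + 2 * m * #|P| + ed e F F <=
  2 * #|F| + 2 * #|P| + ed e (F :|: cover P) (F :|: cover P).
Proof.
have [n] := ubnP #|P|; elim: n P => // n IHn P; rewrite ltnS => cP [tI cn dj dg].
have [->|/set0Pn[C CP]] := eqVneq P set0.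
  by rewrite /cover big_set0 setU0 cards0; lia.
have sP : P :\ C \subset P := subsetDl _ _.
have := IHn (P :\ C); move: cP; rewrite (cardsD1 C) CP add1n => cP /(_ cP).
have bP' : bushes m F (P :\ C).
  by split; first exact: trivIsetS tI; move=> D /(subsetP sP); auto.
move/(_ bP') => IH.
have -> : F :|: cover P = (F :|: cover (P :\ C)) :|: C.
  by rewrite -{1}(setD1K CP) /cover bigcup_setU big_set1 -setUA [C :|: _]setUC.
have dC : [disjoint F :|: cover (P :\ C) & C].
  rewrite -setI_eq0 setIUl setU_eq0 !setI_eq0 dj //= disjoint_sym /cover.
  apply: bigcup_disjoint => D; rewrite !inE => /andP[nDC DP].
  by apply: (trivIsetP tI) => //; rewrite eq_sym.
move: IH; rewrite (ed_setU dC) [#|_ :|: C|]cardsU (_ : _ :&: C = set0) ?cards0; last first.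
  by apply/eqP; rewrite setI_eq0.
have := connected_edges (cn C CP); have := dg C CP.
have : ed e C F <= ed e C (F :|: cover (P :\ C)).
  by apply: leq_sum => c _; apply: subset_leq_card; apply: nb_sub; apply: subsetUl.
by lia.
Qed.

(** Vertices minus edges is nonnegative in a forest, so at most as many bushes as this quantity for
    [F] lie wholly in [W]; each of the others has a vertex of its own outside [W]. *)
Lemma bushes_out F P W : bushes 2 F P -> F \subset W -> acyc e W ->
  2 * #|P| + ed e F F <= 2 * #|F| + 2 * #|cover P :\: W|.
Proof.
move=> [tI cn dj dg] sFW aW.
pose P1 := [set C in P | C \subset W]; pose P2 := [set C in P | ~~ (C \subset W)].
have cP : #|P| = #|P1| + #|P2|.
  rewrite -[in LHS](cardsID [set C : {set T} | C \subset W] P).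
  by congr addn; apply: eq_card => C; rewrite !inE // andbC.
have sP1 : P1 \subset P by apply/subsetP=> C; rewrite inE => /andP[].
have bP1 : bushes 2 F P1.
  by split; first exact: trivIsetS tI; move=> D /(subsetP sP1); auto.
have sW : F :|: cover P1 \subset W.
  rewrite subUset sFW; apply/bigcupsP=> C; rewrite inE => /andP[_ //].
have := bushes_edges bP1; have := forest_edges (acyc_mono sW aW).
suff : #|P2| <= #|cover P :\: W| by lia.
(* The chosen vertex is represented by its singleton, so that [set0] can serve as the default. *)
pose h (C : {set T}) := odflt set0 (omap (fun x => [set x]) [pick x in C :\: W]).
have hP C : C \in P2 -> exists2 x, h C = [set x] & x \in C :\: W.
  rewrite inE => /andP[_ /subsetPn[x xC xW]]; rewrite /h.
  case: pickP => [y yC|/(_ x)]; first by exists y.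
  by rewrite inE xC xW.
have hinj : {in P2 &, injective h}.
  move=> C D CP DP ehCD; have [x ex xC] := hP C CP; have [y ey yD] := hP D DP.
  have exy : x = y by apply/set1P; rewrite -ey -ehCD ex inE eqxx.
  apply: contraTeq isT => nCD; move: CP DP; rewrite !inE => /andP[CP _] /andP[DP _].
  have /pred0P/(_ x) := trivIsetP tI _ _ CP DP nCD.
  by move: xC yD; rewrite /= -exy !inE => /andP[_ ->] /andP[_ ->].
rewrite -(card_in_imset hinj) -(card_imset (mem (cover P :\: W)) set1_inj).
apply: subset_leq_card.
apply/subsetP=> A /imsetP[C CP ->]; have [x -> xC] := hP C CP.
apply: imset_f; move: xC; rewrite !inE => /andP[-> xC] /=.
by apply/bigcupP; exists C => //; move: CP; rewrite inE => /andP[].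
Qed.

End Euler.

(** * The first phase, guided by the forest [M] of a solution *)

Section Guided.
Variables (T : finType) (e : rel T).
Hypotheses (sym_e : symmetric e) (irr_e : irreflexive e).
Variables (M X : {set T}) (k : nat).
Hypotheses (acM : acyc e M) (maxM : forall u, u \notin M -> blocked e M u)
  (kM : k <= #|~: M|) (acX : acyc e X).
Implicit Types (F Fc U W Y Z : {set T}) (x y z u v w f g p : T).
Local Notation conn := (conn e).
Local Notation comp := (compt e).
Local Notation acyc := (acyc e).
Local Notation blocked := (blocked e).
Local Notation nb := (nb e).
Local Notation ed := (ed e).

(** All decisions so far agree with [M]: members of [F] are in it, and vertices outside [F :|: U]
    are not. *)
Definition consistent F U :=
  [/\ F \subset M, M \subset F :|: U, acyc U & [disjoint F & U]].

Definition absorbed F U : {set T} := [set u in U | ed (comp U u) F <= 1].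
Definition absF F U := F :|: absorbed F U.
Definition absU F U := U :\: absorbed F U.

Lemma absorbed_sub F U : absorbed F U \subset U.
Proof. by apply/subsetP=> u; rewrite inE => /andP[]. Qed.

Lemma absFU F U : absF F U :|: absU F U = F :|: U.
Proof.
by rewrite /absF /absU -setUA -{1}(setIidPr (absorbed_sub F U)) setID.
Qed.

Lemma absorbed_closed F U a b : a \in absorbed F U -> b \in U -> e a b ->
  b \in absorbed F U.
Proof.
rewrite !inE => /andP[aU Ea] bU ab; rewrite bU -(comp_eq sym_e (_ : conn U a b)) //.
exact: conn1.
Qed.

(** Absorption removes whole components of [U], so the others are unchanged. *)
Lemma comp_absU F U u : u \in absU F U -> comp (absU F U) u = comp U u.
Proof.
move=> uU; have sub : absU F U \subset U := subsetDl _ _.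
apply/eqP; rewrite eqEsubset comp_mono //=; apply/subsetP=> z.
rewrite mem_comp => /andP[zU cuz].
apply: (closed_conn (Y := U) _ (comp_id e uU) cuz) => a b aC aU bU ab.
apply: (comp_closed aC _ ab); rewrite in_setD bU andbT; apply/negP=> bA.
have := subsetP (comp_sub e (absU F U) u) a aC; rewrite in_setD aU andbT.
by case/negP; apply: absorbed_closed bA aU _; rewrite sym_e.
Qed.

Lemma nb_absF F U Y u : u \in absU F U -> Y \subset absorbed F U ->
  nb (F :|: Y) u = nb F u.
Proof.
move=> uU sY; apply/setP=> z; rewrite !inE; apply/andP/andP=> -[]; last first.
  by move=> ->.
case/orP=> [-> //|zY] uz; exfalso; case/setDP: uU => uU /negP[].
by apply: absorbed_closed (subsetP sY z zY) uU _; rewrite sym_e.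
Qed.

Lemma ed_absF F U u : u \in absU F U ->
  ed (comp (absU F U) u) (absF F U) = ed (comp U u) F.
Proof.
move=> uU; rewrite -(comp_absU uU); apply: eq_bigr => z zC.
by congr #|pred_of_set _|; apply: nb_absF => //; apply: (subsetP (comp_sub e _ u)).
Qed.

Lemma absU_ge2 F U u : u \in absU F U -> 2 <= ed (comp (absU F U) u) (absF F U).
Proof.
move=> uU; rewrite ed_absF //; move: uU; rewrite !inE => /andP[+ uU].
by rewrite uU /= -ltnNge.
Qed.

(** A vertex outside [M] is blocked and so has two exits, more than the edges that its tree has to
    [F]. *)
Lemma absorbed_M F U : consistent F U -> absorbed F U \subset M.
Proof.
move=> [sFM sMH aU dFU]; apply/subsetP=> u; rewrite inE => /andP[uU E1].
apply: contraT => uM; have sMHu : M \subset (F :|: U) :\ u.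
  apply/subsetP=> z zM; rewrite in_setD1 (subsetP sMH) // andbT.
  by apply: contraNneq uM => <-.
have [z [z' [ez ez' nzz _]]] := blocked_exits sym_e irr_e aU uU sMHu (maxM uM).
have := leq_trans (exits_le sym_e irr_e _ aU uU) E1.
rewrite leqNgt => /negP[]; apply: leq_trans (_ : #|[set z; z']| <= _).
  by rewrite cards2 nzz.
by apply: subset_leq_card; apply/subsetP=> t /set2P[->|->].
Qed.

Lemma consistent_abs F U : consistent F U -> consistent (absF F U) (absU F U).
Proof.
move=> ok; have [sFM sMH aU dFU] := ok; split.
- by rewrite subUset sFM absorbed_M.
- by rewrite absFU.
- exact: acyc_mono (subsetDl _ _) aU.
rewrite -setI_eq0; apply/eqP/setP=> z; rewrite [z \in set0]inE in_setI in_setU in_setD.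
case: (z \in absorbed F U); rewrite /= ?andbF // orbF; apply/negP=> /andP[zF zU].
by have := pred0P dFU z; rewrite /= zF zU.
Qed.

Definition chains F U : {set {set T}} :=
  [set comp U u | u in [set u in U | ed (comp U u) F == 2]].
Definition singles Y : {set {set T}} := [set [set s] | s in Y].
Definition out F U := X :\: (F :|: U).

Lemma comp_connected U u : connected e (comp U u).
Proof.
move=> x y; rewrite !mem_comp => /andP[xU cux] /andP[yU cuy].
have uU : u \in U by move: cux; rewrite conn_sym // => /conn_inr; apply.
have gen z : z \in U -> conn U u z -> conn (comp U u) u z.
  move=> zU /conn_uniq_path[//|p [pP Up pY <-]]; apply: path_conn => // t tp.
  by rewrite mem_comp pY //=; apply: path_conn_mem pP pY tp.
by apply: conn_trans (gen y yU cuy); rewrite conn_sym // gen.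
Qed.

Lemma comps_triv (A : {set T}) U : trivIset [set comp U u | u in A].
Proof.
apply/trivIsetP=> C D /imsetP[u uA ->] /imsetP[v vA ->] ncc.
apply/pred0P=> z /=; apply: contraNF ncc; rewrite !mem_comp.
case/andP=> /andP[zU cuz] /andP[_ cvz].
by rewrite (comp_eq sym_e cuz) (comp_eq sym_e cvz).
Qed.

Lemma chains_sub F U : cover (chains F U) \subset U.
Proof. by apply/bigcupsP=> C /imsetP[u _ ->]; apply: comp_sub. Qed.

Lemma disjoint_sub (A B C : {set T}) : [disjoint A & B] -> C \subset B ->
  [disjoint A & C].
Proof. by move=> dAB sCB; apply: disjointWr dAB. Qed.

Lemma bushes_chains F Fc U : [disjoint F & U] -> Fc \subset F ->
  {in U, forall u, nb F u = nb Fc u} -> bushes e 2 Fc (chains F U).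
Proof.
move=> dFU sFc nbE; have dFcU : [disjoint Fc & U] by apply: disjointWl dFU.
split; first exact: comps_triv.
- by move=> C /imsetP[u _ ->]; apply: comp_connected.
- by move=> C /imsetP[u _ ->]; apply: disjoint_sub dFcU (comp_sub _ _ _).
move=> C /imsetP[u + ->]; rewrite inE => /andP[uU /eqP <-].
apply: eq_leq; apply: eq_bigr => z /(subsetP (comp_sub e U u)) zU.
by rewrite nbE.
Qed.

Lemma bushes_union F Fc U Y : [disjoint F & U] -> Fc \subset F ->
  {in U, forall u, nb F u = nb Fc u} -> [disjoint F :|: U & Y] ->
  {in Y, forall s, 2 <= #|nb Fc s|} ->
  bushes e 2 Fc (chains F U :|: singles Y) /\
  #|chains F U :|: singles Y| = #|chains F U| + #|Y|.
Proof.
move=> dFU sFc nbE dY degY.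
have [tI cn dj dg] := bushes_chains dFU sFc nbE.
have cY C s : C \in chains F U -> s \in Y -> [disjoint C & [set s]].
  move=> /imsetP[u _ ->] sY; rewrite disjoint_sym disjoints1.
  apply/negP=> /(subsetP (comp_sub _ _ _)) sU.
  by have := pred0P dY s; rewrite /= inE sU orbT sY.
split; first split.
- apply/trivIsetP=> C D /setUP[CP|/imsetP[s sY ->]] /setUP[DP|/imsetP[t tY ->]] ncd.
  + exact: (trivIsetP tI).
  + exact: cY.
  + by rewrite disjoint_sym cY.
  + by rewrite disjoints1 inE; apply: contra ncd => /eqP->.
- move=> C /setUP[/cn//|/imsetP[s _ ->]] x y /set1P-> /set1P->; exact: conn0.
- move=> C /setUP[/dj//|/imsetP[s sY ->]]; rewrite disjoint_sym disjoints1.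
  apply/negP=> /(subsetP sFc) sF.
  by have := pred0P dY s; rewrite /= inE sF sY.
- by move=> C /setUP[/dg//|/imsetP[s sY ->]]; rewrite ed1 degY.
rewrite cardsU (_ : _ :&: _ = set0) ?cards0 ?subn0.
  by rewrite [#|singles Y|](card_imset _ set1_inj).
apply/eqP; rewrite setI_eq0; apply/pred0P=> C /=; apply/negP=> /andP[CP /imsetP[s sY eC]].
by have := cY C s CP sY; rewrite eC disjoints1 inE eqxx.
Qed.

(* [Fc] discards the absorbed trees without any edge to the previous forest:
   they would only increase the number of components. *)
Definition phase1_weak F U L K := consistent F U /\ U \subset X /\
  exists Fc, [/\ Fc \subset F, {in U, forall u, nb F u = nb Fc u},
    {in out F U, forall s,
      2 <= #|nb Fc s| + #|[set w in nb U s | ed (comp U w) F == 1]| /\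
      #|[set w in nb U s | 2 <= ed (comp U w) F]| <= 1},
    2 * k + 2 * #|Fc| <= 2 * L + 2 * (#|chains F U| + #|out F U|) + ed Fc Fc
    & K = k - #|out F U| ].

(** With cc for vertices minus edges of [Fc], the numerical condition reads k + cc <= L + chains +
    discarded vertices. [phase1_weak] describes the state before absorption, where a neighbour in a
    piece with exactly one forest edge already counts as a future forest neighbour. *)
Definition phase1 F U L K := consistent F U /\ U \subset X /\
  {in U, forall u, 2 <= ed (comp U u) F} /\
  exists Fc, [/\ Fc \subset F, {in U, forall u, nb F u = nb Fc u},
    {in out F U, forall s, 2 <= #|nb Fc s| /\ #|nb U s| <= 1},
    2 * k + 2 * #|Fc| <= 2 * L + 2 * (#|chains F U| + #|out F U|) + ed Fc Fc
    & K = k - #|out F U| ].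

Lemma chains_abs F U : chains F U \subset chains (absF F U) (absU F U).
Proof.
apply/subsetP=> C /imsetP[u]; rewrite inE => /andP[uU /eqP E2] ->.
have uU' : u \in absU F U by rewrite !inE uU E2.
by rewrite -(comp_absU uU'); apply: imset_f; rewrite inE uU' ed_absF // E2.
Qed.

(** [Fc] receives only the absorbed trees with exactly one edge to [F]; by [bushes_edges] with m = 1
    this does not increase vertices minus edges. *)
Lemma phase1_abs F U L K : phase1_weak F U L K ->
  phase1 (absF F U) (absU F U) L K.
Proof.
move=> [ok [sUX [Fc [sFc nbE hS hL hK]]]].
have ok' := consistent_abs ok; have [_ _ _ dFU] := ok.
split=> //; split; first exact: subset_trans (subsetDl _ _) sUX.
split; first by move=> u; apply: absU_ge2.
pose A1 := [set u in U | ed (comp U u) F == 1].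
have sA1 : A1 \subset absorbed F U.
  by apply/subsetP=> u; rewrite !inE => /andP[-> /eqP->].
have dFcA : [disjoint Fc & A1].
  apply: disjointWl sFc _; apply: disjointWr dFU.
  by apply/subsetP=> u; rewrite inE => /andP[].
have eO : out (absF F U) (absU F U) = out F U by rewrite /out absFU.
have cA1 : cover [set comp U u | u in A1] = A1.
  apply/setP=> z; apply/bigcupP/idP => [[C /imsetP[u]]|zA]; last first.
    exists (comp U z); first exact: imset_f.
    by apply: comp_id; move: zA; rewrite inE => /andP[].
  rewrite inE => /andP[uU E1] ->; rewrite mem_comp inE => /andP[zU cuz].
  by rewrite zU -(comp_eq sym_e cuz).
have bA : bushes e 1 Fc [set comp U u | u in A1].
  split; first exact: comps_triv.
  - by move=> C /imsetP[u _ ->]; apply: comp_connected.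
  - move=> C /imsetP[u uA ->]; apply: disjoint_sub dFcA _.
    apply/subsetP=> z zC; rewrite -cA1; apply/bigcupP.
    by exists (comp U u); first exact: imset_f.
  move=> C /imsetP[u + ->]; rewrite inE => /andP[uU /eqP <-].
  apply: eq_leq; apply: eq_bigr => z /(subsetP (comp_sub e U u)) zU.
  by rewrite nbE.
exists (Fc :|: A1); split=> //.
- by apply: setUSS.
- move=> u uU'; have uU : u \in U by move: uU'; rewrite inE => /andP[].
  rewrite (nb_absF uU' (subxx _)) nbE //; apply/setP=> z; rewrite !inE.
  case zc: (z \in Fc) => //=; apply/esym/negP=> /andP[/andP[zU E1] uz].
  have : u \in absorbed F U.
    by apply: (absorbed_closed (a := z)) uU _; rewrite ?inE ?zU ?(eqP E1) // sym_e.
  by case/setDP: uU' => _ /negP.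
- move=> s; rewrite eO => /hS[h1 h2]; split.
    apply: leq_trans h1 _; rewrite -cardsUI (_ : _ :&: _ = set0) ?cards0 ?addn0.
      apply: subset_leq_card; apply/subsetP=> z; rewrite !inE.
      by case/orP=> [/andP[-> ->]|/andP[/andP[-> ->] ->]]; rewrite ?orbT.
    apply/eqP; rewrite setI_eq0; apply/pred0P=> z /=; rewrite !inE.
    apply/negP=> /andP[/andP[/(subsetP sFc) zF _] /andP[/andP[zU _] _]].
    by have := pred0P dFU z; rewrite /= zF zU.
  apply: leq_trans h2; apply: subset_leq_card; apply/subsetP=> z; rewrite !inE.
  by case/andP=> /andP[+ zU] ->; rewrite zU /= -ltnNge => ->.
- rewrite eO; have := bushes_edges sym_e irr_e bA; rewrite cA1.
  have := subset_leq_card (chains_abs F U); move: hL; lia.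
- by rewrite eO.
Qed.

(** With [L = 0], the chains and the discarded vertices are at least k + cc bushes, of which [W]
    keeps at most cc whole. *)
Lemma phase1_leaf F U K W : phase1 F U 0 K -> F \subset W -> acyc W ->
  k <= #|~: W|.
Proof.
move=> [ok [sUX [_ [Fc [sFc nbE hS hL _]]]]] sFW aW; have [_ _ _ dFU] := ok.
have dO : [disjoint F :|: U & out F U].
  by rewrite disjoint_sym -setI_eq0 setIDAC setDIl setDv setI0.
have [bO cO] := bushes_union dFU sFc nbE dO (fun s sO => proj1 (hS s sO)).
have := bushes_out sym_e irr_e bO (subset_trans sFc sFW) aW; rewrite cO.
have : #|cover (chains F U :|: singles (out F U)) :\: W| <= #|~: W|.
  by apply: subset_leq_card; apply/subsetP=> z; rewrite !inE => /andP[].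
by move: hL; lia.
Qed.

Lemma nb_comp_out U u p : p \in U -> p \notin comp U u ->
  {in comp U u, forall z, ~~ e z p}.
Proof.
move=> pU pC z zC; apply: contra pC => zp; exact: comp_closed zC pU zp.
Qed.

Lemma ed_setU1 (C : {set T}) F p : p \notin F ->
  ed C (p |: F) = ed C F + \sum_(z in C) e z p.
Proof.
move=> pF; rewrite /ed -big_split /=; apply: eq_bigr => z _.
case zp: (e z p).
  rewrite (_ : nb (p |: F) z = p |: nb F z) ?cardsU1 ?inE ?(negPf pF) 1?addnC //.
  by apply/setP=> y; rewrite !inE; case: eqP => // ->; rewrite zp.
rewrite addn0; congr #|pred_of_set _|; apply/setP=> y; rewrite !inE.
by case: eqP => //= ->; rewrite zp andbF.
Qed.

Lemma sum_piece1 U p w : acyc U -> p \in U -> w \in nb U p ->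
  \sum_(z in comp (U :\ p) w) e z p = 1.
Proof.
move=> aU pU wp; have wC : w \in comp (U :\ p) w by apply: comp_id; apply: nb_in.
rewrite (bigD1 w) //= big1 => [|z /andP[zC nzw]].
  by rewrite sym_e; move: wp; rewrite in_nb => /andP[_ ->].
apply/eqP; rewrite eqb0; apply: contra nzw => zp; apply/eqP.
apply: (piece_nin sym_e irr_e aU pU wp) => //; rewrite in_nb sym_e zp andbT.
by have := subsetP (comp_sub _ _ _) z zC; rewrite inE => /andP[].
Qed.

Lemma ed_comp_del F U u p : p \in U -> p \notin F -> p \notin comp U u ->
  ed (comp (U :\ p) u) (p |: F) = ed (comp U u) F.
Proof.
move=> pU pF pC; rewrite comp_del // ed_setU1 // big1 ?addn0 // => z zC.
by apply/eqP; rewrite eqb0; apply: nb_comp_out zC.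
Qed.

Lemma consistent_F F U p : consistent F U -> p \in U -> p \in M ->
  consistent (p |: F) (U :\ p).
Proof.
move=> [sFM sMH aU dFU] pU pM; split.
- by rewrite subUset sub1set pM.
- by rewrite -setUA [F :|: _]setUC setUA setD1K // setUC.
- exact: acyc_mono (subsetDl _ _) aU.
rewrite -setI_eq0; apply/eqP/setP=> z; rewrite !inE; case: eqP => //= _.
by have := pred0P dFU z.
Qed.

Lemma consistent_S F U p : consistent F U -> p \in U -> p \notin M ->
  consistent F (U :\ p).
Proof.
move=> [sFM sMH aU dFU] pU pM; split=> //.
- apply/subsetP=> z zM; have := subsetP sMH z zM; rewrite !inE.
  by rewrite (_ : z != p) //; apply: contraNneq pM => <-.
- exact: acyc_mono (subsetDl _ _) aU.
by apply: disjoint_sub dFU (subsetDl _ _).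
Qed.

Lemma setU1D1 F U p : p \in U -> (p |: F) :|: (U :\ p) = F :|: U.
Proof. by move=> pU; rewrite -setUA [F :|: _]setUC setUA setD1K // setUC. Qed.

(** Old chains survive because the tree of [p] has three forest edges and is none of them; every
    piece with one forest edge becomes a chain through its edge to [p]. *)
Lemma chains_F F U p : acyc U -> p \in U -> p \notin F -> 3 <= ed (comp U p) F ->
  #|chains F U| + #|[set w in nb U p | ed (comp (U :\ p) w) F == 1]| <=
  #|chains (p |: F) (U :\ p)|.
Proof.
move=> aU pU pF E3; set N := [set w in _ | _].
pose P' := [set comp (U :\ p) w | w in N].
have NU w : w \in N -> w \in nb U p by rewrite inE => /andP[].
have cP' : #|P'| = #|N|.
  apply: card_in_imset => w w' wN w'N eC; apply/esym.
  apply: (piece_nin sym_e irr_e aU pU) => //; try exact: NU.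
  by rewrite eC; apply: comp_id; apply: nb_in => //; apply: NU.
have pC u : ed (comp U u) F == 2 -> p \notin comp U u.
  apply: contraTN; rewrite mem_comp => /andP[_ c]; rewrite (comp_eq sym_e c).
  by move: E3; case: (ed _ _) => [|[|[]]].
rewrite -cP' -cardsUI (_ : _ :&: _ = set0) ?cards0 ?addn0; last first.
  apply/eqP; rewrite setI_eq0; apply/pred0P=> C /=; apply/negP.
  case/andP=> /imsetP[u]; rewrite inE => /andP[uU E2] -> /imsetP[w wN eC].
  have wp := NU w wN; have := pC u E2.
  have wC : w \in comp U u by rewrite eC; apply: comp_id; apply: nb_in.
  case/negP; apply: comp_closed wC pU _.
  by rewrite sym_e; move: wp; rewrite in_nb => /andP[].
apply: subset_leq_card; apply/subsetP=> C /setUP[/imsetP[u uS]|/imsetP[w wN]] ->.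
  move: uS; rewrite inE => /andP[uU E2]; rewrite -(comp_del sym_e (pC u E2)); apply: imset_f.
  rewrite !inE uU ed_comp_del ?pC ?E2 // !andbT.
  by apply: contraNneq (pC u E2) => <-; apply: comp_id.
apply: imset_f; rewrite inE (nb_in irr_e (NU w wN)) ed_setU1 //.
rewrite sum_piece1 ?NU //; move: wN; rewrite inE => /andP[_ /eqP->].
by rewrite addn1.
Qed.

Lemma chains_S F U p : p \in U -> 3 <= ed (comp U p) F ->
  #|chains F U| <= #|chains F (U :\ p)|.
Proof.
move=> pU E3; apply: subset_leq_card; apply/subsetP=> C /imsetP[u].
rewrite inE => /andP[uU E2] ->.
have pC : p \notin comp U u.
  apply: contraTN E2; rewrite mem_comp => /andP[_ c]; rewrite (comp_eq sym_e c).
  by move: E3; case: (ed _ _) => [|[|[]]].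
rewrite -(comp_del sym_e pC); apply: imset_f; rewrite !inE uU comp_del // E2 !andbT.
by apply: contraNneq pC => <-; apply: comp_id.
Qed.

(** Vertices minus edges changes by 1 minus the number of forest neighbours of [p], and each counted
    piece is a new chain; [pivot] makes the total gain at least one, which pays for the unit of
    [L]. *)
Lemma phase1_F F U L K p : phase1 F U L.+1 K -> p \in U -> p \in M ->
  3 <= ed (comp U p) F -> pivot e F U p ->
  phase1_weak (p |: F) (U :\ p) L K.
Proof.
move=> [ok [sUX [_ [Fc [sFc nbE hS hL hK]]]]] pU pM E3 pv; have [_ _ aU dFU] := ok.
have pF : p \notin F by apply: notinF dFU _ pU.
have pFc : p \notin Fc by apply: contra pF; apply: (subsetP sFc).
split; first exact: consistent_F.
split; first exact: subset_trans (subsetDl _ _) sUX.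
have eO : out (p |: F) (U :\ p) = out F U by rewrite /out setU1D1.
exists (p |: Fc); rewrite eO; split=> //.
- exact: setUS.
- move=> u; rewrite inE => /andP[_ uU]; apply/setP=> z; have /setP/(_ z) := nbE u uU.
  by rewrite !inE; case: eqP.
- move=> s /hS[h1 h2]; split.
    apply: leq_trans h1 _; apply: leq_trans (leq_addr _ _).
    by apply: subset_leq_card; apply: nb_sub; apply: subsetUr.
  apply: leq_trans h2; apply: subset_leq_card; apply/subsetP=> z.
  by rewrite !inE => /andP[/andP[/andP[_ ->] ->]].
rewrite cardsU1 pFc ed_add //.
have := chains_F aU pU pF E3; move: pv hL; rewrite /pivot nbE //; lia.
Qed.

(** The discarded vertex is itself the gain that pays for [L]; [pivot] and [light] are the two
    conditions imposed on members of [out]. *)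
Lemma phase1_S F U L K p : phase1 F U L.+1 K -> p \in U -> p \notin M ->
  3 <= ed (comp U p) F -> pivot e F U p -> light e F U p ->
  phase1_weak F (U :\ p) L K.-1.
Proof.
move=> [ok [sUX [_ [Fc [sFc nbE hS hL hK]]]]] pU pM E3 pv lt; have [_ _ aU dFU] := ok.
have pF : p \notin F by apply: notinF dFU _ pU.
split; first exact: consistent_S.
split; first exact: subset_trans (subsetDl _ _) sUX.
have eO : out F (U :\ p) = p |: out F U.
  apply/setP=> z; rewrite !inE; case: eqP => [->|_] //=.
  by rewrite (negPf pF) (subsetP sUX).
have pO : p \notin out F U by rewrite !inE pU orbT.
have cO : #|out F (U :\ p)| = #|out F U|.+1 by rewrite eO cardsU1 pO.
exists Fc; split=> //.
- by move=> u; rewrite inE => /andP[_ uU]; apply: nbE.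
- move=> s; rewrite eO => /setU1P[->|/hS[h1 h2]].
    by rewrite !nbD1 // -nbE //; split.
  split; first exact: leq_trans h1 (leq_addr _ _).
  apply: leq_trans h2; apply: subset_leq_card; apply/subsetP=> z.
  by rewrite !inE => /andP[/andP[/andP[_ ->] ->]].
- by have := chains_S pU E3; rewrite cO; lia.
- by rewrite cO hK; lia.
Qed.

(** [L] starts with one unit for each vertex of [M :\: X], regarded as a tree of its own. *)
Lemma phase1_init : phase1_weak (M :\: X) X (k + #|M :\: X|) k.
Proof.
split; first split=> //.
- exact: subsetDl.
- by apply/subsetP=> z; rewrite !inE => ->; case: (z \in X).
- by rewrite -setI_eq0 setIDAC setDIl setDv setI0.
split=> //; have eO : out (M :\: X) X = set0.
  by apply/setP=> z; rewrite !inE; case: (z \in X); rewrite ?orbT ?andbF.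
exists (M :\: X); rewrite eO cards0; split=> //; last by rewrite subn0.
  by move=> s; rewrite inE.
by lia.
Qed.

End Guided.

(** * The second phase: every undecided tree has exactly two edges to the forest *)

Section Guided2.
Variables (T : finType) (e : rel T).
Hypotheses (sym_e : symmetric e) (irr_e : irreflexive e).
Variables (M X : {set T}) (k : nat).
Hypotheses (acM : acyc e M) (maxM : forall u, u \notin M -> blocked e M u)
  (kM : k <= #|~: M|) (acX : acyc e X).
Implicit Types (F Fc U W Y Z : {set T}) (x y z u v w f g p s : T).
Local Notation conn := (conn e).
Local Notation comp := (compt e).
Local Notation acyc := (acyc e).
Local Notation blocked := (blocked e).
Local Notation nb := (nb e).
Local Notation ed := (ed e).
Local Notation absF := (absF e).
Local Notation absU := (absU e).
Local Notation pivot := (pivot e).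
Local Notation consistent := (consistent e M).

(** By [maximal_spans] the two neighbours are connected in every maximal forest between [F] and
    [F :|: U], so no such forest can be extended by [s]. *)
Definition sat F U s :=
  [exists y, exists y', [&& y != y', y \in nb F s, y' \in nb F s
                          & conn (F :|: U) y y']].
(** The second alternative anticipates the first: once rule A is exhausted, every settled vertex
    satisfies [sat] ([settled_sat]). *)
Definition settled F U : {set T} :=
  [set s in ~: (F :|: U) | sat F U s || (#|nb U s| <= 1)].
(** [y] hangs at the pivot [v], so taking [v] absorbs [y]. The case [y = v] is included, the
    component being empty then. *)
Definition serve F U v y :=
  [&& v \in U, y \in U, pivot F U v & ed (comp (U :\ v) y) F == 0].
(** Rule A forces [v] into [M]. Rule B branches on the vertex serving one witness of [s]; once that
    witness is in [F], rule C branches on the vertex serving the other one. *)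
Definition ruleA F U s v :=
  [&& s \notin F :|: U, ~~ sat F U s, #|nb U s| == 1
    & [exists y in nb U s, serve F U v y]].
Definition ruleB F U s v :=
  [&& s \notin F :|: U, ~~ sat F U s
    & [exists y in nb U s, serve F U v y &&
        [exists y' in nb (F :|: U) s, (y' != y) && conn (F :|: U) y y']]].
Definition ruleC F U s v :=
  [exists y in nb U s, serve F U v y &&
        [exists y' in nb F s, conn (F :|: U) y y']].

Definition narrow2 F U := {in U, forall u, ed (comp U u) F <= 2}.
(** [K] vertices are wanted besides the settled ones, and [L] bounds the part of them that the loss
    inside [U], common to all maximal forests, does not supply. *)
Definition phase2 F U L K := consistent F U /\
  {in U, forall u, ed (comp U u) F = 2} /\
  k <= #|settled F U| + K /\ K <= L + #|U :\: M|.

Lemma satP F U s : reflect (exists y y', [/\ y != y', y \in nb F s, y' \in nb F s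
  & conn (F :|: U) y y']) (sat F U s).
Proof.
apply: (iffP existsP) => [[y /existsP[y' /and4P[*]]]|[y [y' [*]]]].
  by exists y, y'.
by exists y; apply/existsP; exists y'; apply/and4P.
Qed.

(** All discarded vertices are settled. Applied to [M] and the chains alone, [bushes_out] bounds the
    loss inside [U] from below, and the first-phase inequality becomes the bound on [K]. *)
Lemma phase1_phase2 F U L K : phase1 e M X k F U L K ->
  {in U, forall u, ed (comp U u) F <= 2} -> phase2 F U L K.
Proof.
move=> [ok [sUX [ge2 [Fc [sFc nbE hS hL hK]]]]] le2; have [sFM _ _ dFU] := ok.
split=> //; split; first by move=> u uU; apply/eqP; rewrite eqn_leq le2 ?ge2.
split.
  rewrite hK; have : #|out X F U| <= #|settled F U|; last by lia.
  apply: subset_leq_card; apply/subsetP=> s sO; have [_ d1] := hS s sO.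
  by rewrite inE d1 orbT andbT; move: sO; rewrite !inE => /andP[].
have := bushes_out sym_e irr_e (bushes_chains sym_e dFU sFc nbE)
  (subset_trans sFc sFM) acM.
have : #|cover (chains e F U) :\: M| <= #|U :\: M|.
  by apply/subset_leq_card/setSD/chains_sub.
by rewrite hK; lia.
Qed.

Lemma sat_spans F U s : consistent F U -> narrow2 F U -> sat F U s ->
  exists y y', [/\ y != y', y \in nb F s, y' \in nb F s & conn M y y'].
Proof.
move=> [sFM sMH aU dFU] nar /satP[y [y' [nyy yF y'F c]]]; exists y, y'; split=> //.
apply: (maximal_spans sym_e irr_e aU dFU nar) => //.
- by move=> u; rewrite inE => /andP[uM _]; apply: maxM.
- by move: yF; rewrite in_nb => /andP[].
- by move: y'F; rewrite in_nb => /andP[].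
Qed.

Lemma sat_grow F U F' U' s : consistent F U -> narrow2 F U -> F \subset F' ->
  M \subset F' :|: U' -> sat F U s -> sat F' U' s.
Proof.
move=> ok nar sFF sMH /(sat_spans ok nar)[y [y' [nyy yF y'F c]]].
apply/satP; exists y, y'; split=> //; try exact: (subsetP (nb_sub _ _ sFF)).
exact: conn_mono c.
Qed.

Lemma settled_grow F U F' U' : consistent F U -> narrow2 F U -> F \subset F' ->
  M \subset F' :|: U' -> U' \subset U -> F' :|: U' \subset F :|: U ->
  settled F U \subset settled F' U'.
Proof.
move=> ok nar sFF sMH sUU sHH; apply/subsetP=> s; rewrite !inE => /andP[sH].
have -> /= : ~~ ((s \in F') || (s \in U')).
  by apply: contra sH => sH'; have := subsetP sHH s; rewrite !inE; apply.
case/orP=> [/(sat_grow ok nar sFF sMH)->//|d1]; apply/orP; right.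
by apply: leq_trans d1; apply: subset_leq_card; apply: nb_sub.
Qed.

(** The pivot condition already accounts for both edges, with at most one in each piece. *)
Lemma pivot_pieces F U v : acyc U -> v \in U -> ed (comp U v) F = 2 ->
  pivot F U v -> {in nb U v, forall w, ed (comp (U :\ v) w) F <= 1}.
Proof.
move=> aU vU E2 pv w wv; rewrite leqNgt; apply/negP=> hw.
move: pv; rewrite /pivot leqNgt => /negP[]; rewrite -E2 ed_pieces //.
rewrite ltn_add2l (_ : #|_| = \sum_(z in nb U v) (ed (comp (U :\ v) z) F == 1)).
  rewrite (big_setD1 w) //= [ltnRHS](big_setD1 w) //= gtn_eqF // add0n.
  rewrite -add1n leq_add // ?(ltnW hw) //.
  by apply: leq_sum => z _; case: (ed _ _) => [|[]].
rewrite -sum1_card big_mkcond [RHS]big_mkcond /=.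
by apply: eq_bigr => z _; rewrite inE; case: (z \in _) => //=; case: eqP.
Qed.

Lemma served_comp F U v y : {in U, forall u, ed (comp U u) F = 2} ->
  serve F U v y -> v \in comp U y.
Proof.
move=> E2 /and4P[vU yU _ /eqP E0]; apply: contraT => vC.
by have := E2 y yU; rewrite -(comp_del sym_e vC) E0.
Qed.

Section Step.
Variables (F U : {set T}) (L K : nat) (v : T).
Hypotheses (inv : phase2 F U L K) (vU : v \in U) (pv : pivot F U v).
Let ok : consistent F U := proj1 inv.
Let E2 : {in U, forall u, ed (comp U u) F = 2} := proj1 (proj2 inv).
Let nar : narrow2 F U. Proof. by move=> u /E2->. Qed.
Let aU : acyc U. Proof. by case: ok. Qed.
Let vF : v \notin F. Proof. by case: ok => _ _ _ d; apply: notinF d _ vU. Qed.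

(** A piece at [v] had at most one forest edge and gains the one to [v]; the other trees are
    unaffected. *)
Lemma narrow_F : narrow2 (v |: F) (U :\ v).
Proof.
move=> u /setD1P[nuv uU]; have [vC|vC] := boolP (v \in comp U u); last first.
  by rewrite ed_comp_del // E2.
have uC : u \in comp U v.
  by move: vC; rewrite !mem_comp uU conn_sym // => /andP[].
have [w wv uw] := piece_ex sym_e vU uC nuv.
have -> : comp (U :\ v) u = comp (U :\ v) w.
  by apply/esym/comp_eq => //; move: uw; rewrite mem_comp => /andP[].
rewrite ed_setU1 // sum_piece1 // addn1 ltnS.
by apply: pivot_pieces wv => //; apply: E2.
Qed.

Lemma narrow_S : narrow2 F (U :\ v).
Proof.
move=> u uU'; apply: leq_trans (narrow_F uU'); apply: leq_sum => z _.
by apply: subset_leq_card; apply: nb_sub; apply: subsetUr.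
Qed.

Lemma abs_eq2 F' U' : narrow2 F' U' ->
  {in absU F' U', forall u, ed (comp (absU F' U') u) (absF F' U') = 2}.
Proof.
move=> nar' u uU; apply/eqP; rewrite eqn_leq absU_ge2 // andbT ed_absF //.
by apply: nar'; move: uU; rewrite inE => /andP[].
Qed.

Lemma absU_M F' U' : consistent F' U' -> absU F' U' :\: M = U' :\: M.
Proof.
move=> /(absorbed_M sym_e irr_e maxM) sAM; apply/setP=> z; rewrite !in_setD.
by have [//|zM] := boolP (z \in M); rewrite /= (contra (subsetP sAM z) zM).
Qed.

Lemma settled_step_F : v \in M ->
  settled F U \subset settled (absF (v |: F) (U :\ v)) (absU (v |: F) (U :\ v)).
Proof.
move=> vM; have [sFM sMH _ _] := ok.
apply: settled_grow => //; rewrite ?absFU ?setU1D1 //.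
  by apply: subset_trans (subsetUr [set v] _) (subsetUl _ _).
by apply: subset_trans (subsetDl _ _) (subsetDl _ _).
Qed.

Lemma phase2_F L' K' : v \in M ->
  k <= #|settled (absF (v |: F) (U :\ v)) (absU (v |: F) (U :\ v))| + K' ->
  K' <= L' + #|U :\: M| ->
  phase2 (absF (v |: F) (U :\ v)) (absU (v |: F) (U :\ v)) L' K'.
Proof.
move=> vM hk hK; have okF := consistent_F ok vU vM.
split; first exact: consistent_abs.
split; first by apply: abs_eq2; apply: narrow_F.
split=> //; rewrite absU_M //; have -> // : (U :\ v) :\: M = U :\: M.
by apply/setP=> z; rewrite !inE; case: eqP => // ->; rewrite vM.
Qed.

(** After absorption [v] has no undecided neighbour, since its pieces have at most one forest edge;
    so [v] is newly settled and pays for the unit of [K]. The loss inside [U] drops by one with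
    it. *)
Lemma phase2_S : 0 < K -> v \notin M ->
  phase2 (absF F (U :\ v)) (absU F (U :\ v)) L K.-1.
Proof.
move=> K0 vM; have okS := consistent_S ok vU vM.
have ok' := consistent_abs sym_e irr_e maxM okS.
have [_ [_ [hk hK]]] := inv; have [_ sMH' _ _] := ok'.
split=> //; split; first by apply: abs_eq2; apply: narrow_S.
split; last first.
  rewrite absU_M //; move: hK; rewrite (cardsD1 v) !inE vU vM /=.
  have -> : (U :\: M) :\ v = (U :\ v) :\: M by apply/setP=> z; rewrite !inE andbCA.
  by lia.
have vH : v \notin absF F (U :\ v) :|: absU F (U :\ v).
  by rewrite absFU !inE eqxx (negPf vF).
have vS : v \in settled (absF F (U :\ v)) (absU F (U :\ v)).
  rewrite inE inE vH /=; apply/orP; right.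
  rewrite (_ : nb _ v = set0) ?cards0 //; apply/setP=> w; rewrite inE [w \in set0]inE.
  apply/negP=> /andP[wU' vw].
  have := absU_ge2 sym_e wU'; rewrite ed_absF //; apply/negP; rewrite -ltnNge ltnS.
  have wU : w \in U by move: wU'; rewrite !inE => /and3P[].
  by apply: (pivot_pieces aU vU (E2 vU) pv); rewrite in_nb wU.
have sub : v |: settled F U \subset settled (absF F (U :\ v)) (absU F (U :\ v)).
  rewrite subUset sub1set vS; apply: settled_grow => //.
  - exact: subsetUl.
  - by apply: subset_trans (subsetDl _ _) (subsetDl _ _).
  - by rewrite absFU; apply: setUS; apply: subsetDl.
have := subset_leq_card sub; rewrite cardsU1.
have -> : v \notin settled F U by rewrite !inE vU orbT.
by move: hk K0; case: (K) => //=; lia.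
Qed.

(** The piece of [y] had no forest edge, and the edge to [v] is now its only one. *)
Lemma served_absorbed y : serve F U v y -> y \in absF (v |: F) (U :\ v).
Proof.
move=> sv; have vC := served_comp E2 sv; case/and4P: sv => _ yU _ /eqP E0.
rewrite !in_setU in_set1; have [//|nyv] := eqVneq y v; apply/orP; right.
rewrite inE !inE nyv yU /=.
have yC : y \in comp U v.
  by move: vC; rewrite !mem_comp yU conn_sym // => /andP[].
have [w wv yw] := piece_ex sym_e vU yC nyv.
have ew : comp (U :\ v) y = comp (U :\ v) w.
  by apply/esym/comp_eq => //; move: yw; rewrite mem_comp => /andP[].
by rewrite ed_setU1 // E0 ew sum_piece1.
Qed.

End Step.

Section Choice.
Variables (F U : {set T}) (L K : nat).
Hypothesis inv : phase2 F U L K.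
Let ok : consistent F U := proj1 inv.
Let E2 : {in U, forall u, ed (comp U u) F = 2} := proj1 (proj2 inv).
Let nar : narrow2 F U. Proof. by move=> u /E2->. Qed.
Let aU : acyc U. Proof. by case: ok. Qed.

Lemma out_blocked s : s \notin F :|: U -> exists y y',
  [/\ y != y', y \in nb M s, y' \in nb M s & conn M y y'].
Proof.
have [_ sMH _ _] := ok => sH; have sM : s \notin M by apply: contra sH; apply: (subsetP sMH).
have /blockedP[y [y' [nyy [sy sy'] yM y'M c]]] := maxM sM.
by exists y, y'; rewrite !in_nb yM y'M.
Qed.

Lemma unsat_U s y y' : ~~ sat F U s -> y != y' -> y \in nb M s -> y' \in nb M s ->
  conn M y y' -> (y \in U) || (y' \in U).
Proof.
have [_ sMH _ _] := ok => ns nyy; rewrite !in_nb => /andP[yM sy] /andP[y'M sy'] c.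
apply: contraR ns; rewrite negb_or => /andP[yU y'U]; apply/satP; exists y, y'.
have := subsetP sMH y yM; have := subsetP sMH y' y'M.
rewrite !inE (negPf yU) (negPf y'U) !orbF => -> ->; split=> //.
exact: conn_mono c.
Qed.

(** Without [v], the piece of [y] is cut off from [F]. But an unsatisfied [s] must be blocked
    through [y], its only undecided neighbour, and the other witness would have to lie in that piece
    too. *)
Lemma ruleA_M s v : ruleA F U s v -> v \in M.
Proof.
have [sFM sMH _ dFU] := ok.
case/and4P=> sH ns /cards1P[y0 ey0] /exists_inP[y yU sv]; apply: contraT => vM.
have [z [z' [nzz zs z's c]]] := out_blocked sH.
have /and4P[vU yU' pv /eqP E0] := sv.
have eU t : t \in nb M s -> t \in U -> t = y.
  rewrite in_nb => /andP[_ st] tU; have : t \in nb U s by rewrite in_nb tU.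
  by rewrite ey0 => /set1P->; move: yU; rewrite ey0 => /set1P.
have sMv : M \subset (F :|: U) :\ v.
  apply/subsetP=> t tM; rewrite in_setD1 (subsetP sMH) // andbT.
  by apply: contraNneq vM => <-.
have key t : t != y -> t \in nb M s -> y \in M -> conn M y t -> false.
  move=> nty ts yM cyt.
  have yv : y \in U :\ v.
    by rewrite in_setD1 yU' andbT; apply: contraNneq vM => <-.
  have := hanging_closed yv E0 (conn_mono sMv cyt).
  rewrite mem_comp => /andP[/setD1P[_ tU] _].
  by rewrite (eU t ts tU) eqxx in nty.
have inM t : t \in nb M s -> t \in M by rewrite in_nb => /andP[].
case/orP: (unsat_U ns nzz zs z's c) => zU.
  have ez := eU z zs zU; subst z.
  by apply: (key z') => //; rewrite 1?eq_sym ?inM.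
have ez := eU z' z's zU; subst z'.
by apply: (key z) => //; rewrite ?inM // conn_sym.
Qed.

Lemma serve_ex y : y \in U -> exists v, serve F U v y.
Proof.
move=> yU; have [v [vU pv E0]] := serve_exists sym_e irr_e aU yU (E2 yU).
by exists v; rewrite /serve vU yU pv E0.
Qed.

(** An unsatisfied settled vertex is blocked by [M] through exactly one undecided neighbour, and a
    vertex serving that neighbour triggers rule A. *)
Lemma settled_sat : (forall s v, ~~ ruleA F U s v) ->
  {in settled F U, forall s, sat F U s}.
Proof.
move=> noA s; rewrite inE inE => /andP[sH /orP[//|d1]]; apply: contraT => ns.
have [y [y' [nyy ys y's c]]] := out_blocked sH.
have [t tU] : exists t, t \in nb U s.
  case/orP: (unsat_U ns nyy ys y's c) => tU; [exists y|exists y'].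
    by move: ys; rewrite !in_nb tU => /andP[].
  by move: y's; rewrite !in_nb tU => /andP[].
have tU' : t \in U by move: tU; rewrite in_nb => /andP[].
have [v sv] := serve_ex tU'.
case/negP: (noA s v); rewrite /ruleA sH ns /=; apply/andP; split.
  by rewrite eqn_leq d1; apply/card_gt0P; exists t.
by apply/exists_inP; exists t.
Qed.

Lemma ruleB_ex s : s \notin F :|: U -> ~~ sat F U s -> exists v, ruleB F U s v.
Proof.
have [_ sMH _ _] := ok => sH ns; have [y [y' [nyy ys y's c]]] := out_blocked sH.
have cH : conn (F :|: U) y y' := conn_mono sMH c.
have sub t : t \in nb M s -> t \in nb (F :|: U) s by apply: (subsetP (nb_sub _ _ sMH)).
have nbU t : t \in nb M s -> t \in U -> t \in nb U s.
  by rewrite !in_nb => /andP[_ ->] ->.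
case/orP: (unsat_U ns nyy ys y's c) => tU.
  have [v sv] := serve_ex tU; exists v; rewrite /ruleB sH ns /=; apply/exists_inP.
  exists y; first exact: nbU.
  by rewrite sv; apply/exists_inP; exists y'; rewrite ?sub // eq_sym nyy.
have [v sv] := serve_ex tU; exists v; rewrite /ruleB sH ns /=; apply/exists_inP.
exists y'; first exact: nbU.
by rewrite sv; apply/exists_inP; exists y; rewrite ?sub // nyy conn_sym.
Qed.

(** Inside [F :|: U] the forest [W] is maximal, so it omits at least [#|U :\: M|] vertices of [U],
    and all satisfied vertices as well. If [L = 0], that loss covers [K]; if [K = 0], the settled
    vertices suffice; without rule B all discarded vertices are satisfied and [W] omits as many
    vertices as [M]. *)
Lemma phase2_leaf W : (forall s v, ~~ ruleA F U s v) ->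
  L = 0 \/ K = 0 \/ (forall s v, ~~ ruleB F U s v) ->
  acyc W -> F \subset W ->
  {in (F :|: U) :\: W, forall u, blocked (W :&: (F :|: U)) u} -> k <= #|~: W|.
Proof.
move=> noA stop aW sFW blW; have [_ [_ [hk hK]]] := inv.
have [sFM sMH _ dFU] := ok; set H := F :|: U in blW sMH *.
set W1 := W :&: H in blW.
have sW1H : W1 \subset H := subsetIr _ _.
have sFW1 : F \subset W1 by rewrite subsetI sFW subsetUl.
have aW1 : acyc W1 := acyc_mono (subsetIl _ _) aW.
have cW : #|W1| <= #|M|.
  apply: (maximal_card sym_e irr_e aU nar) => //.
  by move=> u; rewrite inE => /andP[uM _]; apply: maxM.
have cU Y : F \subset Y -> Y \subset H -> #|U :\: Y| = #|H| - #|Y|.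
  move=> sFY sYH; rewrite -[in RHS](setIidPr sYH) -cardsD; apply: eq_card => z.
  rewrite !inE; have [zF|] := boolP (z \in F) => //=.
  by rewrite (subsetP sFY).
have cUM : #|U :\: M| <= #|U :\: W1|.
  by rewrite (cU M) // (cU W1) // leq_sub2l.
pose S1 := [set s in ~: H | sat F U s].
have S1W : S1 \subset ~: W.
  apply/subsetP=> s; rewrite inE inE => /andP[sH /satP[y [y' [nyy ys y's c]]]].
  rewrite inE; apply/negP=> sW; case/negP: (acyc_unblocked sym_e aW sW).
  have sW1s : W1 \subset W :\ s.
    apply/subsetP=> z; rewrite !inE => /andP[-> zH]; rewrite andbT.
    by apply: contraNneq sH => <-; rewrite inE.
  move: ys y's; rewrite !in_nb => /andP[yF sy] /andP[y'F sy'].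
  have c1 : conn W1 y y'.
    apply: (maximal_spans sym_e irr_e aU dFU nar) => // u /setDP[uH uW1].
    apply: blW; rewrite in_setD uH andbT; apply: contra uW1 => uW.
    by rewrite inE uW.
  apply/blockedP; exists y, y'; split=> //; try exact: conn_mono c1.
    by apply: (subsetP sW1s); apply: (subsetP sFW1).
  by apply: (subsetP sW1s); apply: (subsetP sFW1).
have : #|S1| + #|U :\: W1| <= #|~: W|.
  rewrite -cardsUI (_ : S1 :&: _ = set0) ?cards0 ?addn0; last first.
    by apply/setP=> z; rewrite !inE; case: (z \in U); rewrite ?orbT ?andbF.
  apply: subset_leq_card; rewrite subUset S1W; apply/subsetP=> z.
  rewrite !inE => /andP[+ zU]; rewrite zU orbT andbT; exact.
have : #|settled F U| <= #|S1|.
  apply: subset_leq_card; apply/subsetP=> s sS; rewrite inE settled_sat // andbT.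
  by move: sS; rewrite inE => /andP[].
case: stop => [L0|[K0|noB]]; [by lia|by lia|].
have : #|~: H| <= #|S1|.
  apply: subset_leq_card; apply/subsetP=> s; rewrite inE => sH; rewrite !inE -in_setU sH.
  by apply: contraT => /(ruleB_ex sH)[v rB]; rewrite (negPf (noB s v)) in rB.
have := cU M sFM sMH; have := subset_leq_card sMH.
by have := cardsC H; have := cardsC M; lia.
Qed.

Lemma ruleA_serve s v : ruleA F U s v -> v \in U /\ pivot F U v.
Proof. by case/and4P=> _ _ _ /exists_inP[y _ /and4P[]]. Qed.

Lemma ruleB_serve s v : ruleB F U s v -> v \in U /\ pivot F U v.
Proof. by case/and3P=> _ _ /exists_inP[y _ /andP[/and4P[]]]. Qed.

Lemma ruleC_serve s v : ruleC F U s v -> v \in U /\ pivot F U v.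
Proof. by case/exists_inP=> y _ /andP[/and4P[]]. Qed.

Lemma ruleB_unsettled s v : (forall s v, ~~ ruleA F U s v) -> ruleB F U s v ->
  s \notin settled F U.
Proof.
move=> noA /and3P[sH ns _]; apply: contra ns; exact: settled_sat.
Qed.

End Choice.

(* After [v] has joined the forest, the served neighbour of [s] lies in it, so
   either [s] is satisfied or its second witness is still undecided. *)
Lemma ruleB_F F U L K s v : phase2 F U L K -> ruleB F U s v -> v \in M ->
  let F' := absF (v |: F) (U :\ v) in let U' := absU (v |: F) (U :\ v) in
  phase2 F' U' L K -> sat F' U' s \/ exists v', ruleC F' U' s v'.
Proof.
move=> inv rB vM F' U' inv'; have [vU pv] := ruleB_serve rB.
case/and3P: rB => sH ns /exists_inP[y yU /andP[sv /exists_inP[y' y'H /andP[nyy c]]]].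
have yF' : y \in nb F' s.
  rewrite in_nb (served_absorbed inv vU sv).
  by move: yU; rewrite in_nb => /andP[].
have eH : F' :|: U' = F :|: U by rewrite absFU setU1D1.
have sy' : e s y' by move: y'H; rewrite in_nb => /andP[].
move: y'H; rewrite in_nb -eH in_setU => /andP[/orP[y'F|y'U] _]; [left|right].
  by apply/satP; exists y', y; rewrite !in_nb y'F sy' eH conn_sym -?in_nb.
have [v' sv'] := serve_ex inv' y'U; exists v'; apply/exists_inP.
exists y'; first by rewrite in_nb y'U.
by rewrite sv'; apply/exists_inP; exists y => //; rewrite eH conn_sym.
Qed.

(** Taking [v] absorbs the undecided witness, so both witnesses now lie in the forest. *)
Lemma ruleC_F F U L K s v : phase2 F U L K -> ruleC F U s v -> v \in M ->
  sat (absF (v |: F) (U :\ v)) (absU (v |: F) (U :\ v)) s.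
Proof.
move=> inv rC vM; have [vU pv] := ruleC_serve rC.
case/exists_inP: rC => y yU /andP[sv /exists_inP[y' y'F c]].
have yF : y \in F -> false.
  have [[_ _ _ dFU] _] := inv => yF; move: yU; rewrite in_nb => /andP[yU _].
  by have := pred0P dFU y; rewrite /= yF yU.
apply/satP; exists y, y'; split.
- by apply: contraT; rewrite negbK => /eqP eyy; apply: yF; move: y'F; rewrite eyy in_nb => /andP[].
- rewrite in_nb (served_absorbed inv vU sv).
  by move: yU; rewrite in_nb => /andP[].
- apply: (subsetP (nb_sub _ _ _)) y'F.
  by apply: subset_trans (subsetUr [set v] _) (subsetUl _ _).
- by rewrite absFU setU1D1.
Qed.

End Guided2.

(** * Minimal feedback vertex sets as complements of maximal forests *)

Section Minimal.
Variables (T : finType) (e : rel T).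
Hypothesis sym_e : symmetric e.
Implicit Types (S M : {set T}).

Lemma fvs_acyc S : fvs e S <-> acyc e (~: S).
Proof.
split=> aS c c2.
  move=> cS /andP[cyc Uc]; pose P x := x \notin S.
  have cP : all P c by apply/allP=> x /cS; rewrite inE.
  pose d : seq {x : T | x \notin S} := pmap insub c.
  have dc : [seq val x | x <- d] = c.
    rewrite (pmap_filter (insubK _)); apply/all_filterP.
    by apply: sub_all cP => x Px; rewrite /= insubT.
  apply: (aS d); first by rewrite -(size_map val) dc.
  rewrite /ucycle -(map_inj_uniq val_inj) dc Uc andbT.
  rewrite -dc in cyc; move: cyc; case: (d) => //= x d'.
  by rewrite -map_rcons path_map.
case/andP=> cyc Uc; apply: (aS [seq val x | x <- c]).
- by rewrite size_map.
- by move=> _ /mapP[x _ ->]; rewrite inE (valP x).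
rewrite /ucycle map_inj_uniq ?Uc ?andbT; last exact: val_inj.
by case: c cyc {c2 Uc} => //= x c; rewrite -map_rcons path_map.
Qed.

(** Subsets of forests are forests, so minimality needs testing only against returning single
    vertices; a vertex can be returned exactly when it is not blocked. *)
Lemma max_min_fvsP k : max_min_fvs e k <->
  exists M, [/\ acyc e M, forall u, u \notin M -> blocked e M u & k <= #|~: M|].
Proof.
split=> [[S [[fS mS] kS]]|[M [aM bM kM]]].
  exists (~: S); rewrite setCK; split=> //; first exact/fvs_acyc.
  move=> u; rewrite inE negbK => uS; apply: contraT => nb.
  case: (mS (S :\ u)); first exact: properD1.
  apply/fvs_acyc; rewrite setCD setUC; apply: acyc_add => //.
    by rewrite inE negbK.
  exact/fvs_acyc.
exists (~: M); split=> //; split; first by apply/fvs_acyc; rewrite setCK.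
move=> S' /properP[sS [u uM uS]] /fvs_acyc aS.
rewrite inE in uM; apply: (blocked_cyclic sym_e uM (bM u uM)).
apply: acyc_mono aS; rewrite subUset sub1set inE uS /=.
by rewrite -setCS setCK.
Qed.

End Minimal.

(** * A small imperative language and its compilation *)

(** Every loop runs over 0, ..., n-1, which makes running time polynomial by syntax ([time_poly]);
    the one exponential loop is added in [prog]. Storing a constant and storing a variable are kept
    apart for the sake of [tame]. *)
Inductive cmd : Type :=
| CSet (x c : nat)
| CMov (x y : nat)
| CAdd (x y z : nat)
| CSub (x y z : nat)
| CLd (x a y : nat)
| CSt (a y c : nat)
| CStv (a y x : nat)
| CIn (x y : nat)
| CSeq (c1 c2 : cmd)
| CIf (x : nat) (c1 c2 : cmd)
| CFor (x : nat) (c : cmd).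

Record store : Type := Store { sv : nat -> nat; sa : nat -> nat -> nat }.

Definition setv (st : store) (x v : nat) : store :=
  Store [eta sv st with x |-> v] (sa st).
Definition seta (st : store) (a i v : nat) : store :=
  Store (sv st) (fun b j => if (b == a) && (j == i) then v else sa st b j).

(* Registers 2 and 3 are scratch, 6 holds the base address n * n of the arrays
   and 7 holds n; cell [i] of array [a] lives at n * n + 8 * i + a. *)
Definition rg (x : nat) : nat := x.*2 + 8.
Definition cr (d : nat) : nat := d.*2 + 9.

Definition addr (a y : nat) : program :=
  [:: IAdd 2 (rg y) (rg y); IAdd 2 2 2; IAdd 2 2 2; IAdd 2 2 6; IConst 3 a;
      IAdd 2 2 3].

Fixpoint csize (c : cmd) : nat :=
  match c with
  | CSet _ _ | CMov _ _ | CAdd _ _ _ | CSub _ _ _ => 1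
  | CLd _ _ _ | CStv _ _ _ => 7
  | CSt _ _ _ => 8
  | CIn _ _ => 6
  | CSeq c1 c2 => csize c1 + csize c2
  | CIf _ c1 c2 => csize c1 + csize c2 + 3
  | CFor _ c => csize c + 8
  end.

(** Jumps are absolute, hence the address [o]; the loop depth [d] selects the counter register.
    Setting register 2 to 0 and testing it gives an unconditional jump. [CIn] returns 0 beyond the
    adjacency matrix, because the arrays are stored there. *)
Fixpoint compile (o d : nat) (c : cmd) : program :=
  match c with
  | CSet x c => [:: IConst (rg x) c]
  | CMov x y => [:: IMove (rg x) (rg y)]
  | CAdd x y z => [:: IAdd (rg x) (rg y) (rg z)]
  | CSub x y z => [:: ISub (rg x) (rg y) (rg z)]
  | CLd x a y => addr a y ++ [:: ILoad (rg x) 2]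
  | CSt a y c => addr a y ++ [:: IConst 3 c; IStore 2 3]
  | CStv a y x => addr a y ++ [:: IStore 2 (rg x)]
  | CIn x y => [:: ISub 2 6 (rg y); IJumpz 2 (o + 5); ILoad (rg x) (rg y);
                   IConst 2 0; IJumpz 2 (o + 6); IConst (rg x) 0]
  | CSeq c1 c2 => compile o d c1 ++ compile (o + csize c1) d c2
  | CIf x c1 c2 =>
      IJumpz (rg x) (o + (csize c1 + 3)) :: compile (o + 1) d c1 ++
      [:: IConst 2 0; IJumpz 2 (o + (csize c1 + csize c2 + 3))] ++
      compile (o + (csize c1 + 3)) d c2
  | CFor x c =>
      [:: IConst (cr d) 0; ISub 2 7 (cr d); IJumpz 2 (o + (csize c + 8));
          IMove (rg x) (cr d)] ++ compile (o + 4) d.+1 c ++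
      [:: IConst 2 1; IAdd (cr d) (cr d) 2; IConst 2 0; IJumpz 2 (o + 1)]
  end.

Fixpoint wf (c : cmd) : bool :=
  match c with
  | CLd _ a _ | CSt a _ _ | CStv a _ _ => a < 8
  | CSeq c1 c2 | CIf _ c1 c2 => wf c1 && wf c2
  | CFor _ c => wf c
  | _ => true
  end.

Fixpoint time (n : nat) (c : cmd) : nat :=
  match c with
  | CSeq c1 c2 => time n c1 + time n c2
  | CIf _ c1 c2 => time n c1 + time n c2 + 3
  | CFor _ c => n * (time n c + 7) + 3
  | _ => 8
  end.

Definition fetch (p : program) (o : nat) : option instr := onth p o.
Arguments fetch : simpl never.

Fixpoint code_at (p : program) (o : nat) (l : program) : Prop :=
  if l is i :: l' then fetch p o = Some i /\ code_at p o.+1 l' else True.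

Lemma code_at_cat p o l1 l2 :
  code_at p o (l1 ++ l2) <-> code_at p o l1 /\ code_at p (o + size l1) l2.
Proof.
elim: l1 o => [|i l1 IH] o /=; first by rewrite addn0; tauto.
by rewrite IH addSnnS; tauto.
Qed.

Lemma code_at_mid l1 l l2 : code_at (l1 ++ l ++ l2) (size l1) l.
Proof.
elim: l l1 l2 => //= i l IH l1 l2; split.
  by rewrite /fetch onth_cat ltnn subnn.
by have := IH (rcons l1 i) l2; rewrite size_rcons cat_rcons.
Qed.

Lemma size_compile o d c : size (compile o d c) = csize c.
Proof.
elim: c o d => //=.
- by move=> c1 IH1 c2 IH2 o d; rewrite size_cat IH1 IH2.
- by move=> x c1 IH1 c2 IH2 o d; rewrite size_cat /= IH1 IH2; lia.
- by move=> x c IH o d; rewrite size_cat /= IH; lia.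
Qed.

Lemma rg_eq x y : (rg x == rg y) = (x == y).
Proof. by rewrite /rg eqn_add2r -!mul2n eqn_mul2l. Qed.
Lemma cr_eq x y : (cr x == cr y) = (x == y).
Proof. by rewrite /cr eqn_add2r -!mul2n eqn_mul2l. Qed.
Lemma rg_cr x d : (rg x == cr d) = false.
Proof. by apply/eqP => h; have := congr1 odd h; rewrite /rg /cr !oddD !odd_double. Qed.
Lemma cr_rg x d : (cr d == rg x) = false.
Proof. by rewrite eq_sym rg_cr. Qed.
Lemma rg_small x m : m < 8 -> (rg x == m) = false.
Proof. by move=> lt; apply/eqP; rewrite /rg; lia. Qed.
Lemma cr_small d m : m < 8 -> (cr d == m) = false.
Proof. by move=> lt; apply/eqP; rewrite /cr; lia. Qed.
Lemma small_rg x m : m < 8 -> (m == rg x) = false.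
Proof. by rewrite eq_sym; apply: rg_small. Qed.
Lemma small_cr x m : m < 8 -> (m == cr x) = false.
Proof. by rewrite eq_sym; apply: cr_small. Qed.
Definition regE := (rg_eq, cr_eq, rg_cr, cr_rg, rg_small, cr_small, small_rg, small_cr).

Section Semantics.
Variables (n : nat) (inp : nat -> nat).
Hypothesis inp_out : forall a, n * n <= a -> inp a = 0.

Fixpoint den (c : cmd) (st : store) : store :=
  match c with
  | CSet x v => setv st x v
  | CMov x y => setv st x (sv st y)
  | CAdd x y z => setv st x (sv st y + sv st z)
  | CSub x y z => setv st x (sv st y - sv st z)
  | CLd x a y => setv st x (sa st a (sv st y))
  | CSt a y v => seta st a (sv st y) v
  | CStv a y x => seta st a (sv st y) (sv st x)
  | CIn x y => setv st x (inp (sv st y))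
  | CSeq c1 c2 => den c2 (den c1 st)
  | CIf x c1 c2 => if sv st x == 0 then den c2 st else den c1 st
  | CFor x c => foldl (fun st i => den c (setv st x i)) st (iota 0 n)
  end.

Definition matches (st : store) (R M : nat -> nat) : Prop :=
  [/\ forall x, R (rg x) = sv st x, R 6 = n * n, R 7 = n,
      forall a, a < n * n -> M a = inp a
    & forall a i, a < 8 -> M (n * n + i * 8 + a) = sa st a i].

Lemma stepE p l R M i : fetch p l = Some i ->
  step p (State l R M) = exec i (State l R M).
Proof. by rewrite /fetch /step /= => ->. Qed.

Lemma matches_setv st R M R' x v : matches st R M ->
  R' (rg x) = v -> (forall y, y != x -> R' (rg y) = R (rg y)) ->
  R' 6 = R 6 -> R' 7 = R 7 -> matches (setv st x v) R' M.
Proof.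
move=> [hv h6 h7 hi ha] hx hy e6 e7; split; rewrite ?e6 ?e7 // => y /=.
by case: eqVneq => [->|/hy->].
Qed.

Lemma matches_regs st R M R' : matches st R M ->
  (forall y, R' (rg y) = R (rg y)) -> R' 6 = R 6 -> R' 7 = R 7 -> matches st R' M.
Proof.
move=> [hv h6 h7 hi ha] hy e6 e7; split; rewrite ?e6 ?e7 // => y.
by rewrite hy.
Qed.

Lemma matches_seta st R M R' a i v : matches st R M -> a < 8 ->
  (forall y, R' (rg y) = R (rg y)) -> R' 6 = R 6 -> R' 7 = R 7 ->
  matches (seta st a i v) R' [eta M with n * n + i * 8 + a |-> v].
Proof.
move=> [hv h6 h7 hi ha] la hy e6 e7; split; rewrite ?e6 ?e7 //; [move=> y|move=> b lb|move=> b j lb] => /=.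
- by rewrite hy.
- by case: eqP => [|_]; [lia|apply: hi].
rewrite -(ha b j lb); congr (if _ then _ else _); apply/eqP/andP => [h|[/eqP-> /eqP->]//].
(* Quotient and remainder by 8 recover the index and the array, so distinct cells do not collide. *)
have h8 : j * 8 + b = i * 8 + a by lia.
have := congr1 (modn^~ 8) h8; have := congr1 (divn^~ 8) h8.
by rewrite !modnMDl !modn_small // !divnMDl // !divn_small // !addn0 => -> ->.
Qed.

Definition runs (p : program) (m : nat) (s s' : state) := iter m (step p) s = s'.

Lemma runs_trans p m m' s s' s'' : runs p m s s' -> runs p m' s' s'' ->
  runs p (m + m') s s''.
Proof. by rewrite /runs addnC iterD => -> ->. Qed.

Lemma runs1 p l R M i s' m : fetch p l = Some i ->
  runs p m (exec i (State l R M)) s' -> runs p m.+1 (State l R M) s'.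
Proof. by move=> h; rewrite /runs iterSr (stepE _ _ h). Qed.

Lemma runs0 p s : runs p 0 s s. Proof. by []. Qed.

Definition addr_regs (R : nat -> nat) (a y : nat) : nat -> nat :=
  [eta R with 2 |-> n * n + R (rg y) * 8 + a, 3 |-> a].

Lemma addr_runs p o a y st R M : code_at p o (addr a y) -> matches st R M ->
  exists R', [/\ runs p 6 (State o R M) (State (o + 6) R' M),
    R' 2 = n * n + sv st y * 8 + a & forall r, r != 2 -> r != 3 -> R' r = R r].
Proof.
move=> /=[c0 [c1 [c2 [c3 [c4 [c5 _]]]]]] [hv h6 _ _ _]; eexists; split.
- do 6!(apply: runs1; first eassumption; rewrite /=).
  by rewrite -[o + 6]/(o + 6) !addnS addn0; apply: runs0.
- by rewrite /= ?regE // h6 hv; lia.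
- by move=> r n2 n3 /=; rewrite !(negPf n2) !(negPf n3).
Qed.

Lemma addr_code p o a y l : code_at p o (addr a y ++ l) ->
  code_at p o (addr a y) /\ code_at p (o + 6) l.
Proof. by move/code_at_cat. Qed.

(** The clause on counters below [d] lets the enclosing loops survive the execution of their
    bodies. *)
Lemma compile_correct p c o d st R M : wf c -> code_at p o (compile o d c) ->
  matches st R M -> exists R' M' m,
  [/\ runs p m (State o R M) (State (o + csize c) R' M'),
      matches (den c st) R' M', forall d', d' < d -> R' (cr d') = R (cr d')
    & m <= time n c].
Proof.
have base x v R0 M0 s : matches s R0 M0 -> matches (setv s x v) [eta R0 with rg x |-> v] M0.
  move=> ms; apply: (matches_setv ms); rewrite /= ?regE ?eqxx //.
  by move=> y nyx; rewrite /= regE (negPf nyx).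
elim: c o d st R M => /=.
- move=> x v o d st R M _ [c0 _] ms; exists [eta R with rg x |-> v], M, 1; split=> //.
  + by apply: (runs1 c0); rewrite /= addn1; apply: runs0.
  + exact: base.
  + by move=> d' _ /=; rewrite ?regE.
- move=> x y o d st R M _ [c0 _] ms; exists [eta R with rg x |-> R (rg y)], M, 1.
  have hv := (let: And5 hv _ _ _ _ := ms in hv); split=> //.
  + by apply: (runs1 c0); rewrite /= addn1; apply: runs0.
  + by rewrite hv; apply: base.
  + by move=> d' _ /=; rewrite ?regE.
- move=> x y z o d st R M _ [c0 _] ms.
  exists [eta R with rg x |-> R (rg y) + R (rg z)], M, 1.
  have hv := (let: And5 hv _ _ _ _ := ms in hv); split=> //.
  + by apply: (runs1 c0); rewrite /= addn1; apply: runs0.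
  + by rewrite !hv; apply: base.
  + by move=> d' _ /=; rewrite ?regE.
- move=> x y z o d st R M _ [c0 _] ms.
  exists [eta R with rg x |-> R (rg y) - R (rg z)], M, 1.
  have hv := (let: And5 hv _ _ _ _ := ms in hv); split=> //.
  + by apply: (runs1 c0); rewrite /= addn1; apply: runs0.
  + by rewrite !hv; apply: base.
  + by move=> d' _ /=; rewrite ?regE.
- move=> x a y o d st R M la k ms; have [ca [c6 _]] := @addr_code p o a y [:: ILoad (rg x) 2] k.
  have [R1 [r1 e1 h1]] := addr_runs ca ms.
  have [hv h6 h7 hi ha] := ms.
  exists [eta R1 with rg x |-> M (R1 2)], M, 7; split=> //.
  + rewrite -(addn1 6); apply: (runs_trans r1); apply: (runs1 c6).
    by rewrite /= -addnS; apply: runs0.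
  + rewrite e1 ha //; apply: base; apply: (matches_regs ms) => [z||]; apply: h1; rewrite ?regE //.
  + by move=> d' _ /=; rewrite regE h1 ?regE.
- move=> a y v o d st R M la k ms.
  have [ca [c6 [c7 _]]] := @addr_code p o a y [:: IConst 3 v; IStore 2 3] k.
  have [R1 [r1 e1 h1]] := addr_runs ca ms.
  exists [eta R1 with 3 |-> v], [eta M with R1 2 |-> v], 8; split=> //.
  + rewrite -(addn2 6); apply: (runs_trans r1); apply: (runs1 c6).
    by apply: (runs1 c7); rewrite /= -!addnS; apply: runs0.
  + rewrite e1; apply: matches_seta ms la _ _ _ => [z||] /=; rewrite ?regE //; apply: h1; rewrite ?regE //.
  + by move=> d' _ /=; rewrite regE // h1 ?regE.
- move=> a y x o d st R M la k ms.
  have [ca [c6 _]] := @addr_code p o a y [:: IStore 2 (rg x)] k.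
  have [R1 [r1 e1 h1]] := addr_runs ca ms.
  have hv := (let: And5 hv _ _ _ _ := ms in hv).
  exists R1, [eta M with R1 2 |-> R1 (rg x)], 7; split=> //.
  + rewrite -(addn1 6); apply: (runs_trans r1); apply: (runs1 c6).
    by rewrite /= -addnS; apply: runs0.
  + rewrite e1 h1 ?regE // hv; apply: matches_seta ms la _ _ _ => [z||]; apply: h1; rewrite ?regE //.
  + by move=> d' _ /=; rewrite h1 ?regE.
- move=> x y o d st R M _ [c0 [c1 [c2 [c3 [c4 [c5 _]]]]]] ms.
  have [hv h6 h7 hi ha] := ms.
  have [lty|gey] := ltnP (sv st y) (n * n).
    exists [eta [eta [eta R with 2 |-> n * n - sv st y] with rg x |-> inp (sv st y)] with 2 |-> 0], M, 5.
    split=> //.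
    * apply: (runs1 c0); rewrite /= h6 hv; apply: (runs1 c1) => /=.
      rewrite subn_eq0 leqNgt lty /=; apply: (runs1 c2); rewrite /= regE //= hv hi //.
      by apply: (runs1 c3); apply: (runs1 c4); exact: runs0.
    * apply: (matches_setv ms) => [|z nz||] /=; rewrite ?regE ?eqxx ?(negPf nz) //.
    * by move=> d' _ /=; rewrite ?regE.
  exists [eta [eta R with 2 |-> n * n - sv st y] with rg x |-> inp (sv st y)], M, 3.
  split=> //.
  + apply: (runs1 c0); rewrite /= h6 hv; apply: (runs1 c1) => /=.
    rewrite subn_eq0 gey (_ : o + 5 = o.+3.+2); last by lia.
    apply: (runs1 c5); rewrite /= inp_out //.
    by rewrite (_ : o + 6 = o.+4.+2); last by lia.
  + apply: (matches_setv ms) => [|z nz||] /=; rewrite ?regE ?eqxx ?(negPf nz) //.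
  + by move=> d' _ /=; rewrite ?regE.
- move=> c1 IH1 c2 IH2 o d st R M /andP[w1 w2] /code_at_cat[k1 k2] ms.
  rewrite size_compile in k2.
  have [R1 [M1 [m1 [r1 ms1 h1 t1]]]] := IH1 _ _ _ _ _ w1 k1 ms.
  have [R2 [M2 [m2 [r2 ms2 h2 t2]]]] := IH2 _ _ _ _ _ w2 k2 ms1.
  exists R2, M2, (m1 + m2); split=> //.
  + by rewrite addnA; apply: runs_trans r1 r2.
  + by move=> d' ld; rewrite h2 // h1.
  + exact: leq_add.
- move=> x c1 IH1 c2 IH2 o d st R M /andP[w1 w2] [c0 /code_at_cat[k1 k2]] ms.
  case: k2 => q1 [q2 k2]; rewrite !size_compile in q1 q2 k2.
  have hx : R (rg x) = sv st x by case: ms.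
  case: ifP => x0.
    rewrite (_ : (o.+1 + csize c1).+2 = o + (csize c1 + 3)) in k2; last by lia.
    have [R2 [M2 [m2 [r2 ms2 h2 t2]]]] := IH2 _ _ _ _ _ w2 k2 ms.
    exists R2, M2, m2.+1; split=> //; last by lia.
    apply: (runs1 c0); rewrite /= hx x0.
    by rewrite (_ : o + (csize c1 + csize c2 + 3) = o + (csize c1 + 3) + csize c2) //; lia.
  rewrite addn1 in k1.
  have [R1 [M1 [m1 [r1 ms1 h1 t1]]]] := IH1 _ _ _ _ _ w1 k1 ms.
  exists [eta R1 with 2 |-> 0], M1, (m1 + 2).+1; split=> //; last by lia.
  + apply: (runs1 c0); rewrite /= hx x0; apply: (runs_trans r1).
    apply: (runs1 q1); apply: (runs1 q2); exact: runs0.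
  + apply: (matches_regs ms1) => [y||] //=; rewrite ?regE //.
  + by move=> d' ld; rewrite /= regE // h1.
move=> x c IH o d st R M w [c0 [c1 [c2 [c3 /code_at_cat[k [q0 [q1 [q2 [q3 _]]]]]]]]] ms.
rewrite size_compile in q0 q1 q2 q3; rewrite (_ : o.+4 = o + 4) in k q0 q1 q2 q3; last by lia.
have loop j i st1 R1 M1 : i + j = n -> R1 (cr d) = i -> matches st1 R1 M1 ->
  exists R' M' m, [/\ runs p m (State o.+1 R1 M1) (State (o + (csize c + 8)) R' M'),
    matches (foldl (fun st i => den c (setv st x i)) st1 (iota i j)) R' M',
    forall d', d' < d -> R' (cr d') = R1 (cr d')
    & m <= j * (time n c + 7) + 2].
  elim: j i st1 R1 M1 => [|j IHj] i st1 R1 M1 ij ei ms1.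
    have [hv h6 h7 _ _] := ms1.
    exists [eta R1 with 2 |-> 0], M1, 2; split=> //.
    - apply: (runs1 c1); rewrite /= h7 ei -ij addn0 subnn; apply: (runs1 c2) => /=.
      exact: runs0.
    - apply: (matches_regs ms1) => [y||] //=; rewrite ?regE //.
    - by move=> d' ld; rewrite /= regE.
  have [hv h6 h7 _ _] := ms1.
  pose R2 := [eta [eta R1 with 2 |-> n - i] with rg x |-> i].
  have ms2 : matches (setv st1 x i) R2 M1.
    apply: (matches_setv ms1) => [|y ny||]; rewrite /R2 /= ?regE ?eqxx ?(negPf ny) //.
  have [R3 [M3 [m3 [r3 ms3 h3 t3]]]] := IH _ _ _ _ _ w k ms2.
  pose R4 := [eta [eta [eta R3 with 2 |-> 1] with cr d |-> i + 1] with 2 |-> 0].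
  have ms4 : matches (den c (setv st1 x i)) R4 M3.
    apply: (matches_regs ms3) => [y||]; rewrite /R4 /= ?regE //.
  have e4 : R4 (cr d) = i.+1 by rewrite /R4 /= ?regE // eqxx addn1.
  have ij' : i.+1 + j = n by lia.
  have [R5 [M5 [m5 [r5 ms5 h5 t5]]]] := IHj _ _ _ _ ij' e4 ms4.
  exists R5, M5, (3 + (m3 + (4 + m5))); split=> //.
  - apply: (@runs_trans _ _ _ _ (State (o + 4) R2 M1)).
      apply: (runs1 c1); rewrite /= h7 ei; apply: (runs1 c2) => /=.
      rewrite (_ : (n - i == 0) = false); last by apply/eqP; lia.
      apply: (runs1 c3); rewrite /= regE // ei (_ : o + 4 = o.+4); last by lia.
      exact: runs0.
    apply: (runs_trans r3).
    apply: (@runs_trans _ _ _ _ (State o.+1 R4 M3)) => //.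
    apply: (runs1 q0); apply: (runs1 q1); rewrite /= regE //.
    rewrite h3 // /R2 /= !regE // ei.
    by apply: (runs1 q2); apply: (runs1 q3); rewrite /= addn1; apply: runs0.
  - move=> d' ld; rewrite h5 // /R4 /= !regE // (_ : (d' == d) = false); last by apply/eqP; lia.
    by rewrite (h3 d' (ltnW ld)) /R2 /= !regE.
  - by rewrite mulSn; lia.
have ms0 : matches st [eta R with cr d |-> 0] M.
  by apply: (matches_regs ms) => [y||] //=; rewrite ?regE.
have e0 : [eta R with cr d |-> 0] (cr d) = 0 by rewrite /= eqxx.
have [R' [M' [m [r' ms' h' t']]]] := loop n 0 st _ M (erefl _) e0 ms0.
exists R', M', m.+1; split=> //; last by lia.
  by apply: (runs1 c0).
by move=> d' ld; rewrite h' //= regE (_ : (d' == d) = false) //; apply/eqP; lia.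
Qed.

End Semantics.

Lemma time_poly c : exists C D, forall n, time n c <= C * n.+1 ^ D.
Proof.
have const C : exists C' D', forall n, C <= C' * n.+1 ^ D'.
  by exists C, 0 => n; rewrite expn0 muln1.
have add f g : (exists C D, forall n, f n <= C * n.+1 ^ D) ->
    (exists C D, forall n, g n <= C * n.+1 ^ D) ->
    exists C D, forall n, f n + g n <= C * n.+1 ^ D.
  move=> [C [D h]] [C' [D' h']]; exists (C + C'), (D + D') => n.
  rewrite mulnDl leq_add //; first apply: leq_trans (h n) _; last first.
    by apply: leq_trans (h' n) _; rewrite leq_mul2l leq_pexp2l ?leq_addl ?orbT.
  by rewrite leq_mul2l leq_pexp2l ?leq_addr ?orbT.
elim: c => /= [*|*|*|*|*|*|*|*|c1 IH1 c2 IH2|x c1 IH1 c2 IH2|x c IH]; try exact: const.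
- exact: (add _ _ IH1 IH2).
- exact: (add _ _ (add _ _ IH1 IH2) (const 3)).
apply: (add _ _ _ (const 3)).
have [C [D h]] := add _ _ IH (const 7); exists C, D.+1 => n.
by rewrite expnS mulnCA leq_mul // ltnW.
Qed.

(** * Logarithmic cost *)

Definition dest (i : instr) : nat :=
  match i with
  | IConst d _ | IMove d _ | IAdd d _ _ | ISub d _ _ | ILoad d _ => d
  | IStore _ _ | IJumpz _ _ => 0
  end.

Definition const (i : instr) : nat := if i is IConst _ c then c else 0.

Definition bounded (b : nat) (R M : nat -> nat) : Prop :=
  (forall x, R x < 2 ^ b) /\ (forall x, M x < 2 ^ b).

Section Cost.
Variables (p : program) (NR cb : nat).
Hypothesis const_p : all (fun i => const i < 2 ^ cb) p.

Definition cost (m : nat) (s : state) : nat :=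
  \sum_(i < m) step_cost p (iter i (step p) s).

Lemma costD m m' s : cost (m + m') s = cost m s + cost m' (iter m (step p) s).
Proof.
rewrite /cost big_split_ord /=; congr (_ + _); apply: eq_bigr => i _.
by rewrite addnC iterD.
Qed.

Lemma bitlen_le v b : v < 2 ^ b -> bitlen v <= b.
Proof. by move=> lt; apply: up_log_min. Qed.

Lemma onth_all (P : pred instr) i l : all P p -> onth p l = Some i -> P i.
Proof.
move=> /(all_nthP (IConst 0 0)) allp h; rewrite -(@onth_nth _ (IConst 0 0) _ _ _ h).
by apply: allp; rewrite -onthTE h.
Qed.

(** Addition at most doubles the largest number, so one instruction lengthens the numbers by at most
    one bit. *)
Lemma step_bounded b l R M : cb <= b -> bounded b R M ->
  let s := step p (State l R M) in bounded b.+1 (regs s) (memory s) /\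
  step_cost p (State l R M) <= 1 + 2 * b.
Proof.
move=> lb [bR bM]; rewrite /step /step_cost /=.
have bR' x : R x < 2 ^ b.+1 by apply: leq_trans (bR x) _; rewrite leq_pexp2l.
have bM' x : M x < 2 ^ b.+1 by apply: leq_trans (bM x) _; rewrite leq_pexp2l.
case h: (onth p l) => [i|] //=.
have := onth_all const_p h; case: i {h} => /= [d c|d a|d a b'|d a b'|d a|a b'|a l'] hc.
- have hcb : c < 2 ^ b by apply: leq_trans hc _; rewrite leq_pexp2l.
  split; last by have := bitlen_le hcb; lia.
  split=> // x /=; case: ifP => // _; apply: leq_trans hcb _.
  by rewrite leq_pexp2l.
- split; last by have := bitlen_le (bR a); lia.
  by split=> // x /=; case: ifP.
- split; last by have := bitlen_le (bR a); have := bitlen_le (bR b'); lia.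
  split=> // x /=; case: ifP => // _.
  by rewrite expnS mul2n -addnn -addSn leq_add // ltnW.
- split; last by have := bitlen_le (bR a); have := bitlen_le (bR b'); lia.
  split=> // x /=; case: ifP => // _.
  by apply: leq_ltn_trans (bR' a); apply: leq_subr.
- split; last by have := bitlen_le (bR a); have := bitlen_le (bM (R a)); lia.
  by split=> // x /=; case: ifP.
- split; last by have := bitlen_le (bR a); have := bitlen_le (bR b'); lia.
  by split=> // x /=; case: ifP.
by split; last by have := bitlen_le (bR a); lia.
Qed.

Lemma cost_bounded b m l R M : cb <= b -> bounded b R M ->
  let s := iter m (step p) (State l R M) in bounded (b + m) (regs s) (memory s) /\
  cost m (State l R M) <= m * (1 + 2 * (b + m)).
Proof.
move=> lb bs; elim: m => [|m [IH1 IH2]] /=.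
  by rewrite addn0 /cost big_ord0.
case e: (iter m (step p) (State l R M)) IH1 => [l' R' M'] /= IH1.
have [h1 h2] := step_bounded l' (leq_trans lb (leq_addr m b)) IH1.
split; first by rewrite addnS.
rewrite -addn1 costD e /cost big_ord1 /=.
by move: IH2 h2; rewrite -/(cost _ _); nia.
Qed.

Hypothesis dest_p : all (fun i => dest i < NR) p.

Lemma regs_dest m s r : NR <= r -> regs (iter m (step p) s) r = regs s r.
Proof.
move=> le; elim: m => //= m <-; move: (iter _ _ _) => [l R M]; rewrite /step /=.
case h: (onth p l) => [i|] //=; have := onth_all dest_p h.
have ne d : d < NR -> (r == d) = false.
  by move=> lt; apply/eqP=> e; move: le; rewrite e leqNgt lt.
by case: i {h} => //= [d c|d a|d a b|d a b|d a] /ne ->.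
Qed.

End Cost.

(** * Values that survive from one turn to the next *)

Section Masking.
Variables (n : nat) (inp : nat -> nat) (pers : seq nat).

(** Arrays and persistent variables receive only constants below 8. As all other variables are
    cleared after a turn, the numbers do not grow with the number of turns, which is exponential. *)
Fixpoint tame (c : cmd) : bool :=
  match c with
  | CSet x v => (x \in pers) ==> (v < 8)
  | CMov x _ | CAdd x _ _ | CSub x _ _ | CLd x _ _ | CIn x _ => x \notin pers
  | CSt _ _ v => v < 8
  | CStv _ _ _ => false
  | CSeq c1 c2 | CIf _ c1 c2 => tame c1 && tame c2
  | CFor x c => (x \notin pers) && tame c
  end.

Definition small (B : nat) (st : store) : Prop :=
  (forall x, x \in pers -> sv st x < B) /\ (forall a i, a < 8 -> sa st a i < B).

Lemma tame_small c st B : 8 <= B -> tame c -> small B st -> small B (den n inp c st).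
Proof.
move=> B8; have setvN x v s : x \notin pers -> small B s -> small B (setv s x v).
  move=> xN [h1 h2]; split=> // y yP /=; case: eqP => [e|_]; last exact: h1.
  by rewrite -e yP in xN.
elim: c st => /= [x v|x y|x y z|x y z|x a y|a y v|a y x|x y|c1 IH1 c2 IH2|x c1 IH1 c2 IH2|x c IH] st //.
- move=> /implyP xv [h1 h2]; split=> // y yP /=; case: eqP => [e|_]; last exact: h1.
  by apply: leq_trans B8; apply: xv; rewrite -e.
- exact: setvN.
- exact: setvN.
- exact: setvN.
- exact: setvN.
- move=> v8 [h1 h2]; split=> // b i b8 /=; case: ifP => _; [exact: leq_trans B8|exact: h2].
- exact: setvN.
- by move=> /andP[t1 t2] /(IH1 _ t1)/(IH2 _ t2).
- by move=> /andP[t1 t2] h; case: ifP => _; [apply: IH2|apply: IH1].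
move=> /andP[xN t]; elim: (iota 0 n) st => //= i s IHs st h.
by apply: IHs; apply: IH => //; apply: setvN.
Qed.

Definition retain (st : store) : store :=
  Store (fun x => if x \in pers then sv st x else 0) (sa st).

End Masking.

Definition zero (l : seq nat) : program := [seq IConst r 0 | r <- l].

Lemma zero_runs p o l R M : code_at p o (zero l) -> exists R',
  runs p (size l) (State o R M) (State (o + size l) R' M) /\
  forall r, R' r = if r \in l then 0 else R r.
Proof.
elim: l o R => [|r l IH] o R /=; first by exists R; rewrite addn0; split.
case=> c0 /IH{}IH; have [R' [h1 h2]] := IH [eta R with r |-> 0].
exists R'; split; first by apply: (runs1 c0); rewrite /= -addSnnS.
by move=> r'; rewrite h2 /= inE; case: (r' == r); case: (r' \in l).
Qed.

(** * The main loop and its total cost *)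

Section Loop.
Variables (INIT BODY : cmd) (vrun vans : nat).
Let pers := [:: 0; vrun; vans].
Hypotheses (wfI : wf INIT) (wfB : wf BODY) (tameB : tame pers BODY).

(** Moves the input to its place and obtains [n * n] by repeated addition. *)
Definition pre : program :=
  [:: IMove 7 0; IMove (rg 0) 1; IConst 6 0; IMove 2 0; IJumpz 2 10; IAdd 6 6 7;
      IConst 3 1; ISub 2 2 3; IConst 3 0; IJumpz 3 4].

(** Computed from code placed at address 0: the final addresses depend on this number through the
    length of the clearing code, whereas destinations do not depend on addresses ([dest_compile]).
    The lock prevents evaluation. *)
Definition nregs : nat :=
  locked (foldr maxn (rg 0)
    [seq (dest i).+1 | i <- pre ++ compile 0 0 INIT ++ compile 0 0 BODY]
    + rg vrun + rg vans).
Definition zregs : seq nat :=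
  [seq r <- iota 0 nregs | r \notin [:: 6, 7 & [seq rg x | x <- pers]]].
Definition lhead : nat := 10 + csize INIT + size zregs.
Definition lend : nat := lhead + (csize BODY + size zregs + 3).
Definition prog : program :=
  pre ++ compile 10 0 INIT ++ zero zregs ++ IJumpz (rg vrun) lend ::
  compile lhead.+1 0 BODY ++ zero zregs ++
  [:: IConst 2 0; IJumpz 2 lhead; IMove 0 (rg vans)].

Lemma dest_compile o o' d c : map dest (compile o d c) = map dest (compile o' d c).
Proof.
elim: c o o' d => //= [c1 IH1 c2 IH2|x c1 IH1 c2 IH2|x c IH] o o' d.
- by rewrite !map_cat (IH1 o o') (IH2 (o + _) (o' + csize c1)).
- by rewrite !map_cat /= (IH1 (o + 1) (o' + 1)) (IH2 (o + _) (o' + (csize c1 + 3))).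
by rewrite !map_cat /= (IH (o + 4) (o' + 4)).
Qed.

Lemma dest_prog : all (fun i => dest i < nregs) prog.
Proof.
have foldr_max m (l : seq nat) : all (fun x => x <= foldr maxn m l) l.
  apply/allP; elim: l => //= x l IH y; rewrite inE => /predU1P[->|/IH h].
    exact: leq_maxl.
  exact: leq_trans h (leq_maxr _ _).
have := foldr_max (rg 0) [seq (dest i).+1 | i <- pre ++ compile 0 0 INIT ++ compile 0 0 BODY].
set m := foldr _ _ _; rewrite all_map !all_cat => /and3P[hp hI hB].
have mono l : all (fun i => dest i < m) l -> all (fun i => dest i < nregs) l.
  by apply: sub_all => i /= h; apply: leq_trans h _; rewrite /nregs -lock -/m; lia.
have conv o d c : all (fun i => dest i < m) (compile 0 d c) ->
    all (fun i => dest i < nregs) (compile o d c).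
  move=> h; have {h} := mono _ h.
  by rewrite -!(all_map dest (fun x => x < nregs)) (dest_compile o 0).
have n4 : 2 < nregs by rewrite /nregs -lock /rg; lia.
have zr : all (fun i => dest i < nregs) (zero zregs).
  rewrite all_map; apply/allP=> r /=; rewrite mem_filter mem_iota add0n.
  by case/and3P.
apply/andP; split; first exact: mono hp.
apply/andP; split; first exact: conv hI.
apply/andP; split; first exact: zr.
apply/andP; split; first by apply: ltn_trans n4.
rewrite -/(all (fun i => dest i < nregs) _) 2!all_cat.
apply/andP; split; first exact: conv hB.
apply/andP; split; first exact: zr.
by rewrite /= n4 (ltn_trans _ n4).
Qed.

Lemma const_prog : exists cb, 4 <= cb /\ all (fun i => const i < 2 ^ cb) prog.
Proof.
elim: prog => [|i l [cb [h4 IH]]]; first by exists 4.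
exists (cb + const i); split; first exact: leq_trans h4 (leq_addr _ _).
rewrite /=; apply/andP; split.
  apply: leq_trans (ltn_expl _ (ltnSn 1)) _; rewrite leq_pexp2l //; exact: leq_addl.
apply: sub_all IH => j h; apply: leq_trans h _; rewrite leq_pexp2l //.
exact: leq_addr.
Qed.

Lemma size_prog : size prog = lend.+1.
Proof.
rewrite /prog /zero !size_cat /= !size_cat /= !size_map !size_compile.
by rewrite /lend /lhead; lia.
Qed.

Definition start (k : nat) : store := Store [eta fun=> 0 with 0 |-> k] (fun _ _ => 0).

Section Run.
Variables (n : nat) (e : rel 'I_n) (k : nat).
Definition inpm (a : nat) : nat :=
  [exists i : 'I_n, exists j : 'I_n, (a == i * n + j) && e i j].
Definition iterate (st : store) : store := retain pers (den n inpm BODY st).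
Definition first : store := retain pers (den n inpm INIT (start k)).

Lemma inpm_out a : n * n <= a -> inpm a = 0.
Proof.
move=> le; apply/eqP; rewrite eqb0; apply/existsP=> -[i /existsP[j /andP[/eqP ea _]]].
by have := ltn_ord i; have := ltn_ord j; nia.
Qed.

Let tail : program := [:: IConst 2 0; IJumpz 2 lhead; IMove 0 (rg vans)].

Let code_at_eq p l1 l l2 o : p = l1 ++ l ++ l2 -> o = size l1 -> code_at p o l.
Proof. by move=> -> ->; apply: code_at_mid. Qed.

Let pre_code : code_at prog 0 pre.
Proof. exact: (@code_at_eq _ [::]). Qed.

Let init_code : code_at prog 10 (compile 10 0 INIT).
Proof. exact: (@code_at_eq _ pre). Qed.

Let zero_code1 : code_at prog (10 + csize INIT) (zero zregs).
Proof.
apply: (@code_at_eq _ (pre ++ compile 10 0 INIT)); first by rewrite -catA.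
by rewrite size_cat size_compile.
Qed.

Let head_code : code_at prog lhead [:: IJumpz (rg vrun) lend].
Proof.
apply: (@code_at_eq _ (pre ++ compile 10 0 INIT ++ zero zregs)).
  by rewrite -!catA.
by rewrite !size_cat size_compile size_map /lhead addnA.
Qed.

Let body_code : code_at prog lhead.+1 (compile lhead.+1 0 BODY ++ zero zregs ++ tail).
Proof.
apply: (@code_at_eq _ (pre ++ compile 10 0 INIT ++ zero zregs ++
   [:: IJumpz (rg vrun) lend]) _ [::]); first by rewrite cats0 -!catA.
by rewrite !size_cat size_compile size_map /lhead /=; lia.
Qed.

Lemma pre_runs : exists R' m,
  [/\ runs prog m (input e k) (State 10 R' (memory (input e k))),
      matches n inpm (start k) R' (memory (input e k)) & m <= 6 * n + 5].
Proof.
case: pre_code => c0 [c1 [c2 [c3 [c4 [c5 [c6 [c7 [c8 [c9 _]]]]]]]]].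
set M := memory (input e k).
have loop j R : R 2 = j -> R 6 + j * n = n * n -> R 7 = n ->
  (forall x, R (rg x) = sv (start k) x) -> exists R' m,
  [/\ runs prog m (State 4 R M) (State 10 R' M), R' 6 = n * n, R' 7 = n,
    forall x, R' (rg x) = sv (start k) x & m <= 6 * j + 1].
  elim: j R => [|j IHj] R h2 h6 h7 hv.
    exists R, 1; split=> //; last by rewrite -h6 mul0n addn0.
    by apply: (runs1 c4); rewrite /= h2; apply: runs0.
  have [|||x|R' [m [r g6 g7 gv hm]]] := IHj [eta [eta [eta [eta R with 6 |-> R 6 + R 7]
      with 3 |-> 1] with 2 |-> R 2 - 1] with 3 |-> 0].
  - by rewrite /= h2 subn1.
  - by rewrite /= h7; lia.
  - by rewrite /= h7.
  - by rewrite /= ?regE.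
  exists R', (6 + m); split=> //; last by lia.
  apply: runs_trans r; apply: (runs1 c4); rewrite /= {1}h2 /=.
  apply: (runs1 c5); apply: (runs1 c6); apply: (runs1 c7); apply: (runs1 c8).
  exact: (runs1 c9).
have [|||x|R' [m [r h6 h7 hv hm]]] := loop n [eta [eta [eta
  [eta [eta fun=> 0 with 0 |-> n, 1 |-> k] with 7 |-> n] with rg 0 |-> k]
  with 6 |-> 0] with 2 |-> n]; rewrite //=.
  by rewrite !regE; case: x.
exists R', (4 + m); split=> //; last by lia.
  apply: runs_trans r; apply: (runs1 c0); apply: (runs1 c1); apply: (runs1 c2).
  exact: (runs1 c3).
split=> // a i la; rewrite /M /=; apply/eqP; rewrite eqb0.
apply/existsP=> -[x /existsP[y /andP[/eqP ea _]]].
by have := ltn_ord x; have := ltn_ord y; nia.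
Qed.

Let kept : seq nat := [:: 6, 7 & [seq rg x | x <- pers]].

Lemma rg_kept x : (rg x \in kept) = (x \in pers).
Proof.
have inj : injective rg by move=> a b /eqP; rewrite rg_eq => /eqP.
by rewrite /kept inE regE // inE regE // (mem_map inj).
Qed.

Lemma zero_match o st R M : code_at prog o (zero zregs) ->
  matches n inpm st R M -> (forall r, nregs <= r -> R r = 0) ->
  exists R', [/\ runs prog (size zregs) (State o R M) (State (o + size zregs) R' M),
    matches n inpm (retain pers st) R' M & forall r, r \notin kept -> R' r = 0].
Proof.
move=> code ms big; have [R' [r h]] := zero_runs R M code.
have memz x : (x \in zregs) = (x \notin kept) && (x < nregs).
  by rewrite mem_filter mem_iota.
have hz x : x \notin kept -> R' x = 0.
  by move=> xk; rewrite h memz xk /=; case: ltnP => // /big.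
have hk x : x \in kept -> R' x = R x by move=> xk; rewrite h memz xk.
have [hv h6 h7 hi ha] := ms; exists R'; split=> //; split=> //.
- move=> x; rewrite /retain /=; case: ifP => xp.
    by rewrite hk ?hv // rg_kept.
  by apply: hz; rewrite rg_kept xp.
- by rewrite hk.
- by rewrite hk.
Qed.

Lemma big_regs m l R M : runs prog m (input e k) (State l R M) ->
  forall r, nregs <= r -> R r = 0.
Proof.
move=> h r le; have ei : iter m (step prog) (input e k) = State l R M := h.
have := regs_dest dest_prog m (input e k) le; rewrite ei /= => ->.
have := le; rewrite /nregs -lock /rg; case: r le => [|[|r]] //=; lia.
Qed.

Lemma first_runs : exists R M m,
  [/\ runs prog m (input e k) (State lhead R M), matches n inpm first R M,
    forall r, r \notin kept -> R r = 0
    & m <= 6 * n + 5 + time n INIT + size zregs].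
Proof.
have [R1 [m1 [r1 ms1 t1]]] := pre_runs.
have [R2 [M2 [m2 [r2 ms2 _ t2]]]] := compile_correct inpm_out wfI init_code ms1.
have r12 := runs_trans r1 r2.
have [R3 [r3 ms3 z3]] := zero_match zero_code1 ms2 (big_regs r12).
exists R3, M2, (m1 + m2 + size zregs); split=> //; last by lia.
exact: runs_trans r12 r3.
Qed.

Definition head_inv (b : nat) (st : store) (R M : nat -> nat) : Prop :=
  [/\ matches n inpm st R M, forall r, r \notin kept -> R r = 0 & bounded b R M].

Lemma bounded_inv b st R M : 4 <= b -> n * n < 2 ^ b -> n < 2 ^ b ->
  small pers (2 ^ b) st -> matches n inpm st R M ->
  (forall r, r \notin kept -> R r = 0) -> head_inv b st R M.
Proof.
move=> b4 nnb nb [hp hA] ms hz; have [hv h6 h7 hi ha] := ms.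
have b0 : 0 < 2 ^ b by rewrite expn_gt0.
split=> //; split=> x.
  have [|/hz->//] := boolP (x \in kept).
  rewrite inE => /predU1P[->|]; first by rewrite h6.
  rewrite inE => /predU1P[->|/mapP[y yp ->]]; first by rewrite h7.
  by rewrite hv; apply: hp.
have [lt|ge] := ltnP x (n * n).
  by rewrite hi // (leq_ltn_trans (leq_b1 _)) // (@leq_pexp2l 2 1 b) //; lia.
have := ha ((x - n * n) %% 8) ((x - n * n) %/ 8) (ltn_pmod (x - n * n) (isT : 0 < 8)).
by rewrite -addnA -divn_eq subnKC // => ->; apply: hA; rewrite ltn_pmod.
Qed.

(** The same bound [b] holds before and after the turn, by tameness of the body and by clearing. *)
Lemma body_runs b l st R M m0 : 4 <= b -> runs prog m0 (input e k) (State l R M) ->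
  l = lhead -> head_inv b st R M -> sv st vrun != 0 -> exists R' M' m,
  [/\ runs prog m (State lhead R M) (State lhead R' M'), head_inv b (iterate st) R' M'
    & m <= time n BODY + size zregs + 3].
Proof.
move=> b4 r0 el [ms hz [bR bM]] run; have [hv h6 h7 hi ha] := ms; subst l.
have [c0 _] := head_code.
have /code_at_cat[c1 /code_at_cat[c2 c3]] := body_code.
rewrite size_compile in c2 c3; rewrite size_map in c3; case: c3 => q0 [q1 _].
have [R2 [M2 [m2 [r2 ms2 _ t2]]]] := compile_correct inpm_out wfB c1 ms.
have rh : runs prog 1 (State lhead R M) (State lhead.+1 R M).
  by apply: (runs1 c0); rewrite /= hv (negPf run); apply: runs0.
have [R3 [r3 ms3 z3]] := zero_match c2 ms2 (big_regs (runs_trans r0 (runs_trans rh r2))).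
have ms4 : matches n inpm (iterate st) [eta R3 with 2 |-> 0] M2.
  by apply: (matches_regs ms3) => [y||] //=; rewrite ?regE.
exists [eta R3 with 2 |-> 0], M2, (1 + (m2 + (size zregs + 2))); split=> //.
- apply: (runs_trans rh); apply: (runs_trans r2); apply: (runs_trans r3).
  by apply: (runs1 q0); apply: (runs1 q1); apply: runs0.
- apply: bounded_inv => //; [by rewrite -h6|by rewrite -h7| |].
  + have b8 : 8 <= 2 ^ b by rewrite (@leq_pexp2l 2 3 b) // ltnW.
    have sm : small pers (2 ^ b) st.
      by split=> [x _|a i a8]; [rewrite -hv|rewrite -ha].
    have [h1 h2] := tame_small n inpm b8 tameB sm.
    by split=> // x xp /=; rewrite xp; apply: h1.
  + by move=> r rk /=; case: eqP => // _; apply: z3.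
by lia.
Qed.

Definition turn : nat := time n BODY + size zregs + 3.

Lemma loop_runs b m0 st R M N : 4 <= b -> runs prog m0 (input e k) (State lhead R M) ->
  head_inv b st R M -> (forall i, i < N -> sv (iter i iterate st) vrun != 0) ->
  exists R' M' m, [/\ runs prog m (State lhead R M) (State lhead R' M'),
    head_inv b (iter N iterate st) R' M'
    & forall cb, cb <= b -> all (fun i => const i < 2 ^ cb) prog ->
      cost prog m (State lhead R M) <= N * (turn * (1 + 2 * (b + turn)))].
Proof.
move=> b4; elim: N m0 st R M => [|N IH] m0 st R M r0 inv run.
  by exists R, M, 0; split=> // cb _ _ /=; rewrite /cost big_ord0.
have [R1 [M1 [m1 [r1 inv1 t1]]]] := body_runs b4 r0 (erefl _) inv (run 0 isT).
have run1 i : i < N -> sv (iter i iterate (iterate st)) vrun != 0.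
  by move=> lt; rewrite -iterSr; apply: run.
have [R2 [M2 [m2 [r2 inv2 t2]]]] := IH _ _ _ _ (runs_trans r0 r1) inv1 run1.
exists R2, M2, (m1 + m2); split.
- exact: runs_trans r1 r2.
- by rewrite iterSr.
have e1 : iter m1 (step prog) (State lhead R M) = State lhead R1 M1 := r1.
move=> cb lcb hcb; rewrite costD e1 mulSn.
have [_ _ bd] := inv.
have [_ c1] := cost_bounded hcb m1 lhead lcb bd.
apply: leq_add; last exact: (t2 cb).
apply: leq_trans c1 _; apply: leq_mul => //; rewrite leq_add2l leq_mul2l leq_add2l.
exact: t1.
Qed.

Lemma halts b cb m0 R M N : cb <= b -> 4 <= b ->
  all (fun i => const i < 2 ^ cb) prog ->
  runs prog m0 (input e k) (State lhead R M) -> head_inv b first R M ->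
  (forall i, i < N -> sv (iter i iterate first) vrun != 0) ->
  sv (iter N iterate first) vrun = 0 ->
  exists t, halts_with prog (input e k) (sv (iter N iterate first) vans != 0) t /\
    t <= cost prog m0 (input e k) + N * (turn * (1 + 2 * (b + turn))) + 2 * (5 + 2 * b).
Proof.
move=> lcb b4 hcb r0 inv run stop.
have [R1 [M1 [m1 [r1 [ms1 _ bd1] c1]]]] := loop_runs b4 r0 inv run.
have [hv _ _ _ _] := ms1; have [k0 _] := head_code.
have /code_at_cat[_ /code_at_cat[_ k3]] := body_code.
rewrite size_compile size_map in k3; case: k3 => _ [_ [q2 _]].
have r2 : runs prog 2 (State lhead R1 M1)
    (State lend.+1 [eta R1 with 0 |-> R1 (rg vans)] M1).
  apply: (runs1 k0); rewrite /= hv stop /=.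
  rewrite (_ : (lhead.+1 + csize BODY + size zregs).+2 = lend) in q2; last first.
    by rewrite /lend; lia.
  by apply: (runs1 q2); apply: runs0.
have r01 := runs_trans r0 r1.
have r := runs_trans r01 r2.
have ef : iter (m0 + m1 + 2) (step prog) (input e k) =
  State lend.+1 [eta R1 with 0 |-> R1 (rg vans)] M1 := r.
exists (cost prog (m0 + m1 + 2) (input e k)); split.
  exists (m0 + m1 + 2); split=> //.
    by rewrite /halted ef size_prog.
  by rewrite ef /= hv.
have e0 : iter m0 (step prog) (input e k) = State lhead R M := r0.
have e1 : iter (m0 + m1) (step prog) (input e k) = State lhead R1 M1 := r01.
rewrite costD e1 costD e0; apply: leq_add; first by rewrite leq_add2l; apply: (c1 cb).
have [_ c2] := cost_bounded hcb 2 lhead lcb bd1.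
by apply: leq_trans c2 _; lia.
Qed.

End Run.

(** The factor [k.+1] reflects the length of the numbers: [k] is not bounded in terms of [n], and up
    to k plus polynomially many bits are charged. *)
Lemma program_time : exists C D, forall n (e : rel 'I_n) k N,
  (forall i, i < N -> sv (iter i (iterate e) (first e k)) vrun != 0) ->
  sv (iter N (iterate e) (first e k)) vrun = 0 ->
  exists t, halts_with prog (input e k)
    (sv (iter N (iterate e) (first e k)) vans != 0) t /\
    t <= C * N.+1 * k.+1 * n.+1 ^ D.
Proof.
have [cb [cb4 hcb]] := const_prog.
have [CI [DI hI]] := time_poly INIT; have [CB [DB hB]] := time_poly BODY.
pose D := (DI + DB).+1.
pose C := CI + CB + size zregs + cb + 20.
(* The constant 100 is 40 + 50 + 10, for the initialisation, the turns and the last two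
   instructions. *)
exists (100 * C * C), (D + D) => n e k N run stop.
set P := C * n.+1 ^ D.
have n1 : 0 < n.+1 by [].
have pI : time n INIT <= CI * n.+1 ^ D.
  by apply: leq_trans (hI n) _; rewrite leq_mul2l leq_pexp2l ?orbT // /D; lia.
have pB : time n BODY <= CB * n.+1 ^ D.
  by apply: leq_trans (hB n) _; rewrite leq_mul2l leq_pexp2l ?orbT // /D; lia.
have pn : n.+1 <= n.+1 ^ D by rewrite -{1}(expn1 n.+1) leq_pexp2l.
have p1 : 0 < n.+1 ^ D by rewrite expn_gt0.
set X := n.+1 ^ D in P pI pB pn p1.
have PE : P = C * X by [].
have hP : n + time n INIT + time n BODY + 6 * n + size zregs + cb + 10 <= P.
  by rewrite PE /C; nia.
have [R [M [m0 [r0 ms0 z0 t0]]]] := first_runs e k.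
(* A crude bit length: [x < 2 ^ x] bounds the input numbers, and [cb] bits hold the constants of the
   program. *)
pose b0 := cb + n + k.
have bd0 : bounded b0 (regs (input e k)) (memory (input e k)).
  have two : 2 <= 2 ^ b0 by rewrite (@leq_pexp2l 2 1) // /b0; lia.
  have big x : x <= n + k -> x < 2 ^ b0.
    move=> le; apply: leq_ltn_trans (ltn_expl _ (ltnSn 1)); rewrite /b0; lia.
  split=> x /=; last by apply: leq_trans two; rewrite ltnS leq_b1.
  by case: ifP => _; [|case: ifP => _]; apply: big; lia.
have ei : input e k = State 0 (regs (input e k)) (memory (input e k)) by [].
have lb0 : cb <= b0 by rewrite /b0; lia.
have [bd1 c0] := cost_bounded hcb m0 0 lb0 bd0.
rewrite -ei (r0 : iter _ _ _ = _) /= in bd1; rewrite -ei in c0.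
(* One more bit for each instruction executed before the loop. *)
pose b := b0 + m0.
have lb : cb <= b by rewrite /b; lia.
have b4 : 4 <= b by lia.
have inv : head_inv e b (first e k) R M by [].
have [t [ht tle]] := halts lb b4 hcb r0 inv run stop.
exists t; split=> //; apply: leq_trans tle _; set B := turn n.
have hm : m0 <= P by lia.
have hb : b <= P + P + k by rewrite /b /b0; lia.
have hB' : B <= P by rewrite /B /turn; lia.
have h1 : cost prog m0 (input e k) <= P * (1 + 2 * (P + P + k)).
  by apply: leq_trans c0 _; apply: leq_mul => //; rewrite leq_add2l leq_mul2l.
have h2 : N * (B * (1 + 2 * (b + B))) <= N * (P * (1 + 2 * (P + P + k + P))).
  rewrite leq_mul2l; apply/orP; right; apply: leq_mul => //.
  by rewrite leq_add2l leq_mul2l /= leq_add.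
rewrite expnD -/X.
have -> : 100 * C * C * N.+1 * k.+1 * (X * X) = N.+1 * (P * (100 * (P * k.+1))).
  by rewrite PE; lia.
have P1 : 10 <= P by lia.
have Qk : k <= P * k by rewrite leq_pmull //; lia.
have PP : P <= P * P by rewrite leq_pmull //; lia.
have h3 : P * (1 + 2 * (P + P + k)) <= P * (40 * (P * k.+1)).
  by rewrite leq_mul2l mulnS; apply/orP; right; lia.
have h4 : N * (P * (1 + 2 * (P + P + k + P))) <= N * (P * (50 * (P * k.+1))).
  by rewrite leq_mul2l leq_mul2l mulnS; apply/orP; right; apply/orP; right; lia.
have h5 : 2 * (5 + 2 * b) <= P * (10 * (P * k.+1)).
  apply: leq_trans (_ : P * k.+1 * 10 <= _); first by rewrite mulnS; lia.
  by rewrite [P * (10 * _)]mulnCA [leqRHS]mulnC leq_mul2r leq_pmull ?orbT //; lia.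
rewrite mulSn; move: h1 h2 h3 h4 h5.
set y := P * k.+1; set t1 := cost _ _ _; set t2 := N * _; set t3 := 2 * _.
have -> : P * (100 * y) = 100 * (P * y) by rewrite mulnCA.
have -> : P * (40 * y) = 40 * (P * y) by rewrite mulnCA.
have -> : P * (50 * y) = 50 * (P * y) by rewrite mulnCA.
have -> : P * (10 * y) = 10 * (P * y) by rewrite mulnCA.
by rewrite ![N * (_ * _)]mulnCA; set u := N * _; set w := P * y; lia.
Qed.

End Loop.

(** * A counting language with reachability for the tests *)

(** Truth values are the numbers 0 and 1. In [TReach b m x y] the term [m], read as a predicate of
    [b], describes the vertex set in which [x] and [y] are to be connected. *)
Inductive tm : Type :=
| TAdj (x y : nat)
| TLab (c x : nat)
| TEq (x y : nat)
| TAnd (t1 t2 : tm)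
| TNot (t : tm)
| TAdd (t1 t2 : tm)
| TLe (c : nat) (t : tm)
| TSum (x : nat) (t : tm)
| TReach (b : nat) (m : tm) (x y : nat).

Fixpoint bv (t : tm) : seq nat :=
  match t with
  | TAnd t1 t2 | TAdd t1 t2 => bv t1 ++ bv t2
  | TNot t | TLe _ t => bv t
  | TSum x t => x :: bv t
  | TReach b m _ _ => b :: bv m
  | _ => [::]
  end.

Fixpoint fv (t : tm) : seq nat :=
  match t with
  | TAdj x y | TEq x y => [:: x; y]
  | TLab _ x => [:: x]
  | TAnd t1 t2 | TAdd t1 t2 => fv t1 ++ fv t2
  | TNot t | TLe _ t => fv t
  | TSum x t => [seq z <- fv t | z != x]
  | TReach b m x y => [:: x, y & [seq z <- fv m | z != b]]
  end.

(** Evaluating one operand overwrites its bound variables, which must not be free in the next. The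
    mask of a search binds nothing, so searches are not nested and can share one array of marks. *)
Fixpoint wft (t : tm) : bool :=
  match t with
  | TAnd t1 t2 | TAdd t1 t2 =>
      [&& wft t1, wft t2 & ~~ has (mem (bv t1)) (fv t2)]
  | TNot t | TLe _ t => wft t
  | TSum _ t => wft t && ~~ has (mem (bv t)) (fv t)
  | TReach b m x y => [&& wft m, bv m == [::], x != b & y != b]
  | _ => true
  end.

Definition eqtest (r x y : nat) : cmd :=
  CSeq (CSub (r + 2) x y) (CSeq (CSub (r + 3) y x)
  (CSeq (CAdd r (r + 2) (r + 3)) (CIf r (CSet r 0) (CSet r 1)))).

Definition adjtest (r x y : nat) : cmd :=
  CSeq (CLd r 0 x) (CSeq (CAdd r r y) (CSeq (CIn r r) (CIf r (CSet r 1) (CSet r 0)))).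

Definition reachmark (cm : cmd) (r b : nat) : cmd :=
  CSeq cm (CIf (r + 8)
    (CSeq (adjtest (r + 8) (r + 2) b) (CIf (r + 8) (CSt 4 b 1) (CSet (r + 8) 0)))
    (CSet (r + 8) 0)).

Definition reachround (cm : cmd) (r b : nat) : cmd :=
  CSeq (CLd (r + 3) 4 (r + 2))
    (CIf (r + 3) (CFor b (reachmark cm r b)) (CSet (r + 8) 0)).

(** Marks spread from [x] in [n] rounds, enough because a simple path has fewer than [n] edges. *)
Definition reachloop (cm : cmd) (r b x y : nat) : cmd :=
  CSeq (CFor b (CSt 4 b 0)) (CSeq (CMov b x) (CSeq cm
  (CSeq (CIf (r + 8) (CSt 4 x 1) (CSet (r + 8) 0)) (CSeq
  (CFor (r + 1) (CFor (r + 2) (reachround cm r b)))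
  (CSeq (CLd r 4 y) (CIf r (CSet r 1) (CSet r 0))))))).

Fixpoint tcomp (t : tm) (r : nat) : cmd :=
  match t with
  | TAdj x y => adjtest r x y
  | TLab c x => CSeq (CLd r 1 x) (CSeq (CSet (r + 1) c) (eqtest r r (r + 1)))
  | TEq x y => eqtest r x y
  | TAnd t1 t2 => CSeq (tcomp t1 r) (CIf r
      (CSeq (tcomp t2 r) (CIf r (CSet r 1) (CSet r 0))) (CSet r 0))
  | TNot t => CSeq (tcomp t r) (CIf r (CSet r 0) (CSet r 1))
  | TAdd t1 t2 => CSeq (tcomp t1 r) (CSeq (tcomp t2 (r + 1)) (CAdd r r (r + 1)))
  | TLe c t => CSeq (tcomp t r) (CSeq (CSet (r + 1) c) (CSeq (CSub (r + 1) (r + 1) r)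
      (CIf (r + 1) (CSet r 0) (CSet r 1))))
  | TSum x t => CSeq (CSet r 0) (CFor x (CSeq (tcomp t (r + 1)) (CAdd r r (r + 1))))
  | TReach b m x y => reachloop (tcomp m (r + 8)) r b x y
  end.

Section Eval.
Variables (n : nat) (inp : nat -> nat).
Local Notation den := (den n inp).

Definition reach (P : 'I_n -> bool) (r : rel 'I_n) (x y : nat) : bool :=
  [exists i : 'I_n, [exists j : 'I_n, [&& val i == x, val j == y, P i
    & connect [rel a b : 'I_n | [&& P a, P b & r a b]] i j]]].

Definition adjn (row : nat -> nat) (x y : nat) : bool := inp (row x + y) != 0.

Fixpoint ev (row lab : nat -> nat) (t : tm) (v : nat -> nat) : nat :=
  match t with
  | TAdj x y => adjn row (v x) (v y)
  | TLab c x => lab (v x) == c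
  | TEq x y => v x == v y
  | TAnd t1 t2 => (ev row lab t1 v != 0) && (ev row lab t2 v != 0)
  | TNot t => ev row lab t v == 0
  | TAdd t1 t2 => ev row lab t1 v + ev row lab t2 v
  | TLe c t => c <= ev row lab t v
  | TSum x t => \sum_(i < n) ev row lab t [eta v with x |-> val i]
  | TReach b m x y =>
      reach (fun i => ev row lab m [eta v with b |-> val i] != 0)
        (fun i j => adjn row i j) (v x) (v y)
  end.

Lemma reach_ext P P' r r' x y : P =1 P' -> r =2 r' -> reach P r x y = reach P' r' x y.
Proof.
move=> eP er; rewrite /reach; apply: eq_existsb => i; apply: eq_existsb => j.
rewrite eP; congr [&& _, _, _ & _]; apply: eq_connect => a b /=.
by rewrite !eP er.
Qed.

Lemma ev_ext row row' lab lab' t v v' : row =1 row' -> lab =1 lab' ->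
  {in fv t, v =1 v'} -> ev row lab t v = ev row' lab' t v'.
Proof.
move=> er el; elim: t v v' => /= [x y|c x|x y|t1 IH1 t2 IH2|t IH|t1 IH1 t2 IH2|c t IH|x t IH|b m IH x y] v v' h.
- by rewrite /adjn er !h // !inE eqxx ?orbT.
- by rewrite el h // inE eqxx.
- by rewrite !h // !inE eqxx ?orbT.
- rewrite (IH1 v v') ?(IH2 v v') // => z hz; apply: h; rewrite mem_cat hz ?orbT //.
- by rewrite (IH v v').
- rewrite (IH1 v v') ?(IH2 v v') // => z hz; apply: h; rewrite mem_cat hz ?orbT //.
- by rewrite (IH v v').
- apply: eq_bigr => i _; apply: IH => z hz /=; case: eqVneq => // nzx.
  by apply: h; rewrite mem_filter nzx.
rewrite !h ?inE ?eqxx ?orbT //; congr nat_of_bool; apply: reach_ext => [i|i j].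
  congr (_ != 0); apply: IH => z hz /=; case: eqVneq => // nzb.
  by apply: h; rewrite !inE mem_filter nzb hz !orbT.
by rewrite /adjn er.
Qed.

Lemma denS c1 c2 st : den (CSeq c1 c2) st = den c2 (den c1 st).
Proof. by []. Qed.

Lemma denI x c1 c2 st :
  den (CIf x c1 c2) st = if sv st x != 0 then den c1 st else den c2 st.
Proof. by rewrite /=; case: (sv st x == 0). Qed.

Lemma den_set x v st : den (CSet x v) st = setv st x v.
Proof. by []. Qed.

Lemma den_st a y v st : den (CSt a y v) st = seta st a (sv st y) v.
Proof. by []. Qed.

Lemma den_ld x a y st : den (CLd x a y) st = setv st x (sa st a (sv st y)).
Proof. by []. Qed.

Lemma den_sub x y z st : den (CSub x y z) st = setv st x (sv st y - sv st z).
Proof. by []. Qed.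

Lemma sv_set x st v : sv (setv st x v) x = v.
Proof. by rewrite /= eqxx. Qed.

Lemma sv_setN x y st v : y != x -> sv (setv st x v) y = sv st y.
Proof. by move=> /negPf /= ->. Qed.

Lemma for_ind (Inv : nat -> store -> Prop) x c st : Inv 0 st ->
  (forall i st', i < n -> Inv i st' -> Inv i.+1 (den c (setv st' x i))) ->
  Inv n (den (CFor x c) st).
Proof.
move=> h0 hS /=; have gen j i s : i + j = n -> Inv i s ->
    Inv n (foldl (fun st i => den c (setv st x i)) s (iota i j)).
  elim: j i s => [|j IH] i s /=; first by rewrite addn0 => ->.
  by move=> ij hi; apply: IH; [lia|apply: hS => //; lia].
exact: gen.
Qed.

(* Only the variables in [V] and those from [r] on may have changed, and in the
   memory only the mark array. *)
Definition kept (r : nat) (V : seq nat) (st st' : store) : Prop :=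
  (forall z, z < r -> z \notin V -> sv st' z = sv st z) /\
  (forall a i, a != 4 -> sa st' a i = sa st a i).

Lemma kept_refl r V st : kept r V st st. Proof. by []. Qed.

Lemma kept_trans r V st1 st2 st3 : kept r V st1 st2 -> kept r V st2 st3 ->
  kept r V st1 st3.
Proof.
move=> [h1 g1] [h2 g2]; split=> [z zr zV|a i a4]; first by rewrite h2 ?h1.
by rewrite g2 ?g1.
Qed.

Lemma kept_setv r V st x v : (r <= x) || (x \in V) -> kept r V st (setv st x v).
Proof.
move=> hx; split=> // z zr zV /=; case: eqP => // e; move: hx zV.
by rewrite -e leqNgt zr /= => ->.
Qed.

Lemma kept_weak r r' (V V' : seq nat) st st' : r <= r' -> {subset V' <= V} ->
  kept r' V' st st' -> kept r V st st'.
Proof.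
move=> rr sV [h g]; split=> // z zr zV; apply: h; first exact: leq_trans rr.
by apply: contra zV; apply: sV.
Qed.

Lemma kept_seta r V st i v : kept r V st (seta st 4 i v).
Proof. by split=> // a j a4 /=; rewrite (negPf a4). Qed.

Lemma den_adjtest r x y st : y < r ->
  sv (den (adjtest r x y) st) r = adjn (sa st 0) (sv st x) (sv st y) /\
  kept r [::] st (den (adjtest r x y) st) /\
  sa (den (adjtest r x y) st) = sa st.
Proof.
move=> yr; rewrite /= !eqxx /adjn (ltn_eqF yr).
case: (inp _ == 0) => /=; rewrite !eqxx; split=> //; split=> //; split=> // z zr _ /=;
by rewrite (ltn_eqF zr).
Qed.

Lemma den_eqtest r x y st : x < r + 2 -> y < r + 2 ->
  sv (den (eqtest r x y) st) r = (sv st x == sv st y) /\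
  kept r [::] st (den (eqtest r x y) st).
Proof.
move=> xr yr; rewrite /= !eqxx (ltn_eqF xr).
rewrite (ltn_eqF yr).
rewrite (_ : (r + 2 == r + 3) = false) ?eqxx; last by apply/eqP; lia.
rewrite addn_eq0 !subn_eq0 -eqn_leq.
case: (sv st x == sv st y) => /=; rewrite eqxx; split=> //; split=> // z zr _ /=;
by rewrite !ifF //; apply/eqP; lia.
Qed.

Definition marked (st : store) (a : nat) : bool := sa st 4 a != 0.

(** * Correctness of reachability by marking *)

Section Reach.
Variables (cm : cmd) (r b x y : nat) (st0 : store) (PP : nat -> bool).
Hypotheses (br : b < r) (xr : x < r) (yr : y < r) (nxb : x != b) (nyb : y != b)
  (xn : sv st0 x < n) (yn : sv st0 y < n).
Hypothesis cmP : forall s, kept r [:: b] st0 s -> sv s b < n ->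
  (sv (den cm s) (r + 8) != 0) = PP (sv s b) /\
  kept (r + 8) [::] s (den cm s) /\ sa (den cm s) = sa s.
Let adj i j := adjn (sa st0 0) i j.
Let x0 := sv st0 x.

Fixpoint within (j a : nat) : bool :=
  if j is j'.+1 then
    within j' a || [exists i : 'I_n, [&& within j' i, PP a & adj i a]]
  else PP x0 && (a == x0).

(** A mark set during a round is used in that same round, so after [j] rounds marks may be farther
    than [j] steps away; only some number of steps is claimed. *)
Let sound s := forall a, a < n -> marked s a -> exists j, within j a.

Lemma within_mono m m' z : m <= m' -> within m z -> within m' z.
Proof. by move/subnK=> <-; elim: (m' - m) => //= d IH /IH ->. Qed.

Lemma within_conn j0 a : a < n -> within j0 a ->
  reach (fun i => PP i) (fun i j => adj i j) x0 a.
Proof.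
move=> an w; have x0n : x0 < n := xn.
pose R := [rel i j : 'I_n | [&& PP i, PP j & adj i j]].
have sub j (i : 'I_n) : within j i -> PP x0 /\ PP i /\ connect R (Ordinal x0n) i.
  elim: j i => [|j IH] i /=.
    case/andP=> Px /eqP ei; have -> : i = Ordinal x0n by apply: val_inj.
    by split.
  case/orP=> [/IH//|/existsP[i' /and3P[/IH[Px [Pi' c]] Pi ii']]].
  by split=> //; split=> //; apply: connect_trans c (connect1 _); rewrite /= Pi' Pi.
have [Px [Pa c]] := sub j0 (Ordinal an) w.
by apply/existsP; exists (Ordinal x0n); apply/existsP; exists (Ordinal an); rewrite !eqxx Px.
Qed.

(** A connecting path can be shortened to a simple one, of length below [n]. *)
Lemma within_reach a : a < n ->
  reach (fun i => PP i) (fun i j => adj i j) x0 a = within n a.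
Proof.
move=> an; have x0n : x0 < n := xn.
apply/idP/idP; last exact: within_conn.
case/existsP=> i /existsP[j /and4P[/eqP ei /eqP <- Pi]].
have -> : i = Ordinal x0n by apply: val_inj.
case/connectP=> p0 p0P ->; case/shortenP: p0P => p pP Up _.
have: size p < n by have := card_uniqP Up; have := max_card (mem (Ordinal x0n :: p)); rewrite card_ord /= => h1 h2; rewrite h2 in h1.
have W : within (size p) (last (Ordinal x0n) p).
  elim/last_ind: p pP {Up} => [|p z IH] /=; first by rewrite -ei Pi eqxx.
  rewrite rcons_path last_rcons size_rcons => /andP[/IH wp /and3P[_ Pz az]] /=.
  by apply/orP; right; apply/existsP; exists (last (Ordinal x0n) p); rewrite wp Pz.
by move=> lt; apply: within_mono W; apply: ltnW.
Qed.

Lemma within_max j a : a < n -> within j a -> within n a.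
Proof. by move=> an w; rewrite -within_reach //; apply: within_conn an w. Qed.

Lemma kept_adj s i j : kept r [:: b] st0 s -> adjn (sa s 0) i j = adj i j.
Proof. by move=> [_ h]; rewrite /adj /adjn h. Qed.

Lemma kept_sub s s' : kept r [:: b] st0 s -> kept r [:: b] s s' -> kept r [:: b] st0 s'.
Proof. exact: kept_trans. Qed.

Lemma reachmark_step s i l s' : kept r [:: b] st0 s -> sv s (r + 2) = i -> i < n ->
  l < n -> marked s i -> sound s -> s' = den (reachmark cm r b) (setv s b l) ->
  [/\ kept r [:: b] st0 s', sv s' (r + 2) = i, sound s',
    forall a, marked s a -> marked s' a & PP l -> adj i l -> marked s' l].
Proof.
move=> ks ei li ll mi snd ->.
have k1 : kept r [:: b] st0 (setv s b l).
  by apply: kept_sub ks (kept_setv _ _ _); rewrite inE eqxx orbT.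
have bl : sv (setv s b l) b = l by rewrite /= eqxx.
have [] := cmP k1; rewrite bl // => e1 [k2 a2]; rewrite /reachmark denS denI.
set s1 := den cm (setv s b l) in e1 k2 a2 *.
have k02 : kept r [:: b] st0 s1.
  by apply: kept_sub k1 (kept_weak _ _ k2) => //; apply: leq_addr.
have e2 : sv s1 (r + 2) = i.
  by rewrite (proj1 k2) ?sv_setN //; [apply/eqP|]; lia.
have m2 a : marked s1 a = marked s a by rewrite /marked a2.
have s2 : sound s1 by move=> a an; rewrite m2; apply: snd.
have eb : sv s1 b = l by rewrite (proj1 k2) //; lia.
have junk t v (Q : Prop) : kept r [:: b] st0 t -> sv t (r + 2) = i -> sound t ->
    (forall a, marked s a -> marked t a) -> (Q -> marked t l) ->
    [/\ kept r [:: b] st0 (setv t (r + 8) v), sv (setv t (r + 8) v) (r + 2) = i,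
      sound (setv t (r + 8) v), forall a, marked s a -> marked (setv t (r + 8) v) a
      & Q -> marked (setv t (r + 8) v) l].
  move=> kt et st mt at'; split=> //.
    by apply: kept_sub kt (kept_setv _ _ _); rewrite leq_addr.
  by rewrite sv_setN //; apply/eqP; lia.
rewrite e1 denS denI !den_set; case: ifP => Pl; last first.
  have [|? ? ? ? _] := junk s1 0 False k02 e2 s2 _ (False_ind _); last by split.
  by move=> a; rewrite m2.
have b8 : b < r + 8 by lia.
have [e3 [k3 a3]] := den_adjtest (r + 2) s1 b8.
set s3 := den (adjtest _ _ _) s1 in e3 k3 a3 *.
have k03 : kept r [:: b] st0 s3.
  by apply: kept_sub k02 (kept_weak _ _ k3) => //; apply: leq_addr.
have e23 : sv s3 (r + 2) = i by rewrite (proj1 k3) //; lia.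
have m3 a : marked s3 a = marked s a by rewrite -m2 /marked a3.
have s3' : sound s3 by move=> a an; rewrite m3; apply: snd.
rewrite e3 e2 eb (kept_adj _ _ k02) eqb0 negbK; case: ifP => ail; last first.
  have [|? ? ? ? _] := junk s3 0 False k03 e23 s3' _ (False_ind _); last by split.
  by move=> a; rewrite m3.
rewrite den_st (proj1 k3) // eb; split=> //.
- exact: kept_sub k03 (kept_seta _ _ _ _ _).
- move=> a an; rewrite /marked /=; case: (eqVneq a l) => [-> _|_]; last first.
    by rewrite -/(marked s3 a); apply: s3'.
  have [j wj] := snd i li mi; exists j.+1 => /=; apply/orP; right.
  by apply/existsP; exists (Ordinal li); rewrite /= wj Pl.
- move=> a ma; rewrite /marked /=; case: (eqVneq a l) => // _.
  by rewrite -/(marked s3 a) m3.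
- by rewrite /marked /= eqxx.
Qed.

Lemma reachround_step s i s' : kept r [:: b] st0 s -> i < n -> sound s ->
  s' = den (reachround cm r b) (setv s (r + 2) i) ->
  [/\ kept r [:: b] st0 s', sound s',
    forall a, marked s a -> marked s' a
    & marked s i -> forall a, a < n -> PP a -> adj i a -> marked s' a].
Proof.
move=> ks li snd ->; rewrite /reachround denS den_ld denI sv_set.
set s1 := setv (setv s _ _) _ _.
have k1 : kept r [:: b] st0 s1.
  apply: kept_sub ks (kept_trans (kept_setv _ _ _) (kept_setv _ _ _));
  by rewrite leq_addr.
have -> : sa (setv s (r + 2) i) 4 (sv (setv s (r + 2) i) (r + 2)) = sa s 4 i.
  by rewrite sv_set.
case: ifP => [mi|nmi]; last first.
  rewrite den_set; split=> //; last by rewrite /marked nmi.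
  by apply: kept_sub k1 (kept_setv _ _ _); rewrite leq_addr.
pose Inv l t := [/\ kept r [:: b] st0 t, sv t (r + 2) = i, sound t,
  forall a, marked s a -> marked t a
  & forall a, a < l -> PP a -> adj i a -> marked t a].
suff [h1 h2 h3 h4 h5] : Inv n (den (CFor b (reachmark cm r b)) s1) by split.
apply: for_ind.
  split=> //; rewrite /s1 sv_setN ?sv_set //; apply/eqP; lia.
move=> l t ll [kt et st mt at'].
have [g1 g2 g3 g4 g5] := reachmark_step kt et li ll (mt i mi) st (erefl _).
split=> // [a ma|a]; first by apply/g4/mt.
by rewrite ltnS leq_eqVlt => /predU1P[->//|al] Pa ia; apply: g4; apply: at'.
Qed.

Lemma reachloop_correct s' : s' = den (reachloop cm r b x y) st0 ->
  sv s' r = reach (fun i => PP i) (fun i j => adj i j) (sv st0 x) (sv st0 y) /\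
  kept r [:: b] st0 s'.
Proof.
move=> ->; rewrite /reachloop !denS.
pose Inv0 l t := kept r [:: b] st0 t /\ forall a, a < l -> marked t a = false.
have : Inv0 n (den (CFor b (CSt 4 b 0)) st0).
  apply: for_ind => [|i t li [kt mt]]; first by split.
  rewrite den_st sv_set; split.
    apply: kept_sub kt (kept_trans (kept_setv _ _ _) (kept_seta _ _ _ _ _)).
    by rewrite inE eqxx orbT.
  move=> a; rewrite ltnS leq_eqVlt /marked /= => /predU1P[->|al]; first by rewrite eqxx.
  by case: (eqVneq a i) => // _; apply: mt.
set s1 := den (CFor _ _) st0; case=> k1 m1.
rewrite [den (CMov b x) s1]/=.
have e1 : sv s1 x = x0.
  by rewrite (proj1 k1) // inE.
set s2 := setv s1 b _.
have k2 : kept r [:: b] st0 s2.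
  by apply: kept_sub k1 (kept_setv _ _ _); rewrite inE eqxx orbT.
have eb2 : sv s2 b = x0 by rewrite sv_set.
have [] := cmP k2; rewrite eb2 // => e3 [k3 a3].
set s3 := den cm s2 in e3 k3 a3 *.
have k03 : kept r [:: b] st0 s3.
  by apply: kept_sub k2 (kept_weak _ _ k3) => //; apply: leq_addr.
have m3 a : a < n -> marked s3 a = false by move=> an; rewrite /marked a3; apply: m1.
rewrite [den (CIf (r + 8) _ _) _]denI e3 den_set den_st.
have ex3 : sv s3 x = x0 by rewrite (proj1 k03) // inE.
set s4 := (if _ then _ else _).
have k4 : kept r [:: b] st0 s4.
  rewrite /s4; case: ifP => _; first exact: kept_sub k03 (kept_seta _ _ _ _ _).
  by apply: kept_sub k03 (kept_setv _ _ _); rewrite leq_addr.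
have m4 a : a < n -> marked s4 a = within 0 a.
  move=> an; rewrite /s4 /=; case Px: (PP x0) => /=; last exact: m3.
  by rewrite /marked /= ex3; case: (eqVneq a x0) => // _; apply: m3.
pose Inv j t := [/\ kept r [:: b] st0 t, sound t & forall a, a < n -> within j a -> marked t a].
have : Inv n (den (CFor (r + 1) (CFor (r + 2) (reachround cm r b))) s4).
  apply: for_ind => [|j t lj [kt st mt]].
    split=> // [a an|a an w]; last by rewrite m4.
    by rewrite m4 // => w; exists 0.
  pose t1 := setv t (r + 1) j.
  have kt1 : kept r [:: b] st0 t1.
    by apply: kept_sub kt (kept_setv _ _ _); rewrite leq_addr.
  pose InvA i u := [/\ kept r [:: b] st0 u, sound u,
    forall a, a < n -> within j a -> marked u a
    & forall i', i' < i -> i' < n -> within j i' -> forall a, a < n -> PP a -> adj i' a -> marked u a].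
  suff [h1 h2 h3 h4] : InvA n (den (CFor (r + 2) (reachround cm r b)) t1).
    split=> // a an /= /orP[/h3->//|/existsP[i /and3P[wi Pa ia]]].
    exact: (h4 i (ltn_ord i) (ltn_ord i) wi a an Pa ia).
  apply: for_ind => [|i u li [ku su mu au]]; first by split.
  have [g1 g2 g3 g4] := reachround_step ku li su (erefl _).
  split=> // [a an w|i']; first by apply/g3/mu.
  rewrite ltnS leq_eqVlt => /predU1P[->|i'i] i'n w a an Pa ia.
    by apply: g4 => //; apply: mu.
  by apply: g3; apply: (au i').
set s5 := den (CFor _ _) s4; case=> k5 snd5 m5.
have ey : sv s5 y = sv st0 y by rewrite (proj1 k5) // inE.
have mE : marked s5 (sv st0 y) = within n (sv st0 y).
  by apply/idP/idP => [/(snd5 _ yn)[j w]|w]; [exact: within_max yn w|exact: m5].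
rewrite den_ld ey denI sv_set -/(marked s5 _) mE -within_reach // !den_set.
have k6 : kept r [:: b] st0 (setv s5 r (sa s5 4 (sv st0 y))).
  by apply: kept_sub k5 (kept_setv _ _ _); rewrite leqnn.
case: (reach _ _ _ _); rewrite sv_set; split=> //;
by apply: kept_sub k6 (kept_setv _ _ _); rewrite leqnn.
Qed.

End Reach.

Lemma tcomp_sa t r st : bv t = [::] -> sa (den (tcomp t r) st) = sa st.
Proof.
elim: t r st => [x y|c x|x y|t1 IH1 t2 IH2|t IH|t1 IH1 t2 IH2|c t IH|x t IH|b m IH x y] r st //.
- by move=> _ /=; case: (_ == 0).
- by move=> _; rewrite /= ; case: (_ == 0).
- by move=> _; rewrite /= ; case: (_ == 0).
- move=> /= /(congr1 size); rewrite size_cat => /eqP.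
  rewrite addn_eq0 => /andP[/nilP b1 /nilP b2].
  by case: (_ == 0) => /=; rewrite ?IH1 //; case: (_ == 0) => /=; rewrite IH2 ?IH1.
- by move=> h /=; case: (_ == 0) => /=; apply: IH.
- move=> /= /(congr1 size); rewrite size_cat => /eqP.
  by rewrite addn_eq0 => /andP[/nilP b1 /nilP b2]; rewrite IH2 ?IH1.
- by move=> h /=; case: (_ == 0) => /=; apply: IH.
Qed.

Lemma tcomp_correct t r st : wft t -> {in fv t ++ bv t, forall z, z < r} ->
  {in fv t, forall z, sv st z < n} ->
  sv (den (tcomp t r) st) r = ev (sa st 0) (sa st 1) t (sv st) /\
  kept r (bv t) st (den (tcomp t r) st).
Proof.
elim: t r st => [x y|c x|x y|t1 IH1 t2 IH2|t IH|t1 IH1 t2 IH2|c t IH|x t IH|b m IH x y] r st.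
- move=> _ lt _; have yr : y < r by apply: lt; rewrite !inE eqxx orbT.
  by have [e [k _]] := den_adjtest x st yr.
- move=> _ lt _; have xr : x < r by apply: lt; rewrite inE eqxx.
  rewrite [tcomp _ _]/= 2!denS den_ld den_set; set s1 := setv _ (r + 1) c.
  have r2 : r < r + 2 by lia.
  have r12 : r + 1 < r + 2 by lia.
  have [e k] := den_eqtest s1 r2 r12.
  have k1 : kept r [::] st s1.
    by apply: kept_trans (kept_setv _ _ _) (kept_setv _ _ _); rewrite ?leqnn ?leq_addr.
  split; last exact: kept_trans k1 k.
  by rewrite e /s1 sv_set sv_setN ?sv_set //; apply/eqP; lia.
- move=> _ lt _; have xr : x < r by apply: lt; rewrite !inE eqxx.
  have yr : y < r by apply: lt; rewrite !inE eqxx orbT.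
  by apply: den_eqtest; [exact: ltn_addr|exact: ltn_addr].
- case/and3P=> w1 w2 /hasPn dis lt vn.
  have sub1 : kept r (bv t1) st (den (tcomp t1 r) st) /\
      sv (den (tcomp t1 r) st) r = ev (sa st 0) (sa st 1) t1 (sv st).
    have [] := IH1 r st w1 _ _ => //; [|by move=> z zf; apply: vn; rewrite mem_cat zf].
    by move=> z; rewrite mem_cat => /orP[zf|zf]; apply: lt; rewrite !mem_cat zf ?orbT.
  have [k1 e1] := sub1; rewrite [tcomp _ _]/= denS denI e1 denS denI !den_set.
  set s1 := den (tcomp t1 r) st in k1 *.
  have kf1 : kept r (bv t1 ++ bv t2) st s1.
    by apply: kept_weak k1 => // z zb; rewrite mem_cat zb.
  rewrite [ev _ _ (TAnd _ _) _]/=; case: (ev _ _ t1 _ != 0); last first.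
    rewrite sv_set; split=> //; apply: kept_trans kf1 (kept_setv _ _ _).
    by rewrite leqnn.
  have ef z : z \in fv t2 -> sv s1 z = sv st z.
    move=> zf; apply: (proj1 k1); last exact: dis.
    by apply: lt; rewrite !mem_cat zf ?orbT.
  have [] := IH2 r s1 w2.
  + by move=> z; rewrite mem_cat => /orP[zf|zf]; apply: lt; rewrite !mem_cat zf ?orbT.
  + by move=> z zf; rewrite ef //; apply: vn; rewrite mem_cat zf orbT.
  have -> : ev (sa s1 0) (sa s1 1) t2 (sv s1) = ev (sa st 0) (sa st 1) t2 (sv st).
    by apply: ev_ext => // z; apply: (proj2 k1).
  move=> e2 k2; rewrite e2; set s2 := den (tcomp t2 r) s1 in k2 *.
  have kf2 : kept r (bv t1 ++ bv t2) st s2.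
    apply: kept_trans kf1 (kept_weak _ _ k2) => // z zb.
    by rewrite mem_cat zb orbT.
  case: (ev _ _ t2 _ != 0); rewrite sv_set; split=> //;
  by apply: kept_trans kf2 (kept_setv _ _ _); rewrite leqnn.
- move=> w lt vn; have [e k] := IH r st w lt vn.
  rewrite [tcomp _ _]/= [bv _]/= denS denI !den_set e [ev _ _ (TNot _) _]/=.
  case: (ev _ _ _ _) => [|j]; rewrite sv_set; split=> //;
  by apply: kept_trans k (kept_setv _ _ _); rewrite leqnn.
- case/and3P=> w1 w2 /hasPn dis lt vn.
  have [|z zf|e1 k1] := IH1 r st w1; [|by apply: vn; rewrite mem_cat zf|].
    by move=> z; rewrite mem_cat => /orP[zf|zf]; apply: lt; rewrite !mem_cat zf ?orbT.
  rewrite [tcomp _ _]/= [bv _]/= 2!denS; set s1 := den (tcomp t1 r) st in e1 k1 *.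
  have kf1 : kept r (bv t1 ++ bv t2) st s1.
    by apply: kept_weak k1 => // z zb; rewrite mem_cat zb.
  have ef z : z \in fv t2 -> sv s1 z = sv st z.
    move=> zf; apply: (proj1 k1); last exact: dis.
    by apply: lt; rewrite !mem_cat zf ?orbT.
  have [|z zf|] := IH2 (r + 1) s1 w2.
  + move=> z; rewrite mem_cat addn1 => /orP[zf|zf]; apply: leqW; apply: lt;
    by rewrite !mem_cat zf ?orbT.
  + by rewrite ef //; apply: vn; rewrite mem_cat zf orbT.
  have -> : ev (sa s1 0) (sa s1 1) t2 (sv s1) = ev (sa st 0) (sa st 1) t2 (sv st).
    by apply: ev_ext => // z; apply: (proj2 k1).
  move=> e2 k2; set s2 := den (tcomp t2 (r + 1)) s1 in e2 k2 *.
  have rN : r \notin bv t2.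
    apply/negP=> rb; have := lt r; rewrite !mem_cat rb !orbT ltnn => h.
    by have := h isT.
  have e1' : sv s2 r = sv s1 r by rewrite (proj1 k2) //; lia.
  rewrite [den (CAdd _ _ _) _]/= sv_set e1' e1 e2; split=> //.
  apply: kept_trans kf1 (kept_trans (kept_weak _ _ k2) (kept_setv _ _ _)).
  + exact: leq_addr.
  + by move=> z zb; rewrite mem_cat zb orbT.
  + by rewrite leqnn.
- move=> w lt vn; have [e k] := IH r st w lt vn.
  rewrite [tcomp _ _]/= [bv _]/= 3!denS denI !den_set [ev _ _ (TLe _ _) _]/=.
  set s1 := den (tcomp t r) st in e k *.
  have -> : den (CSub (r + 1) (r + 1) r) (setv s1 (r + 1) c) =
      setv (setv s1 (r + 1) c) (r + 1) (c - ev (sa st 0) (sa st 1) t (sv st)).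
    rewrite den_sub sv_set sv_setN ?e //; apply/eqP; lia.
  have k2 v w' : kept r (bv t) st (setv (setv s1 (r + 1) v) (r + 1) w').
    by apply: kept_trans k (kept_trans (kept_setv _ _ _) (kept_setv _ _ _));
    rewrite leq_addr.
  rewrite sv_set subn_eq0; case: (c <= _) => /=; rewrite eqxx; split=> //;
  by apply: kept_trans (k2 _ _) (kept_setv _ _ _); rewrite leqnn.
- case/andP=> w /hasPn dis lt vn; rewrite [tcomp _ _]/= denS den_set.
  have xr : x < r by apply: lt; rewrite mem_cat inE eqxx orbT.
  have ltt z : z \in fv t ++ bv t -> z < r.
    have [->//|nzx] := eqVneq z x; rewrite mem_cat => zt; apply: lt.
    by rewrite mem_cat mem_filter inE nzx (negPf nzx).
  pose Inv l s := kept r (x :: bv t) st s /\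
    sv s r = \sum_(0 <= i < l) ev (sa st 0) (sa st 1) t [eta sv st with x |-> i].
  suff [k e] : Inv n (den (CFor x (CSeq (tcomp t (r + 1)) (CAdd r r (r + 1)))) (setv st r 0)).
    by split; rewrite // e big_mkord.
  apply: for_ind => [|i s li [k e]].
    split; last by rewrite sv_set big_geq.
    by apply: kept_setv; rewrite leqnn.
  rewrite denS; set s1 := setv s x i.
  have k1 : kept r (x :: bv t) st s1.
    by apply: kept_trans k (kept_setv _ _ _); rewrite inE eqxx orbT.
  have [z /ltt zr|z zf|e2 k2] := IH (r + 1) s1 w; first by rewrite addn1 ltnW.
    rewrite /s1; have [->|nzx] := eqVneq z x; first by rewrite sv_set.
    rewrite sv_setN // (proj1 k); first by apply: vn; rewrite mem_filter nzx.
      by apply: ltt; rewrite mem_cat zf.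
    by rewrite inE negb_or nzx; apply: dis.
  have e2' : sv (den (tcomp t (r + 1)) s1) (r + 1) =
     ev (sa st 0) (sa st 1) t [eta sv st with x |-> i].
    rewrite e2; apply: ev_ext => [z|z|z zf]; [by apply: (proj2 k1)..|].
    rewrite /s1; have [->|nzx] := eqVneq z x; first by rewrite sv_set /= eqxx.
    rewrite sv_setN //= (negPf nzx) (proj1 k) //; first by apply: ltt; rewrite mem_cat zf.
    by rewrite inE negb_or nzx; apply: dis.
  move=> {e2}; rename e2' into e2; set s2 := den (tcomp t (r + 1)) s1 in e2 k2 *.
  have rN : r \notin bv t.
    by apply/negP=> rb; have := ltt r; rewrite mem_cat rb orbT ltnn => /(_ isT).
  have er : sv s2 r = sv s r.
    by rewrite (proj1 k2) ?addn1 // /s1 sv_setN //; apply/eqP; lia.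
  rewrite [den (CAdd _ _ _) _]/=; split.
    apply: kept_trans k1 (kept_trans (kept_weak _ _ k2) (kept_setv _ _ _)).
    + exact: leq_addr.
    + by move=> z zb; rewrite inE zb orbT.
    + by rewrite leqnn.
  by rewrite sv_set er e2 e big_nat_recr.
move=> /and4P[wm /eqP bm nxb nyb] lt vn.
have br : b < r by apply: lt; rewrite mem_cat !inE eqxx !orbT.
have xr : x < r by apply: lt; rewrite !inE eqxx.
have yr : y < r by apply: lt; rewrite !inE eqxx orbT.
have xn : sv st x < n by apply: vn; rewrite !inE eqxx.
have yn : sv st y < n by apply: vn; rewrite !inE eqxx orbT.
have fm z : z \in fv m -> z != b -> z \in fv (TReach b m x y).
  by move=> zm nzb; rewrite !inE mem_filter nzb zm !orbT.
have fr z : z \in fv m -> z < r.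
  move=> zm; have [->//|nzb] := eqVneq z b.
  by apply: lt; rewrite mem_cat fm.
pose PP i := ev (sa st 0) (sa st 1) m [eta sv st with b |-> i] != 0.
have cmP s : kept r [:: b] st s -> sv s b < n ->
    (sv (den (tcomp m (r + 8)) s) (r + 8) != 0) = PP (sv s b) /\
    kept (r + 8) [::] s (den (tcomp m (r + 8)) s) /\ sa (den (tcomp m (r + 8)) s) = sa s.
  move=> ks sb; have [z|z zm|e k] := IH (r + 8) s wm.
  - by rewrite bm cats0 => /fr; lia.
  - have [->//|nzb] := eqVneq z b.
    by rewrite (proj1 ks) ?inE //; [apply: vn (fm _ zm nzb)|apply: fr].
  rewrite bm in k; split; last by split; rewrite ?tcomp_sa.
  rewrite e /PP; congr (_ != 0); apply: ev_ext => [z|z|z zm]; [by apply: (proj2 ks)..|].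
  rewrite /=; have [->//|nzb] := eqVneq z b.
  by rewrite (proj1 ks) ?inE //; apply: fr.
have [e k] := reachloop_correct br xr yr nxb nyb xn yn cmP (erefl _).
by rewrite [tcomp _ _]/= [bv _]/= bm; split.
Qed.

End Eval.

(** * Decision trees and their exhaustive traversal *)

(** The binary choices of the branching algorithm. Correctness speaks of the existence of a good
    leaf, while the machine visits the leaves one by one. *)
Inductive tree (A : Type) : Type :=
| Ret (a : A)
| Ask (f : bool -> tree A).
Arguments Ask {A} f.

Section Trees.
Variables A B : Type.
Implicit Types (t : tree A) (g : A -> tree B) (p q : seq bool).

Fixpoint bind t g : tree B :=
  match t with Ret a => g a | Ask f => Ask (fun b => bind (f b) g) end.

(* Descends along [p], and along the [false] branches once [p] is exhausted;
   also returns the path actually taken. *)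
Fixpoint walk t p : seq bool * A :=
  match t with
  | Ret a => ([::], a)
  | Ask f => let: (q, a) := walk (f (head false p)) (behead p) in
             (head false p :: q, a)
  end.

Fixpoint fits t p : bool :=
  match t, p with
  | _, [::] => true
  | Ret _, _ => false
  | Ask f, b :: p' => fits (f b) p'
  end.

Fixpoint leaves t : nat :=
  match t with Ret _ => 1 | Ask f => leaves (f false) + leaves (f true) end.

Fixpoint depth t : nat :=
  match t with Ret _ => 0 | Ask f => (maxn (depth (f false)) (depth (f true))).+1 end.

Fixpoint may (P : A -> Prop) t : Prop :=
  match t with Ret a => P a | Ask f => may P (f false) \/ may P (f true) end.

Lemma walk_depth t p : size (walk t p).1 <= depth t.
Proof.
elim: t p => //= f IH p; have := IH (head false p) (behead p).
by case: (walk _ _) => q a /=; case: (head _ _) => /=; rewrite ltnS leq_max => ->; rewrite ?orbT.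
Qed.

Lemma fits_drop t p : fits t p -> drop (size (walk t p).1) p = [::].
Proof.
elim: t p => [a [|//]|f IH [|b p]] //= ft.
by have := IH _ _ ft; case: (walk _ _).
Qed.

Lemma may_weak (P Q : A -> Prop) t : (forall a, P a -> Q a) -> may P t -> may Q t.
Proof. by move=> h; elim: t => [a|f IH] /=; [apply: h|case=> /IH; tauto]. Qed.

Lemma may_walk P t : may P t -> exists p, P (walk t p).2.
Proof.
elim: t => [a|f IH] /=; first by exists [::].
by case=> /IH[p hp]; [exists (false :: p)|exists (true :: p)];
  move: hp => /=; case: (walk _ _).
Qed.
End Trees.

(** Depth-first successor: the last [false] becomes [true] and everything after it is dropped, for
    the next walk to fill in with [false]. *)
Fixpoint nextp (q : seq bool) : option (seq bool) :=
  if q is b :: q' then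
    if nextp q' is Some p then Some (b :: p) else
    if b then None else Some [:: true]
  else None.

Lemma nextp_false q : nextp (rcons q false) = Some (rcons q true).
Proof. by elim: q => //= b q ->. Qed.

Lemma nextp_true q : nextp (rcons q true) = nextp q.
Proof. by elim: q => //= b q ->. Qed.

Section Search.
Variables (A : Type) (ok : A -> bool).
Implicit Types (t : tree A) (p q : seq bool).

Lemma fits_next t p p' : nextp (walk t p).1 = Some p' -> fits t p'.
Proof.
elim: t p p' => //= f IH p p'; have := IH (head false p) (behead p).
case: (walk _ _) => q a /=; case: (nextp q) => [p1|] h.
  by case=> <- /=; apply: h.
by case: (head _ _) => // -[<-] /=; case: (f true).
Qed.

(** The traversal resumed at a given path: the number counts the walks made, the Boolean is the
    final answer. *)
Inductive sweep t : seq bool -> nat -> bool -> Prop :=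
| sweep_yes p : ok (walk t p).2 -> sweep t p 1 true
| sweep_no p : ~~ ok (walk t p).2 -> nextp (walk t p).1 = None -> sweep t p 1 false
| sweep_go p p' N b : ~~ ok (walk t p).2 -> nextp (walk t p).1 = Some p' ->
    sweep t p' N b -> sweep t p N.+1 b.

Fixpoint hasok t : bool :=
  match t with Ret a => ok a | Ask f => hasok (f false) || hasok (f true) end.

Lemma sweep_true f p N b : sweep (f true) p N b -> sweep (Ask f) (true :: p) N b.
Proof.
elim=> {p N b} [p y|p y e|p p' N b y e _ IH].
- by apply: sweep_yes => /=; case: (walk _ _) y.
- by apply: sweep_no => /=; case: (walk _ _) y e => //= q a _ ->.
- by apply: sweep_go IH => /=; case: (walk _ _) y e => //= q a _ ->.
Qed.

Lemma sweep_false f p N b M b' : sweep (f false) p N b -> sweep (Ask f) [:: true] M b' ->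
  if b then sweep (Ask f) (false :: p) N true else sweep (Ask f) (false :: p) (N + M) b'.
Proof.
move=> d d'; elim: d => {p N b} [p y|p y e|p p' N b y e _ IH].
- by apply: sweep_yes => /=; case: (walk _ _) y.
- by apply: sweep_go d' => /=; case: (walk _ _) y e => //= q a _ ->.
- by case: b IH => IH; apply: sweep_go IH => /=; case: (walk _ _) y e => //= q a _ ->.
Qed.

Lemma sweep_walk t p p' N b : walk t p = walk t p' -> sweep t p N b -> sweep t p' N b.
Proof.
move=> h d; case: d h => {p N b} [p y|p y e|p p1 N b y e d] h.
- by apply: sweep_yes; rewrite -h.
- by apply: sweep_no; rewrite -h.
- by apply: sweep_go d; rewrite -h.
Qed.

Lemma sweep_nil f N b : sweep (Ask f) [:: false] N b -> sweep (Ask f) [::] N b.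
Proof. exact: sweep_walk. Qed.

(** Walks below [false] come first and, unless one succeeds, those below [true] follow; their
    numbers add up as the leaves do. *)
Lemma sweep_complete t : exists N, N <= leaves t /\ sweep t [::] N (hasok t).
Proof.
elim: t => [a|f IH] /=.
  exists 1; split=> //; case oa: (ok a); first exact: sweep_yes.
  by apply: sweep_no; rewrite ?oa.
have [N1 [l1 d1]] := IH false; have [N2 [l2 /sweep_true d2]] := IH true.
have := sweep_false d1 (_ : sweep (Ask f) [:: true] N2 _).
have d2' : sweep (Ask f) [:: true] N2 (hasok (f true)).
  exact: d2.
move=> /(_ _ d2'); case: (hasok (f false)) => /= d.
  by exists N1; split; [lia|apply: sweep_nil].
by exists (N1 + N2); split; [lia|apply: sweep_nil].
Qed.

Lemma may_hasok t : may (fun a => ok a) t -> hasok t.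
Proof. by elim: t => //= f IH [] /IH ->; rewrite ?orbT. Qed.

Lemma hasokP t : hasok t -> exists a, ok a.
Proof. by elim: t => [a|f IH] /=; [exists a|case/orP=> /IH]. Qed.
End Search.

Section Bind.
Variables A B : Type.
Implicit Types (t : tree A) (g : A -> tree B) (p q : seq bool).

Lemma walk_bind t g p : walk (bind t g) p =
  ((walk t p).1 ++ (walk (g (walk t p).2) (drop (size (walk t p).1) p)).1,
   (walk (g (walk t p).2) (drop (size (walk t p).1) p)).2).
Proof.
elim: t p => [a|f IH] p /=; first by rewrite drop0; case: (walk _ _).
by rewrite IH; case: (walk _ _) => q a /=; case: p.
Qed.

Lemma may_bind (P : A -> Prop) (Q : B -> Prop) t g : may P t ->
  (forall a, P a -> may Q (g a)) -> may Q (bind t g).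
Proof. by move=> mt h; elim: t mt => [a|f IH] /=; [apply: h|case=> /IH; tauto]. Qed.

Lemma depth_bind t g d : (forall a, depth (g a) <= d) -> depth (bind t g) <= depth t + d.
Proof.
move=> h; elim: t => [a|f IH] //=; rewrite addSn ltnS geq_max.
by rewrite !(leq_trans (IH _)) // leq_add2r ?leq_maxl ?leq_maxr.
Qed.
End Bind.

Section Fold.
Variables (I A : Type) (F : I -> A -> tree A).

Fixpoint foldt (s : seq I) (a : A) : tree A :=
  if s is i :: s' then bind (F i a) (foldt s') else Ret a.

Lemma depth_foldt d s a : (forall i b, depth (F i b) <= d) -> depth (foldt s a) <= size s * d.
Proof.
move=> h; elim: s a => //= i s IH a; rewrite mulSn.
by apply: leq_trans (depth_bind _ IH) _; rewrite leq_add2r.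
Qed.
End Fold.

(** The number of rounds is fixed, as in the loops of the language; [rounds_settle] makes it suffice
    that a stuck state stays put and that other rounds decrease a measure. *)
Definition rounds (A : Type) (F : A -> tree A) (N : nat) : A -> tree A :=
  foldt (fun _ : nat => F) (iota 0 N).

Lemma rounds_settle (A : Type) (F : A -> tree A) (Inv : A -> Prop) (stuck : A -> bool)
    (mu : A -> nat) N a :
  (forall a, Inv a -> stuck a -> F a = Ret a) ->
  (forall a, Inv a -> ~~ stuck a -> may (fun b => Inv b /\ mu b < mu a) (F a)) ->
  Inv a -> mu a <= N -> may (fun b => Inv b /\ stuck b) (rounds F N a).
Proof.
move=> h1 h2; rewrite /rounds; elim: N 0 a => [|N IH] o a ia le /=.
  case sa: (stuck a) => //; have [] := may_walk (h2 a ia (negbT sa)).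
  by move=> p [_]; rewrite ltnNge (leq_trans le).
case sa: (stuck a).
  rewrite h1 //=; elim: N (o.+1) {IH le} => //= N IH o'.
  by rewrite h1 //=.
apply: may_bind (h2 a ia (negbT sa)) _ => b [ib lt]; apply: IH => //.
by rewrite -ltnS (leq_trans lt).
Qed.

(** The last suitable element, which is what a loop overwriting its result finds; so [seek] computes
    exactly this choice. *)
Definition pickl (T : finType) (P : pred T) : option T :=
  foldl (fun o i => if P i then Some i else o) None (enum T).

Variant pickl_spec (T : finType) (P : pred T) : option T -> Type :=
| PicklSome i of P i : pickl_spec P (Some i)
| PicklNone of P =1 xpred0 : pickl_spec P None.

Lemma picklP (T : finType) (P : pred T) : pickl_spec P (pickl P).
Proof.
rewrite /pickl; have h s : match foldl (fun o i => if P i then Some i else o) None s with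
    Some i => P i | None => all (predC P) s end.
  elim/last_ind: s => //= s x; rewrite -cats1 foldl_cat all_cat /=.
  by case Px: (P x) => //; case: (foldl _ _ _) => //= ->.
case: (foldl _ _ _) (h (enum T)) => [i Pi|/allP al]; constructor => // i.
by apply/negbTE/al; rewrite mem_enum.
Qed.

Lemma eq_pickl (T : finType) (P Q : pred T) : P =1 Q -> pickl P = pickl Q.
Proof.
move=> e; rewrite /pickl; elim: (enum T) None => //= i s IH o.
by rewrite e IH.
Qed.

Record mst (T : finType) := Mst {mF : {set T}; mU : {set T}; mL : nat; mK : nat}.

(** * Greedy maximal forests *)

Section Greedy.
Variables (T : finType) (e : rel T).
Hypotheses (sym_e : symmetric e) (irr_e : irreflexive e).
Implicit Types (F U W P : {set T}) (i u : T).

Definition grow P W i := if (i \in P) && ~~ blocked e W i then i |: W else W.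
Definition pass P W := foldl (grow P) W (enum T).
(** The order of preference matters: when [F] is acyclic, the result contains it and is already
    maximal within [F :|: U]. *)
Definition greedy F U := pass (~: (F :|: U)) (pass U (pass F set0)).

Lemma grow_fold P W (s : seq T) : acyc e W ->
  [/\ acyc e (foldl (grow P) W s), W \subset foldl (grow P) W s,
    foldl (grow P) W s \subset W :|: P
    & forall i, i \in s -> i \in P -> i \notin foldl (grow P) W s ->
        blocked e (foldl (grow P) W s) i].
Proof.
elim: s W => [|j s IH] W aW /=; first by split; rewrite ?subsetUl.
have aj : acyc e (grow P W j).
  rewrite /grow; case: ifP => // /andP[_ nb].
  have [jW|jW] := boolP (j \in W); last exact: (acyc_add sym_e jW aW nb).
  by rewrite (setUidPr _) ?sub1set.
have sj : W \subset grow P W j by rewrite /grow; case: ifP => _ //; apply: subsetUr.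
have [h1 h2 h3 h4] := IH _ aj; split=> //; first exact: subset_trans h2.
  apply: subset_trans h3 _; rewrite subUset subsetUr andbT /grow.
  case: ifP => [/andP[jP _]|_]; last exact: subsetUl.
  by rewrite subUset subsetUl sub1set inE jP orbT.
move=> i; rewrite inE => /predU1P[->|]; last exact: h4.
move=> jP nj; apply: blocked_mono (subset_trans sj h2) _.
case nb: (blocked e W j) => //.
by case/negP: nj; apply: (subsetP h2); rewrite /grow jP nb setU11.
Qed.

Lemma passP P W : acyc e W ->
  [/\ acyc e (pass P W), W \subset pass P W, pass P W \subset W :|: P
    & forall i, i \in P -> i \notin pass P W -> blocked e (pass P W) i].
Proof.
move=> /(grow_fold P (enum T))[h1 h2 h3 h4]; split=> // i; apply: h4.
by rewrite mem_enum.
Qed.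

Lemma pass0 F : acyc e F -> pass F set0 = F.
Proof.
move=> aF; have [h1 _ h3 h4] := passP F (@acyc0 _ e).
rewrite set0U in h3; apply/eqP; rewrite eqEsubset h3; apply/subsetP=> i iF.
apply/negPn/negP=> ni; apply: (blocked_cyclic sym_e ni (h4 i iF ni)).
by apply: acyc_mono aF; rewrite subUset sub1set iF.
Qed.

Lemma greedy_maximal F U : acyc e (greedy F U) /\
  forall u, u \notin greedy F U -> blocked e (greedy F U) u.
Proof.
have [a1 _ _ b1] := passP F (@acyc0 _ e).
have [a2 s2 _ b2] := passP U a1; have [a3 s3 _ b3] := passP (~: (F :|: U)) a2.
split=> // u nu; have [uF|uF] := boolP (u \in F).
  apply: blocked_mono (subset_trans s2 s3) _; apply: b1 => //.
  by apply: contra nu; apply/subsetP; apply: subset_trans s3.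
have [uU|uU] := boolP (u \in U).
  by apply: (blocked_mono s3); apply: b2 => //; apply: contra nu; apply: (subsetP s3).
by apply: b3 => //; rewrite !inE negb_or uF.
Qed.

(** The greedy forest is maximal for arbitrary [F] and [U], so wrong guesses never cause a false
    yes. *)
Lemma greedy_sound F U k : k <= #|~: greedy F U| -> max_min_fvs e k.
Proof.
move=> le; apply/max_min_fvsP => //; exists (greedy F U).
by have [h1 h2] := greedy_maximal F U; split.
Qed.

Lemma greedy_leaf F U : acyc e F ->
  F \subset greedy F U /\
  {in (F :|: U) :\: greedy F U,
    forall u, blocked e (greedy F U :&: (F :|: U)) u}.
Proof.
move=> aF; rewrite /greedy pass0 //; have [a2 s2 t2 b2] := passP U aF.
have [a3 s3 _ b3] := passP (~: (F :|: U)) a2.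
have sF := subset_trans s2 s3; split=> // u; rewrite !inE => /andP[nu].
rewrite (contraNF (subsetP sF u)) //= => uU.
apply: (@blocked_mono _ _ (pass U F)); first by rewrite subsetI s3.
by apply: b2 => //; apply: contra nu; apply: (subsetP s3).
Qed.
End Greedy.

(** * The branching algorithm *)

Section Algo.
Variables (T : finType) (e : rel T) (X : {set T}) (k : nat).
Hypotheses (sym_e : symmetric e) (irr_e : irreflexive e).
Implicit Types (F U W : {set T}) (m : mst T) (i u v s p : T).
Local Notation ed := (ed e).
Local Notation comp := (compt e).

Definition settle F U L K : mst T := Mst (absF e F U) (absU e F U) L K.
Definition plant v m L K : mst T := settle (v |: mF m) (mU m :\ v) L K.
Definition toss v m L K : mst T := settle (mF m) (mU m :\ v) L K.

(** A vertex guessed into the forest raises [L] by one, as [phase1_init] requires. *)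
Definition guess i m : tree (mst T) :=
  if i \in X then Ret m else
  Ask (fun b => Ret (if b then Mst (i |: mF m) (mU m) (mL m).+1 (mK m) else m)).

Definition heavy m p : bool :=
  [&& p \in mU m, 3 <= ed (comp (mU m) p) (mF m), pivot e (mF m) (mU m) p
    & light e (mF m) (mU m) p].

Definition step1 m : tree (mst T) :=
  if pickl (heavy m) is Some p then
    if 0 < mL m then
      Ask (fun b => Ret (if b then plant p m (mL m).-1 (mK m)
                         else toss p m (mL m).-1 (mK m).-1))
    else Ret m
  else Ret m.

Definition forced m v : bool := [exists s, ruleA e (mF m) (mU m) s v].
Definition pending m s : bool := [exists v, ruleB e (mF m) (mU m) s v].

(** When [s] becomes satisfied it is newly settled and pays for the unit of [K]; the loss inside [U]
    being unchanged, [L] may drop too. *)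
Definition step2C s m : tree (mst T) :=
  if pickl (ruleC e (mF m) (mU m) s) is Some v then
    Ask (fun b => Ret (if b then toss v m (mL m) (mK m).-1
                       else plant v m (mL m).-1 (mK m).-1))
  else Ret (Mst (mF m) (mU m) (mL m).-1 (mK m).-1).

Definition step2B m : tree (mst T) :=
  if pickl (pending m) is Some s then
    if pickl (ruleB e (mF m) (mU m) s) is Some v then
      Ask (fun b => if b then Ret (toss v m (mL m) (mK m).-1)
                    else step2C s (plant v m (mL m) (mK m)))
    else Ret m
  else Ret m.

Definition step2 m : tree (mst T) :=
  if pickl (forced m) is Some v then Ret (plant v m (mL m) (mK m)) else
  if (0 < mK m) && (0 < mL m) then step2B m else Ret m.

Definition algo : tree (mst T) :=
  bind (foldt guess (enum T) (Mst set0 X k k)) (fun m0 =>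
  bind (rounds step1 #|T| (settle (mF m0) (mU m0) (mL m0) (mK m0))) (fun m1 =>
  if 0 < mL m1 then rounds step2 #|T| m1 else Ret m1)).

Definition good m : bool := k <= #|~: greedy e (mF m) (mU m)|.

(** At most one question per guess and per round of the first phase, two per round of the second.
    The four loops of [backC] rely on this bound. *)
Lemma depth_algo : depth algo <= 4 * #|T|.
Proof.
have d1 m : depth (step1 m) <= 1.
  by rewrite /step1; case: (pickl _) => // p; case: (0 < _).
have d2 m : depth (step2 m) <= 2.
  rewrite /step2; case: (pickl _) => // ; case: (_ && _) => //; rewrite /step2B.
  case: (pickl _) => // s; case: (pickl _) => //= v.
  by rewrite /step2C; case: (pickl _).
have d0 i m : depth (guess i m) <= 1 by rewrite /guess; case: (i \in X).
have -> : 4 * #|T| = #|T| * 1 + (#|T| * 1 + #|T| * 2) by lia.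
apply: leq_trans (depth_bind (d := #|T| * 1 + #|T| * 2) _ _) _ => [m|].
  apply: leq_trans (depth_bind (d := #|T| * 2) _ _) _ => [m'|].
    case: (0 < _) => //; apply: leq_trans (depth_foldt _ _ (fun _ => d2)) _.
    by rewrite size_iota.
  rewrite leq_add2r; apply: leq_trans (depth_foldt _ _ (fun _ => d1)) _.
  by rewrite size_iota.
by rewrite leq_add2r; apply: leq_trans (depth_foldt _ _ d0) _; rewrite -cardE.
Qed.

Lemma sound : hasok good algo -> max_min_fvs e k.
Proof. by case/hasokP => m; apply: greedy_sound. Qed.

Section Complete.
Variable M : {set T}.
Hypotheses (acM : acyc e M) (maxM : forall u, u \notin M -> blocked e M u)
  (kM : k <= #|~: M|) (acX : acyc e X).

Lemma may_guess (s : seq T) m : may (fun m' => [/\ mF m' = mF m :|: [set i in s | i \in M :\: X],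
    mU m' = mU m, mL m' = mL m + count (mem (M :\: X)) s & mK m' = mK m])
  (foldt guess s m).
Proof.
elim: s m => [|i s IH] m /=.
  by rewrite addn0; split=> //; apply/setP=> x; rewrite !inE; case: (x \in mF m).
have step m' : mU m' = mU m -> mK m' = mK m -> mL m' = mL m + (i \in M :\: X) ->
    mF m' = mF m :|: [set j in [set i] | j \in M :\: X] ->
    may (fun m'' => [/\ mF m'' = mF m :|: [set j in i :: s | j \in M :\: X],
      mU m'' = mU m, mL m'' = mL m + ((i \in M :\: X) + count (mem (M :\: X)) s)
      & mK m'' = mK m]) (foldt guess s m').
  move=> eU eK eL eF; apply: may_weak (IH m') => m'' [-> -> -> ->].
  rewrite eU eK eL eF addnA; split=> //; apply/setP=> x; rewrite !inE.
  by case: (x \in mF m); case: (x == i); case: (x \in s); case: (x \in M); case: (x \in X).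
have sub b : i \in M :\: X = b ->
  [set j in [set i] | j \in M :\: X] = if b then [set i] else set0.
  move=> <-; apply/setP=> x; rewrite !inE; case: eqVneq => [->|]; rewrite ?andbF //=.
    by case: (i \in X); case: (i \in M); rewrite !inE ?eqxx.
  by case: ifP; rewrite !inE // => _ /negPf->.
rewrite /guess; case: ifP => iX /=.
  have iN : i \in M :\: X = false by rewrite !inE iX.
  by apply: step; rewrite ?iN ?addn0 ?(sub _ iN) ?setU0.
have [iM|iM] := boolP (i \in M); [right|left]; apply: step => //=.
- by rewrite !inE iX iM addn1.
- by rewrite (@sub true) 1?setUC // !inE iX iM.
- by rewrite !inE (negPf iM) andbF addn0.
- by rewrite (@sub false) ?setU0 // !inE (negPf iM) andbF.
Qed.

Let inv1 m := phase1 e M X k (mF m) (mU m) (mL m) (mK m).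
Let inv2 m := phase2 e M k (mF m) (mU m) (mL m) (mK m).

Lemma absU_lt F U v : v \in U -> #|absU e F (U :\ v)| < #|U|.
Proof.
move=> vU; rewrite [#|U|](cardsD1 v) vU ltnS; apply: subset_leq_card.
exact: subsetDl.
Qed.

Lemma step1_ok m : inv1 m -> may (fun m' => inv1 m' /\
    ((pickl (heavy m') == None) || (mL m' == 0))) (rounds step1 #|T| m).
Proof.
move=> im; apply: (@rounds_settle _ _ _ _ (fun m => #|mU m|)) => //; last exact: max_card.
  move=> m' _; rewrite /step1; case: (pickl _) => //= p.
  by case: (mL m').
case=> F U L K; rewrite /inv1 /step1 /=; case: picklP => //= p /and4P[/= pU E3 pv lt].
case: L => //= L inv _; have [pM|pM] := boolP (p \in M).
  right; split; last exact: absU_lt.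
  by apply: phase1_abs => //; apply: phase1_F E3 _.
left; split; last exact: absU_lt.
by apply: phase1_abs => //; apply: phase1_S E3 _ _.
Qed.

Lemma forcedN m : pickl (forced m) = None ->
  forall s v, ~~ ruleA e (mF m) (mU m) s v.
Proof.
case: picklP => // h _ s v; apply/negP=> r.
by have := negbT (h v); rewrite /forced => /existsP[]; exists s.
Qed.

Let stuck2 m := (pickl (forced m) == None) &&
  [|| mK m == 0, mL m == 0 | pickl (pending m) == None].

(** Every question is answered according to [M]; each round that is not stuck removes a vertex from
    [U], so [#|T|] rounds suffice. *)
Lemma step2_ok m : inv2 m -> may (fun m' => inv2 m' /\ stuck2 m') (rounds step2 #|T| m).
Proof.
move=> im; apply: (@rounds_settle _ _ _ _ (fun m => #|mU m|)) => //; last exact: max_card.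
  move=> m' _ /andP[/eqP eA h]; rewrite /step2 eA /step2B.
  by case/or3P: h => /eqP ->; rewrite ?andbF //; case: (_ && _).
case=> F U L K; rewrite /inv2 /stuck2 /step2 => /= inv.
case eA: (pickl (forced (Mst F U L K))) => [v|] /=.
  move: eA; case: picklP => // v'; rewrite {1}/forced => /existsP[s /= rA] [<-] _.
  have [vU pv] := ruleA_serve rA; have vM := ruleA_M sym_e maxM inv rA.
  have ss := settled_step_F sym_e irr_e maxM inv vU vM.
  split; last exact: absU_lt.
  have [_ [_ [h1 h2]]] := inv; apply: (phase2_F sym_e irr_e maxM inv) => //.
  by apply: leq_trans h1 _; rewrite leq_add2r subset_leq_card.
have nA := forcedN eA; rewrite /= in nA; move=> {eA}.
case: K inv => [|K] inv //=; case: L inv => [|L] inv //=.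
rewrite /step2B; case: picklP => //= s; rewrite {1}/pending => /existsP[v0 r0].
case: picklP => [v /= rB|/(_ v0)]; last by rewrite r0.
move=> _; have [vU pv] := ruleB_serve rB; have [vM|vM] := boolP (v \in M); last first.
  right; split; last exact: absU_lt.
  exact: (phase2_S sym_e irr_e maxM kM inv).
(* With [v] in [M], the unsettled [s] gets settled, now or after rule C; this pays for the unit of
   [K]. *)
left; have ss := settled_step_F sym_e irr_e maxM inv vU vM.
have [ok1 [_ [h1 h2]]] := inv; have nset := ruleB_unsettled sym_e irr_e maxM inv nA rB.
have inv' : phase2 e M k (absF e (v |: F) (U :\ v)) (absU e (v |: F) (U :\ v)) L.+1 K.+1.
  apply: (phase2_F sym_e irr_e maxM inv) => //.
  by apply: leq_trans h1 _; rewrite leq_add2r subset_leq_card.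
have := ruleB_F sym_e irr_e inv rB vM inv'; cbv zeta.
have count F' U' : settled e F U \subset settled e F' U' -> s \in settled e F' U' ->
    k <= #|settled e F' U'| + K.
  move=> sub sin; apply: leq_trans h1 _; rewrite addnS -addSn leq_add2r.
  apply: proper_card; rewrite properE sub; apply/negP=> /subsetP/(_ s sin).
  by rewrite (negPf nset).
have sout F' U' : F' :|: U' \subset F :|: U -> sat e F' U' s -> s \in settled e F' U'.
  move=> sub st; rewrite !inE st andbT -in_setU.
  apply: contra (_ : s \notin F :|: U); first exact: (subsetP sub).
  by case/and3P: rB.
have absS F' U' : absF e F' U' :|: absU e F' U' = F' :|: U' by apply: absFU.
have sub1 : absF e (v |: F) (U :\ v) :|: absU e (v |: F) (U :\ v) \subset F :|: U.
  by rewrite absS setU1D1.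
rewrite /step2C /=; case: picklP => [v' /= rC _|nC]; last first.
  case=> [st|[v' rC]]; last by have := nC v'; rewrite /= rC.
  split; last exact: absU_lt.
  apply: (phase2_F sym_e irr_e maxM inv) => //.
  by apply: count => //; apply: sout.
set F1 := absF _ _ _ in inv' sub1 ss rC *; set U1 := absU _ _ _ in inv' sub1 ss rC *.
have lt1 : #|U1| <= #|U| by apply/ltnW/absU_lt.
have [v'U pv'] := ruleC_serve rC; have [v'M|v'M] := boolP (v' \in M); last first.
  right; split; last exact: leq_trans (absU_lt _ v'U) lt1.
  exact: (phase2_S sym_e irr_e maxM kM inv').
left; split; last exact: leq_trans (absU_lt _ v'U) lt1.
have [_ [_ [_ h2']]] := inv'.
apply: (phase2_F sym_e irr_e maxM inv') => //; apply: count.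
  exact: subset_trans ss (settled_step_F sym_e irr_e maxM inv' v'U v'M).
apply: sout; last exact: (ruleC_F sym_e irr_e inv' rC).
by apply: subset_trans sub1; rewrite absS setU1D1.
Qed.

(** Answers agreeing with [M] lead to a leaf where [phase1_leaf] or [phase2_leaf] applies to the
    greedy forest. *)
Lemma complete : hasok good algo.
Proof.
apply: may_hasok; rewrite /algo; apply: (may_bind (may_guess (enum T) (Mst set0 X k k))) => -[F U L K] /= [-> -> -> ->].
rewrite set0U; set F0 := [set i in _ | _].
have -> : F0 = M :\: X by apply/setP=> i; rewrite !inE mem_enum.
have -> : count (mem (M :\: X)) (enum T) = #|M :\: X|.
  by rewrite cardE -size_filter /enum_mem filter_predT.
have i1 := phase1_abs sym_e irr_e maxM kM (phase1_init kM acX).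
apply: (may_bind (@step1_ok (settle (M :\: X) X (k + #|M :\: X|) k) i1)) => -[{}F {}U {}L {}K] [/= inv st].
have aF : acyc e F.
  by have [[sFM _ _ _] _] := inv; apply: acyc_mono acM.
have [aG _] := greedy_maximal sym_e F U; have [sG _] := greedy_leaf sym_e U aF.
case: posnP => [L0|Lp] /=.
  rewrite /inv1 /= L0 in inv; rewrite /good /=.
  exact: (phase1_leaf sym_e irr_e kM inv).
move: st; rewrite /= (gtn_eqF Lp) orbF => /eqP; case: picklP => // nh _.
have acU : acyc e U by have [[_ _ ]] := inv.
have i2 : inv2 (Mst F U L K).
  apply: (phase1_phase2 sym_e irr_e acM kM inv) => u uU; rewrite leqNgt; apply/negP=> E3.
  have [p [pu pv lt]] := pivot_exists sym_e irr_e acU uU (ltnW E3).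
  have := nh p; rewrite /heavy /= pv lt.
  move: pu; rewrite mem_comp => /andP[-> /(comp_eq sym_e) <-].
  by rewrite E3.
move=> {nh aF aG sG acU Lp}; apply: may_weak (step2_ok i2) => {inv i2} -[{}F {}U {}L {}K] [inv' /andP[/eqP eA /= st]].
have aF' : acyc e F.
  by have [[sFM _ _ _] _] := inv'; apply: acyc_mono acM.
have [aG' _] := greedy_maximal sym_e F U; have [sG' bG'] := greedy_leaf sym_e U aF'.
apply: (phase2_leaf sym_e irr_e acM maxM kM inv') => //; first exact: forcedN eA.
case/or3P: st => /eqP; [by right; left|by left|].
case: picklP => // nB _; right; right => s v; apply/negP=> rB.
by have := negbT (nB s); rewrite /pending => /existsP[]; exists v.
Qed.
End Complete.

Lemma hasok_algo : acyc e X -> hasok good algo <-> max_min_fvs e k.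
Proof.
move=> acX; split; first exact: sound.
by case/max_min_fvsP=> // M [acM maxM kM]; apply: complete acM maxM kM acX.
Qed.
End Algo.

(** * Counting the leaves by weights *)

Section Weights.
Import Order.TTheory GRing.Theory Num.Theory.
Local Open Scope ring_scope.

Fixpoint wsum (A : Type) (w : A -> rat) (t : tree A) : rat :=
  match t with Ret a => w a | Ask f => wsum w (f false) + wsum w (f true) end.

Lemma leaves_wsum (A : Type) (t : tree A) : (leaves t)%:R = wsum (fun=> 1) t.
Proof. by elim: t => //= f IH; rewrite natrD !IH. Qed.

Lemma wsum_bind (A B : Type) (w : B -> rat) (t : tree A) (g : A -> tree B) :
  wsum w (bind t g) = wsum (fun a => wsum w (g a)) t.
Proof. by elim: t => //= f IH; rewrite !IH. Qed.

Lemma wsum_le (A : Type) (w w' : A -> rat) t : (forall a, w a <= w' a) ->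
  wsum w t <= wsum w' t.
Proof. by move=> h; elim: t => //= f IH; apply: lerD. Qed.

Lemma wsum_rounds (A : Type) (w : A -> rat) (F : A -> tree A) N a :
  (forall a, wsum w (F a) <= w a) -> wsum w (rounds F N a) <= w a.
Proof.
move=> h; rewrite /rounds; elim: N 0%N a => [|N IH] o a //=.
by rewrite wsum_bind; apply: le_trans (wsum_le _ (IH _)) (h a).
Qed.

Section Leaves.
Variables (T : finType) (e : rel T) (X : {set T}) (k : nat).
Implicit Types (m : mst T).

(** Weights bound the leaves still to come. Rule B with rule C splits 3^K (4/3)^L into shares 1/3 +
    1/3 + 1/4 < 1, a pivot into 3/4 + 1/4 = 1. Once [K] has reached 0 the second phase no longer
    branches, and the summand 2^L bounds the rest of the first. *)
Let a (K L : nat) : rat := if (0 < K)%N then 3 ^+ K * (4 / 3) ^+ L else 0.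
Let w2 m : rat := if (0 < mK m)%N then 3 ^+ mK m * (4 / 3) ^+ mL m else 1.
Let w1 m : rat := a (mK m) (mL m) + 2 ^+ mL m.

Let pow3 K : 1 <= 3 ^+ K :> rat. Proof. exact: exprn_ege1. Qed.
Let pow4 L : 1 <= (4 / 3) ^+ L :> rat. Proof. by apply: exprn_ege1. Qed.
Let pow2 L : 1 <= 2 ^+ L :> rat. Proof. exact: exprn_ege1. Qed.
Let pow34 K L : 1 <= 3 ^+ K * (4 / 3) ^+ L :> rat.
Proof. by rewrite mulr_ege1. Qed.

Lemma w2_ge1 m : 1 <= w2 m. Proof. by rewrite /w2; case: ifP. Qed.

Lemma a_ge0 K L : 0 <= a K L.
Proof. by rewrite /a; case: ifP => // _; apply: le_trans (pow34 K L). Qed.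

Lemma step2_weight m : wsum w2 (step2 e m) <= w2 m.
Proof.
case: m => F U L K; rewrite /step2 /=; case: pickl => [v|] /=; first by [].
case: K => [|K] //=; case: L => [|L] //=; rewrite /step2B /=.
case: pickl => [s|] //=; case: pickl => [v|] //=.
rewrite /step2C /=; have h : w2 (Mst F U L K) <= 3 ^+ K * (4 / 3) ^+ L.
  by rewrite /w2 /=; case: ifP => // _; apply: pow34.
have h' F' U' : w2 (Mst F' U' L K) <= 3 ^+ K * (4 / 3) ^+ L.
  by rewrite /w2 /=; case: ifP => // _; apply: pow34.
have h2 F' U' : w2 (Mst F' U' L.+1 K) <= 4 / 3 * (3 ^+ K * (4 / 3) ^+ L).
  rewrite /w2 /=; case: ifP => _; first by rewrite exprS mulrCA.
  by have := pow34 K L; lra.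
have -> : w2 (Mst F U L.+1 K.+1) = 4 * (3 ^+ K * (4 / 3) ^+ L).
  by rewrite /w2 /= !exprS; field.
have p := pow34 K L; rewrite /toss /plant /settle.
case: pickl => [v'|] /=; last first.
  by have := h' (absF e (v |: F) (U :\ v)) (absU e (v |: F) (U :\ v));
     have := h2 (absF e F (U :\ v)) (absU e F (U :\ v)); lra.
set F1 := absF _ (_ |: _) _; set U1 := absU _ (_ |: _) _.
have := h2 (absF e F (U :\ v)) (absU e F (U :\ v)).
have := h2 (absF e F1 (U1 :\ v')) (absU e F1 (U1 :\ v')).
have := h' (absF e (v' |: F1) (U1 :\ v')) (absU e (v' |: F1) (U1 :\ v')).
lra.
Qed.

Lemma step1_weight m : wsum w1 (step1 e m) <= w1 m.
Proof.
case: m => F U L K; rewrite /step1 /=; case: pickl => [v|] //=.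
case: L => [|L] //=; rewrite /w1 /a /= !exprS.
have p := pow34 K.-1 L; have q := pow2 L; case: K p => [|K] /= p; first lra.
have -> : (3 ^+ K.+1 : rat) = 3 * 3 ^+ K by rewrite exprS.
set z := 3 ^+ K * _ in p *.
have -> : 3 * 3 ^+ K * (4 / 3 * (4 / 3) ^+ L) = 4 * z :> rat by rewrite /z; field.
have -> : 3 * 3 ^+ K * (4 / 3) ^+ L = 3 * z :> rat by rewrite /z mulrA.
by case: ifP; lra.
Qed.

(** Each guess adds to the current weights the ones for [L.+1]: the factors are 1 + 4/3 = 7/3 and 1
    + 2 = 3. *)
Lemma guess_weight (s : seq T) m : wsum w1 (foldt (guess X) s m) <=
  (7 / 3) ^+ count (mem (~: X)) s * a (mK m) (mL m)
  + 3 ^+ count (mem (~: X)) s * 2 ^+ mL m.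
Proof.
elim: s m => [|i s IH] m /=; first by rewrite !mul1r.
rewrite wsum_bind /guess; rewrite inE; case: ifP => iX /=; first by rewrite add0n.
have := IH m; have := IH (Mst (i |: mF m) (mU m) (mL m).+1 (mK m)) => /=.
set x := _ ^+ _; set y := 3 ^+ _; rewrite add1n !exprS -/x -/y.
have -> : a (mK m) (mL m).+1 = 4 / 3 * a (mK m) (mL m).
  by rewrite /a; case: ifP => _; rewrite ?mulr0 // exprS mulrCA.
move=> h1 h2; apply: le_trans (lerD h2 h1) _.
by rewrite le_eqVlt; apply/orP; left; apply/eqP; field.
Qed.

(** Per unit of [k] the first term costs 7/3 times 3 times 4/3, that is 28/3; the second costs 3
    times 2, which is less. *)
Lemma leaves_algo : (#|~: X| <= k)%N ->
  (leaves (algo e X k))%:R <= 2 * (28 / 3) ^+ k :> rat.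
Proof.
move=> le; rewrite leaves_wsum /algo wsum_bind.
apply: le_trans (wsum_le _ (w' := w1) _) _ => [m|].
  rewrite wsum_bind; apply: le_trans (wsum_le _ (w' := w1) _) _ => [m'|].
    have l2 := w2_ge1 m'; have h : w2 m' <= w1 m'.
      rewrite /w2 /w1 /a; case: ifP => _; last by rewrite add0r.
      by rewrite lerDl; apply: le_trans (pow2 _).
    case: ifP => _ /=; last exact: le_trans l2 h.
    apply: le_trans (wsum_le _ (w' := w2) _) _ => [m0|]; first exact: w2_ge1.
    exact: le_trans (wsum_rounds _ _ step2_weight) h.
  exact: wsum_rounds step1_weight.
apply: le_trans (guess_weight _ _) _ => /=.
have -> : count (mem (~: X)) (enum T) = #|~: X|.
  by rewrite cardE -size_filter /enum_mem filter_predT.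
have h1 : (7 / 3) ^+ #|~: X| * a k k <= (28 / 3) ^+ k :> rat.
  apply: (@le_trans _ _ ((7 / 3) ^+ k * (3 ^+ k * (4 / 3) ^+ k))).
    have x0 : 0 <= (7 / 3 : rat) by lra.
    have x1 : 1 <= (7 / 3 : rat) by lra.
    move: (7 / 3 : rat) x0 x1 => x x0 x1.
    apply: ler_pM; [exact: exprn_ge0|exact: a_ge0|exact: (ler_weXn2l x1)|].
    by rewrite /a; case: ifP => // _; apply: le_trans (pow34 k k).
  rewrite -!exprMn (_ : 7 / 3 * (3 * (4 / 3)) = 28 / 3) //; field.
have h2 : 3 ^+ #|~: X| * 2 ^+ k <= (28 / 3) ^+ k :> rat.
  apply: (@le_trans _ _ (3 ^+ k * 2 ^+ k)).
    apply: ler_wpM2r; first exact: exprn_ge0.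
    have x1 : 1 <= (3 : rat) by lra.
    exact: (ler_weXn2l x1).
  rewrite -exprMn; have x0 : 0 <= (3 * 2 : rat) by lra.
  have y0 : 0 <= (28 / 3 : rat) by lra.
  have xy : 3 * 2 <= 28 / 3 :> rat by lra.
  by apply: lerXn2r; rewrite ?nnegrE.
by apply: le_trans (lerD h1 h2) _; lra.
Qed.
End Leaves.

(** 9.34 is 28/3 times 1 + 1/1400, and by Bernoulli's inequality the power of the last factor
    outgrows k + 1 up to the constant 1401. *)
Lemma power_slack (F : realFieldType) k :
  k.+1%:R * (28 / 3) ^+ k <= 1401 * (934 / 100) ^+ k :> F.
Proof.
have -> : 934 / 100 = (1 + 1 / 1400) * (28 / 3) :> F by lra.
have h : 1 + k%:R * (1 / 1400) <= (1 + 1 / 1400) ^+ k :> F.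
  elim: k => [|k IH]; first by rewrite mul0r addr0.
  have k0 : 0 <= k%:R :> F by apply: ler0n.
  rewrite exprS -[k.+1%:R]natr1; move: IH k0.
  by move: (k%:R) (_ ^+ k) => x y; nra.
have k0 : 0 <= k%:R :> F by apply: ler0n.
rewrite [((1 + _) * _) ^+ k]exprMn [1401 * _]mulrA; apply: ler_wpM2r; first by apply: exprn_ge0; lra.
by rewrite -[k.+1%:R]natr1; move: h k0; move: (k%:R) (_ ^+ k) => x y; lra.
Qed.
End Weights.

(* A path through the decision tree is stored as a word over 1 ([false]) and 2
   ([true]), so that 0 marks its end. *)
Definition code (p : seq bool) (i : nat) : nat := nth 0 [seq (nat_of_bool b).+1 | b <- p] i.

Lemma code_cat p q i : code (p ++ q) i = if i < size p then code p i else code q (i - size p).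
Proof. by rewrite /code map_cat nth_cat size_map. Qed.

Lemma code_behead p i : code (behead p) i = code p i.+1.
Proof. by case: p => //=; rewrite /code nth_nil. Qed.

Lemma code_drop p d i : code (drop d p) i = code p (d + i).
Proof. by rewrite /code map_drop nth_drop. Qed.

(** * Commands that follow a decision tree *)

Definition quiet (st st' : store) : Prop :=
  sv st' 5 = sv st 5 /\ forall i, sa st' 3 i = sa st 3 i.

Lemma quiet_trans st1 st2 st3 : quiet st1 st2 -> quiet st2 st3 -> quiet st1 st3.
Proof. by move=> [e1 h1] [e2 h2]; split=> [|i]; rewrite ?e2 ?e1 ?h2 ?h1. Qed.

Lemma quiet_setv st x v : x != 5 -> quiet st (setv st x v).
Proof. by move=> h; split=> //=; rewrite eq_sym (negPf h). Qed.

Fixpoint nopath (c : cmd) : bool :=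
  match c with
  | CSet x _ | CMov x _ | CAdd x _ _ | CSub x _ _ | CLd x _ _ | CIn x _ => x != 5
  | CSt a _ _ | CStv a _ _ => a != 3
  | CSeq c1 c2 | CIf _ c1 c2 => nopath c1 && nopath c2
  | CFor x c => (x != 5) && nopath c
  end.

(* Variable 5 and array 3 hold the position on the path and the path; running
   from [st] to [st'] walks down [t], choosing first branches when the path ends. *)
Definition follows (B : Type) (RB : store -> B -> Prop) (st st' : store) (t : tree B) :=
  forall p, (forall i, sa st 3 (sv st 5 + i) = code p i) ->
  [/\ RB st' (walk t p).2, sv st' 5 = sv st 5 + size (walk t p).1,
      forall j, j < sv st 5 -> sa st' 3 j = sa st 3 j,
      forall i, i < size (walk t p).1 -> sa st' 3 (sv st 5 + i) = code (walk t p).1 i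
    & forall i, sa st' 3 (sv st' 5 + i) = code (drop (size (walk t p).1) p) i].

Section Follows.
Variables (n : nat) (inp : nat -> nat).
Local Notation den := (den n inp).

Lemma nopath_quiet c st : nopath c -> quiet st (den c st).
Proof.
elim: c st => //= [x c|x y|x y z|x y z|x a y|a y c|a y x|x y|c1 IH1 c2 IH2|x c1 IH1 c2 IH2|x c IH] st.
1-5: by move=> h; apply: quiet_setv.
1,2: by rewrite eq_sym => /negPf h; split=> //= i; rewrite h.
- by move=> h; apply: quiet_setv.
- by case/andP=> h1 h2; apply: quiet_trans (IH1 _ h1) (IH2 _ h2).
- by case/andP=> h1 h2; case: ifP => _; [apply: IH2|apply: IH1].
case/andP=> x5 hc; elim: (iota 0 n) st => [|i s IHs] st //=.
by apply: quiet_trans (IHs _); apply: quiet_trans (IH _ hc); apply: quiet_setv.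
Qed.

Lemma follows_ret (B : Type) (RB : store -> B -> Prop) st st' b :
  quiet st st' -> RB st' b -> follows RB st st' (Ret b).
Proof.
by move=> [e h] hb p hp; split=> //= [|i]; rewrite ?e ?addn0 // h hp drop0.
Qed.

Lemma follows_quiet (B : Type) (RB : store -> B -> Prop) st st1 st' t :
  quiet st st1 -> follows RB st1 st' t -> follows RB st st' t.
Proof.
move=> [e h] fo p hp; have [|h1 h2 h3 h4 h5] := fo p; first by move=> i; rewrite e h hp.
rewrite e in h2 h3 h4; split=> // j /h3 ->; exact: h.
Qed.

Lemma follows_post (B C : Type) (RB : store -> B -> Prop) (RC : store -> C -> Prop)
    st st1 st' t (g : B -> C) : follows RB st st1 t -> quiet st1 st' ->
  (forall b, RB st1 b -> RC st' (g b)) -> follows RC st st' (bind t (fun b => Ret (g b))).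
Proof.
move=> fo [e h] hB p hp; have [h1 h2 h3 h4 h5] := fo p hp.
rewrite walk_bind /= cats0; split=> //; first exact: hB.
- by rewrite e.
- by move=> j /h3 <-; rewrite h.
- by move=> i /h4 <-; rewrite h.
by move=> i; rewrite h e.
Qed.

Lemma follows_bind (B C : Type) (RB : store -> B -> Prop) (RC : store -> C -> Prop)
    st st1 st' t (g : B -> tree C) : follows RB st st1 t ->
  (forall b, RB st1 b -> follows RC st1 st' (g b)) -> follows RC st st' (bind t g).
Proof.
move=> fo hB p hp; have [h1 h2 h3 h4 h5] := fo p hp; rewrite walk_bind.
have [g1 g2 g3 g4 g5] := hB _ h1 _ h5.
set q1 := (walk t p).1 in h2 h4 h5 g1 g2 g3 g4 g5 *.
set w := walk _ _ in g1 g2 g3 g4 g5 *.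
rewrite /= size_cat; split=> //; first by rewrite g2 h2 addnA.
- by move=> j lj; rewrite g3 ?h3 // h2 ltn_addr.
- move=> i li; rewrite code_cat; case: ltnP => lq.
    by rewrite g3 ?h4 // h2 ltn_add2l.
  have -> : sv st 5 + i = sv st1 5 + (i - size q1) by rewrite h2; lia.
  by apply: g4; lia.
by move=> i; rewrite g5 drop_drop addnC.
Qed.

Lemma follows_foldt (I A : Type) (R : store -> A -> Prop) (F : I -> A -> tree A)
    (h : I -> nat) x c s st a :
  (forall i st a, R st a -> follows R st (den c (setv st x (h i))) (F i a)) -> R st a ->
  follows R st (foldl (fun st i => den c (setv st x i)) st (map h s)) (foldt F s a).
Proof.
move=> hF; elim: s st a => [|i s IH] st a ha /=; first exact: follows_ret.
by apply: follows_bind (hF i st a ha) _ => b; apply: IH.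
Qed.

(** Entry 0 means that the path is exhausted; it is then replaced by 1, for [false], so that the
    walk also records the path taken. *)
Definition ask : cmd :=
  CSeq (CLd 6 3 5) (CSeq (CIf 6 (CSet 10 1) (CSeq (CSet 6 1) (CSt 3 5 1)))
  (CSeq (CSet 10 1) (CSeq (CSub 6 6 10) (CAdd 5 5 10)))).

Definition asked (b : bool) (st st' : store) : Prop :=
  [/\ sv st' 6 = b, forall z, z \notin [:: 5; 6; 10] -> sv st' z = sv st z
    & forall a i, a != 3 -> sa st' a i = sa st a i].

Lemma follows_ask (B : Type) (RB : store -> B -> Prop) st c (f : bool -> tree B) :
  (forall b st', asked b st st' -> follows RB st' (den c st') (f b)) ->
  follows RB st (den (CSeq ask c) st) (Ask f).
Proof.
move=> hc p hp; rewrite denS; set st1 := den ask st.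
have hp0 : sa st 3 (sv st 5) = code p 0 by rewrite -hp addn0.
set b := head false p.
have [as1 e5 e3] : [/\ asked b st st1, sv st1 5 = (sv st 5).+1
    & forall i, sa st1 3 i = if i == sv st 5 then b.+1 else sa st 3 i].
  rewrite /st1 /ask !denS den_ld denI sv_set hp0 !den_set.
  have -> : (code p 0 != 0) = (p != [::]) by rewrite /b; case: (p).
  case: ifP => ep; last first.
    have pE : p = [::] by move/negbFE/eqP: ep.
    split; [split|by rewrite /= addn1|by move=> i; rewrite /= /b pE].
    + by rewrite /b pE.
    + by move=> z; rewrite !inE !negb_or /= => /and3P[/negPf-> /negPf-> /negPf->].
    + by move=> a' i /negPf /= ->.
  have pE : code p 0 = b.+1 by rewrite /b; case: (p) ep.
  split; [split|by rewrite /= addn1|].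
  - by rewrite /= pE subn1.
  - by move=> z; rewrite !inE !negb_or /= => /and3P[/negPf-> /negPf-> /negPf->].
  - by [].
  by move=> i /=; case: eqP => // ->; rewrite hp0 pE.
clearbody st1; have [|h1 h2 h3 h4 h5] := hc b st1 as1 (behead p).
  by move=> i; rewrite code_behead e3 e5 addSnnS ifF ?hp //; apply/eqP; lia.
rewrite /= -/b; case: (walk _ _) h1 h2 h3 h4 h5 => q a /= h1 h2 h3 h4 h5; split=> //.
- by rewrite h2 e5 addSnnS.
- by move=> j lj; rewrite h3 ?e5 ?e3 ?(ltn_eqF lj) // ltnW.
- case=> [|i] li; first by rewrite addn0 h3 ?e5 // e3 eqxx.
  by rewrite -addSnnS -e5 h4.
by move=> i; rewrite h5; case: (p).
Qed.
End Follows.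

(** * The tests of the algorithm as terms *)

Definition tEx (x : nat) (t : tm) : tm := TLe 1 (TSum x t).
Definition tOr1 (x : nat) (t : tm) : tm := TAnd (TLe 1 (TSum x t)) (TNot (TLe 2 (TSum x t))).
Definition tOne (t : tm) : tm := TAnd (TLe 1 t) (TNot (TLe 2 t)).

(* Edges to the forest (label 1) from the component of [x] in the set that the
   mask [m] describes through variable 16. *)
Definition tEd (m : tm) (x : nat) : tm :=
  TSum 14 (TSum 15 (TAnd (TReach 16 m x 14) (TAnd (TLab 1 15) (TAdj 14 15)))).
Definition mUd (p : nat) : tm := TAnd (TLab 0 16) (TNot (TEq 16 p)).
Definition mH (b : nat) : tm := TNot (TLab 2 b).
Definition tNb (c s y : nat) (t : tm) : tm := TAnd (TAnd (TLab c y) (TAdj s y)) t.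

Definition tPiv (p : nat) : tm :=
  TLe 2 (TAdd (TSum 17 (TAnd (TLab 1 17) (TAdj p 17)))
    (TSum 18 (tNb 0 p 18 (tOne (tEd (mUd p) 18))))).
Definition tLight (p : nat) : tm :=
  TNot (TLe 2 (TSum 18 (tNb 0 p 18 (TLe 2 (tEd (mUd p) 18))))).
Definition tHeavy (p : nat) : tm :=
  TAnd (TLab 0 p) (TAnd (TLe 3 (tEd (TLab 0 16) p)) (TAnd (tPiv p) (tLight p))).
Definition tAbs (p : nat) : tm := TAnd (TLab 0 p) (TNot (TLe 2 (tEd (TLab 0 16) p))).
Definition tServe (v y : nat) : tm :=
  TAnd (TLab 0 v) (TAnd (TLab 0 y) (TAnd (tPiv v) (TNot (TLe 1 (tEd (mUd v) y))))).
Definition tTie (y y' : nat) : tm := TReach 22 (mH 22) y y'.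
Definition tSat (s : nat) : tm :=
  tEx 20 (tEx 21 (TAnd (TAnd (TNot (TEq 20 21)) (TAnd (TLab 1 20) (TAdj s 20)))
    (tNb 1 s 21 (tTie 20 21)))).
Definition tRuleA (s v : nat) : tm :=
  TAnd (TLab 2 s) (TAnd (TNot (tSat s)) (TAnd
    (tOne (TSum 17 (TAnd (TLab 0 17) (TAdj s 17))))
    (tEx 23 (tNb 0 s 23 (tServe v 23))))).
Definition tRuleB (s v : nat) : tm :=
  TAnd (TLab 2 s) (TAnd (TNot (tSat s)) (tEx 23 (tNb 0 s 23 (TAnd (tServe v 23)
    (tEx 24 (TAnd (TAnd (mH 24) (TAdj s 24)) (TAnd (TNot (TEq 24 23)) (tTie 23 24)))))))).
Definition tRuleC (s v : nat) : tm :=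
  tEx 23 (tNb 0 s 23 (TAnd (tServe v 23) (tEx 24 (tNb 1 s 24 (tTie 23 24))))).
Definition tBlocked (u : nat) : tm :=
  tEx 20 (tEx 21 (TAnd (TAnd (TNot (TEq 20 21)) (TAnd (TAdj u 20) (TAdj u 21)))
    (TAnd (TLab 3 20) (TAnd (TLab 3 21) (TReach 22 (TLab 3 22) 20 21))))).

(** Bound variables have fixed names: up to 22 in the auxiliary tests, up to 24 in the rules.
    Argument variables must avoid them. *)
Definition ok1 (x : nat) : bool := (x < 14) || (22 < x).
Definition ok2 (x : nat) : bool := (x < 14) || (24 < x).

Lemma ok21 x : ok2 x -> ok1 x. Proof. by rewrite /ok1 /ok2; lia. Qed.
Lemma ok1N x : ok1 x -> (forall d, 13 < d < 23 -> (x == d) = false).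
Proof. by rewrite /ok1 => h d hd; apply/eqP; lia. Qed.
Lemma ok2N x : ok2 x -> (forall d, 13 < d < 25 -> (x == d) = false).
Proof. by rewrite /ok2 => h d hd; apply/eqP; lia. Qed.

Section Eval.
Variables (n : nat) (e : rel 'I_n) (row lab : nat -> nat).
Hypothesis sym_e : symmetric e.
Hypothesis rowP : forall i : 'I_n, row i = i * n.
Implicit Types (F U W Y : {set 'I_n}) (i j p u w : 'I_n) (v : nat -> nat).
Local Notation ev := (ev n (inpm e) row lab).
Local Notation upd v x i := [eta v with x |-> nat_of_ord i].

Lemma adjnE i j : adjn (inpm e) row i j = e i j.
Proof.
rewrite /adjn /inpm rowP eqb0 negbK; apply/existsP/idP => [[i' /existsP[j' /andP[/eqP eq eij]]]|eij].
  suff [-> ->] : i = i' /\ j = j' by [].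
  have := ltn_ord j; have := ltn_ord j'; move=> lj' lj.
  have ei : i = i' :> nat.
    have := congr1 (divn^~ n) eq; rewrite !divnMDl ?divn_small ?addn0 //; lia.
  by split; apply: val_inj => //=; move: eq; rewrite ei => /addnI.
by exists i; apply/existsP; exists j; rewrite eqxx.
Qed.

Lemma ev_and t1 t2 v (b1 b2 : bool) : ev t1 v = b1 -> ev t2 v = b2 ->
  ev (TAnd t1 t2) v = b1 && b2.
Proof. by move=> /= -> ->; rewrite !eqb0 !negbK. Qed.

Lemma ev_and0l t1 t2 v : ev t1 v = 0 -> ev (TAnd t1 t2) v = 0.
Proof. by move=> /= ->. Qed.

Lemma ev_and0r t1 t2 v : ev t2 v = 0 -> ev (TAnd t1 t2) v = 0.
Proof. by move=> /= ->; rewrite andbF. Qed.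

Lemma ev_not t v (b : bool) : ev t v = b -> ev (TNot t) v = ~~ b.
Proof. by move=> /= ->; rewrite eqb0. Qed.

Lemma ev_adj x y v i j : v x = i -> v y = j -> ev (TAdj x y) v = e i j.
Proof. by move=> /= -> ->; rewrite adjnE. Qed.

Lemma ev_eq x y v i j : v x = i -> v y = j -> ev (TEq x y) v = (i == j).
Proof. by move=> /= -> ->. Qed.

Lemma ev_le c t v m : ev t v = m -> ev (TLe c t) v = (c <= m).
Proof. by move=> /= ->. Qed.

Lemma ev_add t1 t2 v m1 m2 : ev t1 v = m1 -> ev t2 v = m2 ->
  ev (TAdd t1 t2) v = m1 + m2.
Proof. by move=> /= -> ->. Qed.

Lemma ev_sum x t v : ev (TSum x t) v = \sum_(i < n) ev t (upd v x i).
Proof. by []. Qed.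

Lemma ev_cnt x t v (P : pred 'I_n) : (forall i, ev t (upd v x i) = P i) ->
  ev (TSum x t) v = #|[set i | P i]|.
Proof.
move=> h /=; rewrite (eq_bigr (fun i => nat_of_bool (P i))) //.
by rewrite -big_mkcond sum1_card; apply: eq_card => i; rewrite !inE.
Qed.

Lemma ev_ex x t v (P : pred 'I_n) : (forall i, ev t (upd v x i) = P i) ->
  ev (tEx x t) v = [exists i, P i].
Proof.
move=> /ev_cnt h; rewrite (ev_le _ h) card_gt0; congr nat_of_bool; apply/set0Pn/existsP => -[i]; first by rewrite inE; exists i.
by exists i; rewrite inE.
Qed.

Lemma ev_one t v c : ev t v = c -> ev (tOne t) v = (c == 1).
Proof. by move=> /= ->; case: c => [|[|c]]. Qed.

Lemma ev_reach b m x y v Y i j : v x = i -> v y = j ->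
  (forall a, ev m (upd v b a) = (a \in Y)) ->
  ev (TReach b m x y) v = (j \in compt e Y i).
Proof.
move=> vx vy hm; rewrite /= vx vy; congr nat_of_bool; rewrite mem_comp.
have eqc : connect [rel a c : 'I_n | [&& ev m (upd v b a) != 0, ev m (upd v b c) != 0
    & adjn (inpm e) row a c]] =2 conn e Y.
  by apply: eq_connect => a c /=; rewrite adjnE !hm !eqb0 !negbK.
apply/existsP/andP => [[i' /existsP[j' /and4P[/eqP/val_inj-> /eqP/val_inj-> h]]]|[jY c]].
  rewrite eqc; move: h; rewrite hm eqb0 negbK => iY c; split=> //.
  exact: conn_inr c iY.
exists i; apply/existsP; exists j; rewrite !eqxx eqc c hm eqb0 negbK !andbT.
by rewrite /=; rewrite (conn_sym sym_e) in c; apply: conn_inr c jY.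
Qed.

Lemma ev_blocked a v u W : (forall i, (lab i == 3) = (i \in W)) -> v a = u -> ok1 a ->
  ev (tBlocked a) v = blocked e W u.
Proof.
move=> hW va /ok1N na; apply: ev_ex => y; apply: ev_ex => y'.
have [y'W|y'W] := boolP (y' \in W); last first.
  rewrite !andbF; apply: ev_and0r; apply: ev_and0r; apply: ev_and0l.
  by rewrite /= hW (negPf y'W).
have -> : [&& y != y', e u y, e u y', y \in W, true & conn e W y y'] =
    (~~ (y == y') && (e u y && e u y')) &&
    ((y \in W) && ((y' \in W) && (y' \in compt e W y))).
  by rewrite mem_comp y'W; case: (y != y'); case: (e u y); case: (e u y'); case: (y \in W).
have v' : (upd (upd v 20 y) 21 y') a = u by rewrite /= !na.
apply: ev_and; apply: ev_and; [|apply: ev_and; exact: ev_adj| |apply: ev_and].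
- by apply: ev_not; apply: ev_eq.
- by rewrite /= hW.
- by rewrite /= hW.
by apply: ev_reach => // c; rewrite /= hW.
Qed.

Variables (F U : {set 'I_n}).
Hypotheses (labU : forall i, (lab i == 0) = (i \in U))
  (labF : forall i, (lab i == 1) = (i \in F))
  (labO : forall i, (lab i == 2) = (i \notin F :|: U)).

Lemma ev_U x v i : v x = i -> ev (TLab 0 x) v = (i \in U).
Proof. by move=> /= ->; rewrite labU. Qed.
Lemma ev_F x v i : v x = i -> ev (TLab 1 x) v = (i \in F).
Proof. by move=> /= ->; rewrite labF. Qed.
Lemma ev_O x v i : v x = i -> ev (TLab 2 x) v = (i \notin F :|: U).
Proof. by move=> /= ->; rewrite labO. Qed.
Lemma ev_H x v i : v x = i -> ev (mH x) v = (i \in F :|: U).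
Proof. by move/ev_O/ev_not->; rewrite negbK. Qed.

Lemma ev_ed m x v Y w : v x = w -> x \notin [:: 14; 15] ->
  (forall a b c : 'I_n, ev m (upd (upd (upd v 14 a) 15 b) 16 c) = (c \in Y)) ->
  ev (tEd m x) v = ed e (compt e Y w) F.
Proof.
move=> vx; rewrite !inE negb_or => /andP[/negPf n4 /negPf n5] hm.
have hr (a b : 'I_n) : ev (TReach 16 m x 14) (upd (upd v 14 a) 15 b) =
    (a \in compt e Y w).
  by apply: ev_reach => [||c]; rewrite ?hm //= n5 n4.
rewrite /tEd ev_sum edE [RHS]big_mkcond; apply: eq_bigr => a _.
rewrite ev_sum; transitivity (\sum_(b < n) ((a \in compt e Y w) && ((b \in F) && e a b))).
  apply: eq_bigr => b _; apply: ev_and; first exact: hr.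
  by apply: ev_and; rewrite /= ?labF ?adjnE.
case: (a \in compt e Y w); last by rewrite big1.
by rewrite [RHS]big_mkcond; apply: eq_bigr => b _; case: (b \in F).
Qed.

Lemma ev_edU x v w : v x = w -> x \notin [:: 14; 15] ->
  ev (tEd (TLab 0 16) x) v = ed e (compt e U w) F.
Proof. by move=> vx nx; apply: ev_ed => // a b c; apply: ev_U. Qed.

Lemma ev_edUd x v w q p : v x = w -> v q = p -> x \notin [:: 14; 15] -> ok1 q ->
  ev (tEd (mUd q) x) v = ed e (compt e (U :\ p) w) F.
Proof.
move=> vx vq nx /ok1N nq; apply: ev_ed => // a b c.
rewrite inE inE andbC; apply: ev_and; first exact: ev_U.
by apply: ev_not; apply: ev_eq => //=; rewrite !nq.
Qed.

Lemma ev_nb (P : pred 'I_n) c s y t v Y i j : v s = i -> v y = j ->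
  ev (TLab c y) v = (j \in Y) -> ev t v = P j ->
  ev (tNb c s y t) v = (j \in nb e Y i) && P j.
Proof.
by move=> vs vy hY ht; rewrite in_nb; do 2!apply: ev_and => //; apply: ev_adj.
Qed.

Lemma ev_piv q v p : v q = p -> ok1 q -> ev (tPiv q) v = pivot e F U p.
Proof.
move=> vq oq; have nq := ok1N oq; apply: ev_le; apply: ev_add.
  rewrite (@ev_cnt _ _ _ (fun y => y \in nb e F p)); last first.
    move=> y; rewrite in_nb; apply: ev_and; first exact: ev_F.
    by apply: ev_adj => //=; rewrite nq.
  by apply: eq_card => y; rewrite inE.
rewrite (@ev_cnt _ _ _ (fun w => (w \in nb e U p) && (ed e (compt e (U :\ p) w) F == 1))) //.
move=> w; apply: (@ev_nb (fun w => ed e (compt e (U :\ p) w) F == 1)) => //.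
- by rewrite /= nq.
- exact: ev_U.
by apply: ev_one; apply: ev_edUd => //; rewrite /= nq.
Qed.

Lemma ev_light q v p : v q = p -> ok1 q -> ev (tLight q) v = light e F U p.
Proof.
move=> vq oq; have nq := ok1N oq; rewrite /light leqNgt; apply: ev_not; apply: ev_le.
rewrite (@ev_cnt _ _ _ (fun w => (w \in nb e U p) && (2 <= ed e (compt e (U :\ p) w) F))) //.
move=> w; apply: (@ev_nb (fun w => 2 <= ed e (compt e (U :\ p) w) F)) => //.
- by rewrite /= nq.
- exact: ev_U.
by apply: ev_le; apply: ev_edUd => //; rewrite /= nq.
Qed.

Lemma ev_heavy q v p L K : v q = p -> ok1 q -> ev (tHeavy q) v = heavy e (Mst F U L K) p.
Proof.
move=> vq oq; apply: ev_and; first exact: ev_U.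
apply: ev_and; last by apply: ev_and; [apply: ev_piv|apply: ev_light].
by apply: ev_le; apply: ev_edU => //; rewrite !inE negb_or !(ok1N oq).
Qed.

Lemma ev_abs q v p : v q = p -> ok1 q -> ev (tAbs q) v = (p \in absorbed e F U).
Proof.
move=> vq oq; rewrite inE; apply: ev_and; first exact: ev_U.
rewrite leqNgt; apply: ev_not; apply: ev_le; apply: ev_edU => //.
by rewrite !inE negb_or !(ok1N oq).
Qed.

Lemma ev_serve a b v p (y : 'I_n) : v a = p -> v b = y -> ok1 a -> ok1 b ->
  ev (tServe a b) v = serve e F U p y.
Proof.
move=> va vb oa ob; apply: ev_and; first exact: ev_U.
apply: ev_and; first exact: ev_U.
apply: ev_and; first exact: ev_piv.
rewrite -leqn0 leqNgt; apply: ev_not; apply: ev_le; apply: ev_edUd => //.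
by rewrite !inE negb_or !(ok1N ob).
Qed.

Lemma ev_tie a b v (y y' : 'I_n) : v a = y -> v b = y' -> a != 22 -> b != 22 ->
  y' \in F :|: U -> ev (tTie a b) v = conn e (F :|: U) y y'.
Proof.
move=> va vb na nb' y'H; rewrite (ev_reach va vb (Y := F :|: U)) ?mem_comp ?y'H //.
by move=> c; apply: ev_H.
Qed.

Lemma ev_sat a v (s : 'I_n) : v a = s -> ok1 a -> ev (tSat a) v = sat e F U s.
Proof.
move=> va oa; have na := ok1N oa; apply: ev_ex => y; apply: ev_ex => y'.
have [y'F|y'F] := boolP (y' \in F); last first.
  have -> : y' \in nb e F s = false by rewrite in_nb (negPf y'F).
  rewrite !andbF; apply: ev_and0r; do 2!apply: ev_and0l.
  by rewrite (ev_F (i := y')) // (negPf y'F).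
rewrite [in LHS]/tNb.
have -> : [&& y != y', y \in nb e F s, y' \in nb e F s & conn e (F :|: U) y y'] =
  (~~ (y == y') && ((y \in F) && e s y)) && (((y' \in F) && e s y') && conn e (F :|: U) y y').
  by rewrite !in_nb !andbA.
have vs : (upd (upd v 20 y) 21 y') a = s by rewrite /= !na.
apply: ev_and; apply: ev_and.
- by apply: ev_not; apply: ev_eq.
- by apply: ev_and; [apply: ev_F|apply: ev_adj].
- by apply: ev_and; [apply: ev_F|apply: ev_adj].
by apply: ev_tie => //; rewrite inE y'F.
Qed.

Lemma ev_ruleA a b v (s : 'I_n) p : v a = s -> v b = p -> ok2 a -> ok2 b ->
  ev (tRuleA a b) v = ruleA e F U s p.
Proof.
move=> va vb oa ob; have na := ok2N oa; have nb' := ok2N ob.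
apply: ev_and; first exact: ev_O.
apply: ev_and; first by apply: ev_not; apply: ev_sat => //; apply: ok21.
apply: ev_and.
  apply: ev_one; rewrite (@ev_cnt _ _ _ (fun y => y \in nb e U s)).
    by apply: eq_card => y; rewrite inE.
  move=> y; rewrite in_nb; apply: ev_and; first exact: ev_U.
  by apply: ev_adj => //=; rewrite na.
apply: ev_ex => y; apply: (@ev_nb (fun y => serve e F U p y)) => //; first by rewrite /= na.
  exact: ev_U.
by apply: ev_serve => //=; [rewrite nb'|apply: ok21].
Qed.

Lemma ev_ruleC a b v (s : 'I_n) p : v a = s -> v b = p -> ok2 a -> ok2 b ->
  ev (tRuleC a b) v = ruleC e F U s p.
Proof.
move=> va vb oa ob; have na := ok2N oa; have nb' := ok2N ob.
apply: ev_ex => y.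
apply: (@ev_nb (fun y => serve e F U p y && [exists y' in nb e F s, conn e (F :|: U) y y'])) => //; first by rewrite /= na.
  exact: ev_U.
apply: ev_and; first by apply: ev_serve => //=; [rewrite nb'|apply: ok21].
apply: ev_ex => y'; have [y'F|y'F] := boolP (y' \in F); last first.
  rewrite in_nb (negPf y'F); do 2!apply: ev_and0l.
  by rewrite (ev_F (i := y')) // (negPf y'F).
apply: (@ev_nb (fun y' => conn e (F :|: U) y y')) => //; first by rewrite /= !na.
  exact: ev_F.
by apply: ev_tie => //; rewrite inE y'F.
Qed.

Lemma ev_ruleB a b v (s : 'I_n) p : v a = s -> v b = p -> ok2 a -> ok2 b ->
  ev (tRuleB a b) v = ruleB e F U s p.
Proof.
move=> va vb oa ob; have na := ok2N oa; have nb' := ok2N ob.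
apply: ev_and; first exact: ev_O.
apply: ev_and; first by apply: ev_not; apply: ev_sat => //; apply: ok21.
apply: ev_ex => y.
apply: (@ev_nb (fun y => serve e F U p y &&
  [exists y' in nb e (F :|: U) s, (y' != y) && conn e (F :|: U) y y'])) => //; first by rewrite /= na.
  exact: ev_U.
apply: ev_and; first by apply: ev_serve => //=; [rewrite nb'|apply: ok21].
apply: ev_ex => y'; rewrite in_nb; have [y'H|y'H] := boolP (y' \in F :|: U); last first.
  by do 2!apply: ev_and0l; rewrite (ev_H (i := y')) // (negPf y'H).
apply: ev_and.
  by apply: ev_and; [by rewrite (ev_H (i := y')) // y'H|apply: ev_adj => //=; rewrite !na].
apply: ev_and; last by apply: ev_tie.
by apply: ev_not; apply: ev_eq.
Qed.

Lemma ev_forced v p L K : v 11 = p ->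
  ev (tEx 25 (tRuleA 25 11)) v = forced e (Mst F U L K) p.
Proof. by move=> vp; apply: ev_ex => s; apply: ev_ruleA. Qed.

Lemma ev_pending v (s : 'I_n) L K : v 11 = s ->
  ev (tEx 25 (tRuleB 11 25)) v = pending e (Mst F U L K) s.
Proof. by move=> vs; apply: ev_ex => p; apply: ev_ruleB. Qed.

End Eval.

(** * The concrete program *)

(** Variables: 0 is [k], 1 the flag to go on, 2 the answer, 3 and 4 the budgets [L] and [K], 5 the
    position on the path, 6 the last choice, 8 the vertex found, 9 the vertex [s] of rule B, 13 a
    flag. Arrays: 0 row offsets, 1 labels, 2 the set [X], 3 the path, 4 marks, 5 absorption. Labels:
    0 for [U], 1 for [F], 2 for discarded, 3 for the greedy forest. *)
Definition test (t : tm) (c1 c2 : cmd) : cmd := CSeq (tcomp t 40) (CIf 40 c1 c2).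
Definition nop : cmd := CSet 10 0.
Definition seek (t : tm) : cmd :=
  CSeq (CSet 13 0) (CFor 11 (test t (CSeq (CMov 8 11) (CSet 13 1)) nop)).
Definition incr (x : nat) : cmd := CSeq (CSet 10 1) (CAdd x x 10).
Definition decr (x : nat) : cmd := CSeq (CSet 10 1) (CSub x x 10).
(** Two loops, because the set to absorb must be known completely before any label changes. *)
Definition absorbC : cmd :=
  CSeq (CFor 11 (test (tAbs 11) (CSt 5 11 1) (CSt 5 11 0)))
    (CFor 11 (CSeq (CLd 12 5 11) (CIf 12 (CSt 1 11 1) nop))).
Definition takeC : cmd := CSeq (CSt 1 8 1) absorbC.
Definition tossC : cmd := CSeq (CSt 1 8 2) absorbC.
Definition guessC : cmd :=
  CSeq (CLd 12 2 11) (CIf 12 nop (CSeq ask (CIf 6 (CSeq (CSt 1 11 1) (incr 3)) nop))).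
Definition step1C : cmd :=
  CSeq (seek (tHeavy 11)) (CIf 13 (CIf 3 (CSeq ask (CIf 6
    (CSeq (decr 3) takeC) (CSeq (decr 3) (CSeq (decr 4) tossC)))) nop) nop).
Definition step2CC : cmd :=
  CSeq (seek (tRuleC 9 11)) (CIf 13 (CSeq ask (CIf 6
    (CSeq (decr 4) tossC) (CSeq (decr 3) (CSeq (decr 4) takeC))))
    (CSeq (decr 3) (decr 4))).
Definition step2BC : cmd :=
  CSeq (seek (tEx 25 (tRuleB 11 25))) (CIf 13 (CSeq (CMov 9 8)
    (CSeq (seek (tRuleB 9 11)) (CIf 13 (CSeq ask (CIf 6
      (CSeq (decr 4) tossC) (CSeq takeC step2CC))) nop))) nop).
Definition step2C' : cmd :=
  CSeq (seek (tEx 25 (tRuleA 25 11))) (CIf 13 takeC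
    (CIf 4 (CIf 3 step2BC nop) nop)).
Definition treeC : cmd :=
  CSeq (CFor 11 guessC) (CSeq absorbC (CSeq (CFor 7 step1C) (CIf 3 (CFor 7 step2C') nop))).
Definition resetC : cmd :=
  CSeq (CMov 3 0) (CSeq (CMov 4 0) (CSeq (CSet 5 0)
    (CFor 11 (CSeq (CLd 12 2 11) (CIf 12 (CSt 1 11 0) (CSt 1 11 2)))))).
Definition passC (c : nat) : cmd :=
  CFor 11 (test (TLab c 11) (test (tBlocked 11) nop (CSt 1 11 3)) nop).
Definition leafC : cmd :=
  CSeq (passC 1) (CSeq (passC 0) (CSeq (passC 2) (CSeq (CSet 12 0)
    (CSeq (CFor 11 (test (TLab 3 11) nop (incr 12))) (CSub 13 0 12))))).
(** One step towards [nextp]: a final [true] is erased, a final [false] becomes [true] and raises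
    flag 7. The 1 subtracted from the entry is left in variable 10 by [decr]. *)
Definition bstep : cmd :=
  CIf 7 nop (CIf 5 (CSeq (decr 5) (CSeq (CLd 12 3 5) (CSeq (CSub 12 12 10)
    (CIf 12 (CSt 3 5 0) (CSeq (CSt 3 5 2) (CSet 7 1)))))) nop).
Definition backC : cmd :=
  CSeq (CSet 7 0) (CSeq (CFor 11 bstep) (CSeq (CFor 11 bstep)
    (CSeq (CFor 11 bstep) (CFor 11 bstep)))).
(** One turn per leaf: the initial state is rebuilt and the path replayed, which takes the place of
    a stack of states. *)
Definition BODY : cmd :=
  CSeq resetC (CSeq treeC (CSeq leafC (CIf 13
    (CSeq backC (CSeq (CSet 2 0) (CIf 7 (CSet 1 1) (CSet 1 0))))
    (CSeq (CSet 1 0) (CSet 2 1))))).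
(** With all labels 2, [leafC] computes [greedy set0 set0], the forest [X]; if enough vertices lie
    outside, the answer is yes without any turn. *)
Definition INIT : cmd :=
  CSeq (CSet 12 0) (CSeq (CFor 11 (CSeq (CStv 0 11 12) (CFor 7 (incr 12))))
  (CSeq (CFor 11 (CSt 1 11 2)) (CSeq leafC
  (CSeq (CFor 11 (test (TLab 3 11) (CSt 2 11 1) nop))
    (CIf 13 (CSeq (CSet 1 1) (CSet 2 0)) (CSeq (CSet 1 0) (CSet 2 1))))))).

Lemma wf_init : wf INIT. Proof. by []. Qed.
Lemma wf_body : wf BODY. Proof. by []. Qed.
Lemma tame_body : tame [:: 0; 1; 2] BODY. Proof. by []. Qed.

Definition check (t : tm) : bool :=
  [&& wft t, all (fun z => z < 40) (fv t ++ bv t) & all (fun z => 13 < z) (bv t)].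

Definition keeps (st st' : store) : Prop :=
  (forall z, z < 14 -> sv st' z = sv st z) /\
  (forall a i, a != 4 -> sa st' a i = sa st a i).

Definition core (st st' : store) : Prop :=
  (forall z, z \in [:: 0; 3; 4; 9] -> sv st' z = sv st z) /\
  (forall a i, a < 3 -> sa st' a i = sa st a i).

Lemma sa_seta st a i v j : sa (seta st a i v) a j = if j == i then v else sa st a j.
Proof. by rewrite /= eqxx. Qed.

Lemma core_refl st : core st st. Proof. by []. Qed.

Lemma core_trans st1 st2 st3 : core st1 st2 -> core st2 st3 -> core st1 st3.
Proof. by move=> [h1 g1] [h2 g2]; split=> [z hz|a i ha]; rewrite ?h2 ?h1 ?g2 ?g1. Qed.

Lemma keeps_core st st' : keeps st st' -> core st st'.
Proof.
move=> [h g]; split=> [z|a i ha]; last by rewrite g //; apply/eqP; lia.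
by rewrite !inE => /or4P[] /eqP->; apply: h.
Qed.

Lemma core_setv st x v : x \notin [:: 0; 3; 4; 9] -> core st (setv st x v).
Proof.
move=> hx; split=> // z hz; rewrite sv_setN //.
by apply: contraNneq hx => <-.
Qed.

Lemma core_asked b st st' : asked b st st' -> core st st' /\ sv st' 8 = sv st 8.
Proof.
move=> [_ h g]; split; last exact: h.
split=> [z|a i ha]; last by rewrite g //; apply/eqP; lia.
by rewrite !inE => /or4P[] /eqP->; apply: h.
Qed.

Lemma take_enum_ord n i (li : i < n) :
  take i.+1 (enum 'I_n) = rcons (take i (enum 'I_n)) (Ordinal li).
Proof.
rewrite (take_nth (Ordinal li)) ?size_enum_ord //; congr rcons.
by apply: val_inj; rewrite /= nth_enum_ord.
Qed.

(** * Correctness of the commands *)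

Section Commands.
Variables (n : nat) (e : rel 'I_n) (X : {set 'I_n}) (k : nat).
Hypotheses (sym_e : symmetric e).
Local Notation den := (den n (inpm e)).
Local Notation ev := (ev n (inpm e)).
Implicit Types (F U W : {set 'I_n}) (m : mst 'I_n) (P : pred 'I_n).

Lemma den_test t c1 c2 st : check t -> {in fv t, forall z, sv st z < n} ->
  exists st1, keeps st st1 /\
    den (test t c1 c2) st = if ev (sa st 0) (sa st 1) t (sv st) != 0
                            then den c1 st1 else den c2 st1.
Proof.
case/and3P=> w /allP lt /allP gt hv.
have [h [k1 k2]] := @tcomp_correct n (inpm e) t 40 st w lt hv.
have le : {in fv t ++ bv t, forall z, z < 40} by exact: lt.
exists (den (tcomp t 40) st); split; last by rewrite /test denS denI h.
split=> // z z14; apply: k1; first exact: leq_trans z14 _.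
by apply/negP=> /gt; rewrite ltnNge -ltnS z14.
Qed.

Lemma den_for x c st : den (CFor x c) st =
  foldl (fun st i => den c (setv st x i)) st (iota 0 n).
Proof. by []. Qed.

Lemma den_bit x c1 c2 st (b : bool) : sv st x = b ->
  den (CIf x c1 c2) st = if b then den c1 st else den c2 st.
Proof. by move=> h; rewrite denI h; case: b {h}. Qed.

(* [for_ind] along the enumeration of the vertices. *)
Lemma for_enum (Inv : seq 'I_n -> store -> Prop) x c st : Inv [::] st ->
  (forall s i st', Inv s st' -> Inv (rcons s i) (den c (setv st' x (val i)))) ->
  Inv (enum 'I_n) (den (CFor x c) st).
Proof.
move=> h0 hS; have <- : take n (enum 'I_n) = enum 'I_n.
  by rewrite take_oversize ?size_enum_ord.
apply: (@for_ind n (inpm e) (fun i => Inv (take i (enum 'I_n)))).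
  by rewrite take0.
by move=> i st' li; rewrite (take_enum_ord li); apply: hS.
Qed.

Lemma seekP t P st : check t -> all (fun z => z \in [:: 9; 11]) (fv t) ->
  (9 \in fv t -> sv st 9 < n) ->
  (forall i st', core st st' -> sv st' 11 = val i ->
     ev (sa st' 0) (sa st' 1) t (sv st') = P i) ->
  core st (den (seek t) st) /\
  if pickl P is Some i then sv (den (seek t) st) 13 = 1 /\ sv (den (seek t) st) 8 = i
  else sv (den (seek t) st) 13 = 0.
Proof.
move=> ct /allP ft h9 hP; rewrite /seek denS den_set.
pose Inv (s : seq 'I_n) st' := core st st' /\
  if foldl (fun o i => if P i then Some i else o) None s is Some i
  then sv st' 13 = 1 /\ sv st' 8 = val i else sv st' 13 = 0.
apply: (@for_enum Inv); first by split; [apply: core_setv|].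
move=> s i st' [c h]; set st1 := setv st' 11 _.
have c1 : core st st1 by apply: core_trans c (core_setv _ _ _).
have [|st2 [k2 ->]] := @den_test t (CSeq (CMov 8 11) (CSet 13 1)) nop st1 ct.
  move=> z zt; have := ft z zt; rewrite !inE => /orP[]/eqP ez; rewrite ez in zt *.
    by rewrite (proj1 c1) // h9.
  by rewrite sv_set ltn_ord.
have c2 : core st st2 := core_trans c1 (keeps_core k2).
rewrite (hP i) ?sv_set // /Inv -cats1 foldl_cat /= eqb0 negbK.
case: (P i) => /=.
  split; last by rewrite (proj1 k2).
  exact: core_trans c2 (core_trans (core_setv _ _ _) (core_setv _ _ _)).
split; first exact: core_trans c2 (core_setv _ _ _).
have e13 : sv st2 13 = sv st' 13 by rewrite (proj1 k2).
have e8 : sv st2 8 = sv st' 8 by rewrite (proj1 k2).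
by case: (foldl _ _ _) h => [j|]; rewrite /= ?e13 ?e8.
Qed.

Definition labels F U (st : store) : Prop := forall i : 'I_n,
  [/\ (sa st 1 i == 0) = (i \in U), (sa st 1 i == 1) = (i \in F)
    & (sa st 1 i == 2) = (i \notin F :|: U)].

Definition setup (st : store) : Prop := sv st 0 = k /\ forall i : 'I_n,
  sa st 0 i = i * n /\ (sa st 2 i != 0) = (i \in X).

Definition rep (st : store) m : Prop :=
  [/\ setup st, labels (mF m) (mU m) st, sv st 3 = mL m & sv st 4 = mK m].

Lemma setup_core st st' : core st st' -> setup st -> setup st'.
Proof.
move=> [h g] [e0 es]; split; first by rewrite h.
by move=> i; rewrite !g.
Qed.

Lemma rep_core st st' m : core st st' -> rep st m -> rep st' m.
Proof.
move=> c [hs hl h3 h4]; have [h g] := c; split; rewrite ?h //; first exact: setup_core hs.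
by move=> i; rewrite g.
Qed.

Lemma rep_labels F U F' U' L K st st' : rep st (Mst F U L K) -> labels F' U' st' ->
  (forall z, z \in [:: 0; 3; 4; 9] -> sv st' z = sv st z) ->
  (forall a i, a != 1 -> a < 3 -> sa st' a i = sa st a i) -> rep st' (Mst F' U' L K).
Proof.
move=> [[h0 hs] _ h3 h4] hl h g; split=> //=; rewrite ?h //.
by split=> [|i]; rewrite ?h // !g.
Qed.

Lemma rep_decr3 st F U L K : rep st (Mst F U L K) ->
  rep (den (decr 3) st) (Mst F U L.-1 K).
Proof.
case=> -[h0 hs] hl /= h3 h4; split=> //=; first by rewrite h3 subn1.
Qed.

Lemma rep_decr4 st F U L K : rep st (Mst F U L K) ->
  rep (den (decr 4) st) (Mst F U L K.-1).
Proof.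
case=> -[h0 hs] hl /= h3 h4; split=> //=; first by rewrite h4 subn1.
Qed.

Section Rep.
Variables (st : store) (m : mst 'I_n).
Hypothesis hr : rep st m.

Lemma rep_row (i : 'I_n) : sa st 0 i = i * n.
Proof. by case: hr => -[_ h] _ _ _; case: (h i). Qed.
Lemma rep_U (i : 'I_n) : (sa st 1 i == 0) = (i \in mU m).
Proof. by case: hr => _ h _ _; case: (h i). Qed.
Lemma rep_F (i : 'I_n) : (sa st 1 i == 1) = (i \in mF m).
Proof. by case: hr => _ h _ _; case: (h i). Qed.
Lemma rep_O (i : 'I_n) : (sa st 1 i == 2) = (i \notin mF m :|: mU m).
Proof. by case: hr => _ h _ _; case: (h i). Qed.
End Rep.

Lemma absorbP st F U L K : rep st (Mst F U L K) ->
  rep (den absorbC st) (settle e F U L K) /\ sv (den absorbC st) 9 = sv st 9.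
Proof.
move=> hr; rewrite /absorbC denS.
pose Inv1 (s : seq 'I_n) st' := core st st' /\
  forall i, i \in s -> (sa st' 5 i != 0) = (i \in absorbed e F U).
have [] : Inv1 (enum 'I_n) (den (CFor 11 (test (tAbs 11) (CSt 5 11 1) (CSt 5 11 0))) st).
  apply: for_enum; first by split.
  move=> s i st' [c h]; set st1 := setv st' 11 _.
  have c1 : core st st1 by apply: core_trans c (core_setv _ _ _).
  have r1 := rep_core c1 hr.
  have [//||st2 [k2 ->]] := @den_test (tAbs 11) (CSt 5 11 1) (CSt 5 11 0) st1.
    by move=> z /(@allP _ (pred1 11) (fv (tAbs 11)) isT) /eqP ->; rewrite sv_set ltn_ord.
  have c2 : core st st2 := core_trans c1 (keeps_core k2).
  have -> := ev_abs sym_e (rep_row r1) (rep_U r1) (rep_F r1) (sv_set 11 st' i).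
    rewrite eqb0 negbK.
    have e11 : sv st2 11 = i by rewrite (proj1 k2) // sv_set.
    have e5 j : j \in s -> (sa st2 5 j != 0) = (j \in absorbed e F U).
      by move=> js; rewrite (proj2 k2) // h.
    have hc c' : core st (seta st2 5 i c').
      by apply: core_trans c2 _; split=> // a j a3 /=; case: eqP => // ea; lia.
    rewrite !den_st e11; case: ifP => ai; (split; first exact: hc) => j;
      rewrite mem_rcons inE sa_seta (_ : (j == i :> nat) = (j == i)) //;
      by case: (eqVneq j i) => [->|_ /e5].
  by [].
set st1 := den _ st => c1 h5.
pose Inv2 (s : seq 'I_n) st' :=
  [/\ forall z, z \in [:: 0; 3; 4; 9] -> sv st' z = sv st z,
      forall a i, a != 1 -> a < 3 -> sa st' a i = sa st a i,
      forall i, sa st' 5 i = sa st1 5 i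
    & forall i : 'I_n, sa st' 1 i =
        if (i \in s) && (i \in absorbed e F U) then 1 else sa st 1 i].
have [] : Inv2 (enum 'I_n) (den (CFor 11 (CSeq (CLd 12 5 11) (CIf 12 (CSt 1 11 1) nop))) st1).
  apply: for_enum; first by case: c1 => h g; split=> // *; exact: g.
  move=> s i st' [i1 i2 i3 i4].
  rewrite denS den_ld sv_set denI sv_set.
  rewrite -[sa (setv _ _ _) 5 _]/(sa st' 5 i) i3 h5 ?mem_enum //; set s2 := setv _ 12 _.
  have nz z : z \in [:: 0; 3; 4; 9] -> sv s2 z = sv st z.
    by move=> hz; rewrite !sv_setN ?i1 //; move: hz; rewrite !inE => /or4P[] /eqP->.
  case: ifP => ai.
    have e11 : sv s2 11 = i by [].
    rewrite den_st e11; split=> //.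
    - by move=> a j na a3; rewrite /= (negPf na) /= i2.
    - move=> j; rewrite sa_seta -[sa s2 1 _]/(sa st' 1 j) i4 mem_rcons inE.
      by rewrite (_ : (j == i :> nat) = (j == i)) //; case: eqVneq => [->|]; rewrite ?ai.
  split=> //.
    move=> z hz; rewrite den_set sv_setN ?nz //.
    by move: hz; rewrite !inE => /or4P[] /eqP->.
  move=> j; rewrite -[sa _ 1 _]/(sa st' 1 j) i4 mem_rcons inE.
  by case: (eqVneq j i) => [->|nj] /=; rewrite ?ai ?andbF.
move=> h1 h2 _ h4; split; last by rewrite h1.
apply: (rep_labels hr _ h1 h2) => i; rewrite h4 mem_enum /= !inE.
have := rep_U hr i; have := rep_F hr i; have := rep_O hr i => /=.
rewrite inE; case: (boolP (_ && _)) => [/andP[-> _]|_] /=; first by rewrite !orbT.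
by move=> -> -> ->; rewrite orbF.
Qed.

Lemma rep_store st F U L K (v : 'I_n) (c : nat) : rep st (Mst F U L K) -> sv st 8 = v ->
  c \in [:: 1; 2] -> (c == 2 -> v \in U) ->
  rep (den (CSt 1 8 c) st) (Mst (if c == 1 then v |: F else F) (U :\ v) L K).
Proof.
move=> hr e8 hc vU; apply: (rep_labels hr) => //; last first.
  by move=> a i na _; rewrite /= (negPf na).
move=> i; rewrite den_st e8 /=.
have := rep_U hr i; have := rep_F hr i; have := rep_O hr i => /=.
have -> : (i == v :> nat) = (i == v) by [].
move: hc vU; rewrite !inE; case: (eqVneq i v) => [->|nv] /=; last first.
  by case: (c == 1) => _ _ h2 h1 h0; split; rewrite ?inE ?(negPf nv).
case/orP=> /eqP-> /=; first by rewrite setU11.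
by move=> /(_ isT) -> _ <- /eqP ->.
Qed.

Lemma takeP st m (v : 'I_n) : rep st m -> sv st 8 = v ->
  rep (den takeC st) (plant e v m (mL m) (mK m)) /\ sv (den takeC st) 9 = sv st 9.
Proof.
case: m => F U L K hr e8; have hU : 1 == 2 -> v \in U by [].
have [h h9] := absorbP (rep_store (c := 1) hr e8 isT hU).
by split; [exact: h|rewrite /takeC denS h9].
Qed.

Lemma tossP st m (v : 'I_n) : rep st m -> sv st 8 = v -> v \in mU m ->
  rep (den tossC st) (toss e v m (mL m) (mK m)).
Proof.
case: m => F U L K hr e8 vU; have hU : 2 == 2 -> v \in U by [].
by have [] := absorbP (rep_store (c := 2) hr e8 isT hU).
Qed.

Let rep0 st m := rep st m /\ mU m = X.

Lemma guess_follows (i : 'I_n) st m : rep0 st m ->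
  follows rep0 st (den guessC (setv st 11 (val i))) (guess X i m).
Proof.
case: m => F U L K [hr eU]; rewrite [mU _]/= in eU; rewrite /guessC denS den_ld sv_set denI sv_set.
have [[h0 hs] _ _ _] := hr; set st1 := setv _ 12 _.
have q1 : quiet st st1 by [].
have c1 : core st st1 by apply: core_trans (core_setv _ _ _) (core_setv _ _ _).
rewrite -[sa (setv _ _ _) 2 _]/(sa st 2 i) (proj2 (hs i)) /guess; apply: follows_quiet q1 _.
case: ifP => iX.
  apply: follows_ret; first exact: nopath_quiet.
  by split=> //; apply: rep_core (core_trans c1 (core_setv _ _ _)) hr.
apply: follows_ask => b st2 as2; apply: follows_ret; first exact: nopath_quiet.
have [c2 _] := core_asked as2; have [h6 h _] := as2.
have r2 := rep_core (core_trans c1 c2) hr.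
rewrite (den_bit _ _ h6); case: b {as2} h6 => h6; last first.
  by split=> //; apply: rep_core (core_setv _ _ _) r2.
split=> //; have e11 : sv st2 11 = i by rewrite h.
have [[g0 gs] gl /= g3 g4] := r2.
rewrite e11; split=> //=; last by rewrite g3 addn1.
move=> j; have := gl j; rewrite /= (_ : (j == i :> nat) = (j == i)) // !inE.
by case: (eqVneq j i) => [->|] //= _; rewrite eU iX.
Qed.

Lemma ret_follows st c m : nopath c -> rep (den c st) m ->
  follows rep st (den c st) (Ret m).
Proof. by move=> nc hr; apply: follows_ret => //; apply: nopath_quiet. Qed.

Lemma nop_follows st m : rep st m -> follows rep st (den nop st) (Ret m).
Proof. by move=> hr; apply: ret_follows => //; apply: rep_core (core_setv _ _ _) hr. Qed.

Lemma step1_follows st m : rep st m -> follows rep st (den step1C st) (step1 e m).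
Proof.
case: m => F U L K hr; rewrite /step1C denS; set st1 := den (seek _) st.
have [c1 h1] : core st st1 /\ if pickl (heavy e (Mst F U L K)) is Some i
    then sv st1 13 = 1 /\ sv st1 8 = i else sv st1 13 = 0.
  apply: seekP => // i st' c' e11.
  have r := rep_core c' hr.
  exact: (ev_heavy sym_e (rep_row r) (rep_U r) (rep_F r) _ _ e11).
have r1 := rep_core c1 hr; have [_ _ h3 h4] := r1; rewrite [mL _]/= in h3.
apply: (@follows_quiet _ _ _ st1); first exact: nopath_quiet.
rewrite /step1; case: picklP h1 => [p hp [e13 e8]|_ e13]; last first.
  rewrite (den_bit (b := false) _ _ e13); exact: nop_follows r1.
rewrite (den_bit (b := true) _ _ e13) [mL _]/= denI h3 -lt0n; case: ifP => Lp; last exact: nop_follows r1.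
apply: follows_ask => b st2 as2; have [c2 e82] := core_asked as2; have [h6 _ _] := as2.
have r2 := rep_core c2 r1; have e8' : sv st2 8 = p by rewrite e82.
rewrite (den_bit _ _ h6); case: b {as2 h6}; apply: ret_follows => //.
  rewrite denS; have := rep_decr3 r2; set st3 := den (decr 3) st2 => r3.
  by have [] := takeP (v := p) r3 e8'.
rewrite 2!denS; have := rep_decr4 (rep_decr3 r2).
set st3 := den (decr 4) _ => r3.
have pU : p \in U by case/and4P: hp.
exact: (tossP (v := p) r3 e8' pU).
Qed.

Lemma step2C_follows st (s : 'I_n) m : rep st m -> sv st 9 = s ->
  follows rep st (den step2CC st) (step2C e s m).
Proof.
case: m => F U L K hr e9; rewrite /step2CC denS; set st1 := den (seek _) st.
have [c1 h1] : core st st1 /\ if pickl (ruleC e F U s) is Some i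
    then sv st1 13 = 1 /\ sv st1 8 = i else sv st1 13 = 0.
  apply: seekP => // [_|i st' c' e11].
    by rewrite e9 ltn_ord.
  have r := rep_core c' hr; have e9' : sv st' 9 = s by rewrite (proj1 c').
  exact: (ev_ruleC sym_e (rep_row r) (rep_U r) (rep_F r) (rep_O r) e9' e11).
have r1 := rep_core c1 hr.
apply: (@follows_quiet _ _ _ st1); first exact: nopath_quiet.
rewrite /step2C; case: picklP h1 => [p hp [e13 e8]|_ e13]; last first.
  rewrite (den_bit (b := false) _ _ e13); by apply: ret_follows => //; rewrite denS; apply: rep_decr4 (rep_decr3 r1).
rewrite (den_bit (b := true) _ _ e13).
apply: follows_ask => b st2 as2; have [c2 e82] := core_asked as2; have [h6 _ _] := as2.
have r2 := rep_core c2 r1; have e8' : sv st2 8 = p by rewrite e82.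
have [pU _] := ruleC_serve hp.
rewrite (den_bit _ _ h6); case: b {as2 h6}; apply: ret_follows => //.
  rewrite denS; have := rep_decr4 r2; set st3 := den (decr 4) st2 => r3.
  exact: (tossP (v := p) r3 e8' pU).
rewrite 2!denS; have := rep_decr4 (rep_decr3 r2).
set st3 := den (decr 4) _ => r3.
by have [] := takeP (v := p) r3 e8'.
Qed.

Lemma step2B_follows st m : rep st m -> follows rep st (den step2BC st) (step2B e m).
Proof.
case: m => F U L K hr; rewrite /step2BC denS; set st1 := den (seek _) st.
have [c1 h1] : core st st1 /\ if pickl (pending e (Mst F U L K)) is Some i
    then sv st1 13 = 1 /\ sv st1 8 = i else sv st1 13 = 0.
  apply: seekP => // i st' c' e11.
  have r := rep_core c' hr.
  exact: (ev_pending sym_e (rep_row r) (rep_U r) (rep_F r) (rep_O r) _ _ e11).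
have r1 := rep_core c1 hr.
apply: (@follows_quiet _ _ _ st1); first exact: nopath_quiet.
rewrite /step2B; case: picklP h1 => [s hs [e13 e8]|_ e13]; last first.
  rewrite (den_bit (b := false) _ _ e13); exact: nop_follows r1.
rewrite (den_bit (b := true) _ _ e13) 2!denS; set st2 := den (CMov 9 8) st1.
have r2 : rep st2 (Mst F U L K) by case: r1 => -[].
have e9 : sv st2 9 = s by rewrite /st2 /= e8.
have [c3 h3] : core st2 (den (seek (tRuleB 9 11)) st2) /\ if pickl (ruleB e F U s) is Some i
    then sv (den (seek (tRuleB 9 11)) st2) 13 = 1 /\ sv (den (seek (tRuleB 9 11)) st2) 8 = i
    else sv (den (seek (tRuleB 9 11)) st2) 13 = 0.
  apply: seekP => // [_|i st' c' e11].
    by rewrite e9 ltn_ord.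
  have r := rep_core c' r2; have e9' : sv st' 9 = s by rewrite (proj1 c').
  exact: (ev_ruleB sym_e (rep_row r) (rep_U r) (rep_F r) (rep_O r) e9' e11).
apply: (@follows_quiet _ _ _ st2); first exact: quiet_setv.
set st3 := den (seek _) st2 in c3 h3 *; have r3 := rep_core c3 r2.
apply: (@follows_quiet _ _ _ st3); first exact: nopath_quiet.
case: picklP h3 => [v hv [e13' e8']|_ e13']; last first.
  rewrite (den_bit (b := false) _ _ e13'); exact: nop_follows r3.
rewrite (den_bit (b := true) _ _ e13'); have [vU _] := ruleB_serve hv.
apply: follows_ask => b st4 as4; have [c4 e84] := core_asked as4; have [h6 _ _] := as4.
have r4 := rep_core c4 r3; have e8'' : sv st4 8 = v by rewrite e84.
have e94 : sv st4 9 = s by rewrite (proj1 c4) // (proj1 c3).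
rewrite (den_bit _ _ h6); case: b {as4 h6}.
  apply: ret_follows => //.
  rewrite denS; have := rep_decr4 r4; set st5 := den (decr 4) st4 => r5.
  exact: (tossP (v := v) r5 e8'' vU).
rewrite denS; have [r5 e95] := takeP r4 e8''.
apply: (@follows_quiet _ _ _ (den takeC st4)); first exact: nopath_quiet.
by apply: step2C_follows => //; rewrite e95.
Qed.

Lemma step2_follows st m : rep st m -> follows rep st (den step2C' st) (step2 e m).
Proof.
case: m => F U L K hr; rewrite /step2C' denS; set st1 := den (seek _) st.
have [c1 h1] : core st st1 /\ if pickl (forced e (Mst F U L K)) is Some i
    then sv st1 13 = 1 /\ sv st1 8 = i else sv st1 13 = 0.
  apply: seekP => // i st' c' e11.
  have r := rep_core c' hr.
  exact: (ev_forced sym_e (rep_row r) (rep_U r) (rep_F r) (rep_O r) _ _ e11).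
have r1 := rep_core c1 hr; have [_ _ h3 h4] := r1; rewrite [mL _]/= in h3; rewrite [mK _]/= in h4.
apply: (@follows_quiet _ _ _ st1); first exact: nopath_quiet.
rewrite /step2; case: picklP h1 => [p hp [e13 e8]|_ e13].
  rewrite (den_bit (b := true) _ _ e13).
  by apply: ret_follows => //; have [] := takeP r1 e8.
rewrite (den_bit (b := false) _ _ e13) [mK _]/= [mL _]/= denI h4 -lt0n.
case: ifP => Kp; last exact: nop_follows r1.
rewrite denI h3 -lt0n; case: ifP => Lp; last exact: nop_follows r1.
exact: step2B_follows.
Qed.

Lemma tree_follows st : rep st (Mst set0 X k k) ->
  follows rep st (den treeC st) (algo e X k).
Proof.
move=> hr; rewrite /treeC denS.
have f1 : follows rep0 st (den (CFor 11 guessC) st) (foldt (guess X) (enum 'I_n) (Mst set0 X k k)).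
  rewrite den_for -val_enum_ord; apply: (@follows_foldt n (inpm e) _ _ rep0); last by split.
  by move=> i st' m; apply: guess_follows.
apply: follows_bind f1 _ => -[F U L K] [r1 _].
rewrite denS; have [r2 _] := absorbP r1.
rewrite denS card_ord; set st2 := den absorbC _ in r2 *.
apply: (@follows_quiet _ _ _ st2); first exact: nopath_quiet.
have f2 : follows rep st2 (den (CFor 7 step1C) st2)
    (rounds (step1 e) n (settle e F U L K)).
  rewrite den_for -(map_id (iota 0 n)); apply: (@follows_foldt n (inpm e) _ _ rep) => // i st' m r'.
  apply: (@follows_quiet _ _ _ (setv st' 7 i)); first exact: quiet_setv.
  by apply: step1_follows; apply: rep_core (core_setv _ _ _) r'.
apply: follows_bind f2 _ => m r3; have [_ _ h3 _] := r3.
rewrite denI h3 -lt0n; case: ifP => Lp; last exact: nop_follows r3.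
set st3 := den (CFor 7 step1C) st2 in r3 h3 *; rewrite den_for -(map_id (iota 0 n)); apply: (@follows_foldt n (inpm e) _ _ rep) => // i st' m' r'.
apply: (@follows_quiet _ _ _ (setv st' 7 i)); first exact: quiet_setv.
by apply: step2_follows; apply: rep_core (core_setv _ _ _) r'.
Qed.

Lemma resetP st : setup st -> rep (den resetC st) (Mst set0 X k k) /\
  sv (den resetC st) 5 = 0 /\ forall i, sa (den resetC st) 3 i = sa st 3 i.
Proof.
move=> [h0 hs]; rewrite /resetC 3!denS.
set st1 := den (CSet 5 0) _.
pose Inv (s : seq 'I_n) st' := [/\ forall z, z < 10 -> sv st' z = sv st1 z,
  forall a i, a != 1 -> sa st' a i = sa st a i
  & forall i : 'I_n, i \in s -> sa st' 1 i = if i \in X then 0 else 2].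
have [] : Inv (enum 'I_n) (den (CFor 11 (CSeq (CLd 12 2 11) (CIf 12 (CSt 1 11 0) (CSt 1 11 2)))) st1).
  apply: for_enum; first by split.
  move=> s i st' [i1 i2 i3]; rewrite denS den_ld sv_set denI sv_set.
  rewrite -[sa (setv _ _ _) 2 _]/(sa st' 2 i) i2 // (proj2 (hs i)); set s2 := setv _ 12 _.
  have e11 : sv s2 11 = i by [].
  have j1 z : z < 10 -> sv s2 z = sv st1 z.
    by move=> hz; rewrite sv_setN 1?sv_setN ?i1 //; apply/eqP; lia.
  case: ifP => iX; rewrite den_st e11; split=> //.
  - by move=> a j na; rewrite /= (negPf na) /= i2.
  - move=> j; rewrite sa_seta mem_rcons inE (_ : (j == i :> nat) = (j == i)) //.
    by case: eqVneq => [->|_ /i3]; rewrite ?iX.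
  - by move=> a j na; rewrite /= (negPf na) /= i2.
  move=> j; rewrite sa_seta mem_rcons inE (_ : (j == i :> nat) = (j == i)) //.
  by case: eqVneq => [->|_ /i3]; rewrite ?iX.
move=> i1 i2 i3; split; last by rewrite i1 //; split=> // i; rewrite i2.
split; rewrite ?i1 //; first by split=> [|i]; rewrite ?i1 // !i2.
by move=> i; rewrite i3 ?mem_enum //= !inE orFb; case: (i \in X).
Qed.
End Commands.

Lemma code_rcons q b i : code (rcons q b) i = if i == size q then b.+1 else code q i.
Proof.
rewrite -cats1 code_cat; case: ltngtP => [//|lt|->]; last by rewrite subnn.
have -> : code q i = 0 by rewrite /code nth_default ?size_map // ltnW.
by case d: (i - size q) => [|d']; [lia|rewrite /code /= nth_nil].
Qed.

Lemma code_nil i : code [::] i = 0.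
Proof. by rewrite /code nth_nil. Qed.

(** * Correctness of one turn *)

Section Body.
Variables (n : nat) (e : rel 'I_n) (X : {set 'I_n}) (k : nat).
Hypotheses (sym_e : symmetric e).
Local Notation den := (den n (inpm e)).
Local Notation ev := (ev n (inpm e)).
Implicit Types (F U W P : {set 'I_n}) (m : mst 'I_n).

Definition calm (st st' : store) : Prop :=
  (forall z, z \in [:: 0; 3; 4; 9] -> sv st' z = sv st z) /\
  (forall a i, a \in [:: 0; 2] -> sa st' a i = sa st a i).

Lemma core_calm st st' : core st st' -> calm st st'.
Proof. by move=> [h g]; split=> // a i; rewrite !inE => /orP[] /eqP->; apply: g. Qed.

Lemma calm_trans st1 st2 st3 : calm st1 st2 -> calm st2 st3 -> calm st1 st3.
Proof. by move=> [h1 g1] [h2 g2]; split=> [z hz|a i ha]; rewrite ?h2 ?h1 ?g2 ?g1. Qed.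

Lemma calm_seta st i v : calm st (seta st 1 i v).
Proof. by split=> // a j; rewrite !inE => /orP[] /eqP->. Qed.

Definition marked_by W (lab0 : 'I_n -> nat) (st : store) : Prop :=
  forall i : 'I_n, sa st 1 i = if i \in W then 3 else lab0 i.

Definition rows (st : store) : Prop := forall i : 'I_n, sa st 0 i = i * n.

Lemma rows_calm st st' : calm st st' -> rows st -> rows st'.
Proof. by move=> [_ g] h i; rewrite g. Qed.

Lemma pass_cmd lab0 c P W st : (forall i, lab0 i < 3) ->
  (forall i, (lab0 i == c) = (i \in P)) -> c < 3 -> rows st -> marked_by W lab0 st ->
  calm st (den (passC c) st) /\ marked_by (pass e P W) lab0 (den (passC c) st).
Proof.
move=> l3 lP c3 hr hm.
pose Inv (s : seq 'I_n) st' := calm st st' /\ marked_by (foldl (grow e P) W s) lab0 st'.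
apply: (@for_enum n e Inv); first by split.
move=> s i st' [cl mk]; set Wc := foldl _ _ _ in mk.
set st1 := setv st' 11 _.
have c1 : calm st st1 by apply: calm_trans cl (core_calm (core_setv _ _ _)).
have [//|z|st2 [k2 ->]] := @den_test n e (TLab c 11)
  (test (tBlocked 11) nop (CSt 1 11 3)) nop st1.
  by rewrite !inE => /eqP->; rewrite sv_set ltn_ord.
have c2 : calm st st2 := calm_trans c1 (core_calm (keeps_core k2)).
have m2 : marked_by Wc lab0 st2 by move=> j; rewrite (proj2 k2) // -mk.
have e2 : sv st2 11 = i by rewrite (proj1 k2) // sv_set.
have -> : ev (sa st1 0) (sa st1 1) (TLab c 11) (sv st1) = (sa st2 1 i == c).
  by rewrite /= (proj2 k2).
rewrite m2 eqb0 negbK.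
have fin b : grow e P Wc i = Wc -> calm st (setv st2 10 b) /\
    marked_by (grow e P Wc i) lab0 (setv st2 10 b).
  by move=> ->; split=> //; apply: calm_trans c2 (core_calm (core_setv _ _ _)).
rewrite /Inv -cats1 foldl_cat -/Wc [foldl _ _ [:: i]]/=.
have [iW|iW] := boolP (i \in Wc).
  rewrite (gtn_eqF c3); apply: fin; rewrite /grow; case: ifP => // _.
  by apply/setUidPr; rewrite sub1set.
rewrite lP; case iP: (i \in P); last by apply: fin; rewrite /grow iP.
have [//|z|st3 [k3 ->]] := @den_test n e (tBlocked 11) nop (CSt 1 11 3) st2.
  move=> /(@allP _ (pred1 11) (fv (tBlocked 11)) isT) /eqP ->.
  by rewrite e2 ltn_ord.
have c3' : calm st st3 := calm_trans c2 (core_calm (keeps_core k3)).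
have m3 : marked_by Wc lab0 st3 by move=> j; rewrite (proj2 k3) // m2.
have e3 : sv st3 11 = i by rewrite (proj1 k3).
have hW (j : 'I_n) : (sa st2 1 j == 3) = (j \in Wc).
  by rewrite m2; case: ifP => // _; apply: ltn_eqF (l3 j).
rewrite (ev_blocked sym_e (rows_calm c2 hr) hW e2) // eqb0 negbK /grow iP /=.
case: (blocked e Wc i).
  by split=> //; apply: calm_trans c3' (core_calm (core_setv _ _ _)).
rewrite e3; split; first exact: calm_trans c3' (calm_seta _ _ _).
move=> j; rewrite -/(seta st3 1 i 3) sa_seta (_ : (j == i :> nat) = (j == i)) // m3 !inE.
by case: eqVneq.
Qed.

Lemma leafP F U st : sv st 0 = k -> rows st -> labels F U st ->
  [/\ sv (den leafC st) 13 = k - #|~: greedy e F U|, calm st (den leafC st)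
    & forall i : 'I_n, (sa (den leafC st) 1 i == 3) = (i \in greedy e F U)].
Proof.
move=> h0 hr hl; pose lab0 (i : 'I_n) := sa st 1 i.
have l3 i : lab0 i < 3.
  rewrite /lab0; have [hU hF] := hl i; rewrite inE -hU -hF.
  by case: (sa st 1 i) => [|[|[|c]]].
have hm : marked_by set0 lab0 st by move=> i; rewrite inE.
rewrite /leafC 5!denS.
have lF i : (lab0 i == 1) = (i \in F) by case: (hl i).
have lU i : (lab0 i == 0) = (i \in U) by case: (hl i).
have lO i : (lab0 i == 2) = (i \in ~: (F :|: U)) by rewrite inE; case: (hl i).
have [c1 m1] := pass_cmd l3 lF isT hr hm; set st1 := den (passC 1) st in c1 m1 *.
have [c2 m2] := pass_cmd l3 lU isT (rows_calm c1 hr) m1; set st2 := den (passC 0) st1 in c2 m2 *.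
have c02 := calm_trans c1 c2.
have [c3 m3] := pass_cmd l3 lO isT (rows_calm c02 hr) m2; set st3 := den (passC 2) st2 in c3 m3 *.
have c03 := calm_trans c02 c3; rewrite -/(greedy e F U) in m3.
clearbody st3 => {c1 c2 c3 m1 m2 st1 st2 c02}; move: (greedy e F U) m3 => W m3.
pose Inv (s : seq 'I_n) st' := [/\ calm st st', marked_by W lab0 st'
  & sv st' 12 = count (fun i => i \notin W) s].
have [] : Inv (enum 'I_n) (den (CFor 11 (test (TLab 3 11) nop (incr 12))) (den (CSet 12 0) st3)).
  apply: for_enum; first by split=> //; apply: calm_trans c03 (core_calm (core_setv _ _ _)).
  move=> s i st' [i1 i2 i3]; set s1 := setv st' 11 _.
  have [//|z|s2 [k2 ->]] := @den_test n e (TLab 3 11) nop (incr 12) s1.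
    by rewrite !inE => /eqP->; rewrite sv_set ltn_ord.
  have d2 : calm st s2.
    by apply: calm_trans (core_calm (keeps_core k2)); apply: calm_trans i1 (core_calm (core_setv _ _ _)).
  have n2 : marked_by W lab0 s2 by move=> j; rewrite (proj2 k2) // -i2.
  have e12 : sv s2 12 = sv st' 12 by rewrite (proj1 k2).
  have -> : ev (sa s1 0) (sa s1 1) (TLab 3 11) (sv s1) = (i \in W).
    rewrite /= i2; case: (i \in W) => //=; by rewrite (ltn_eqF (l3 i)).
  rewrite eqb0 negbK /Inv -cats1 count_cat /= addn0 -i3 -e12; case: (i \in W).
    split=> //=; last by rewrite addn0.
    exact: calm_trans d2 (core_calm (core_setv _ _ _)).
  split=> //; apply: calm_trans d2 (core_calm _).
  by apply: core_trans (core_setv _ _ _) (core_setv _ _ _).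
set st4 := den (CFor _ _) _ => c4 m4 e4.
have ec : count (fun i => i \notin W) (enum 'I_n) = #|~: W|.
  rewrite cardE -size_filter /enum_mem filter_predT; congr size.
  by apply: eq_filter => i; rewrite /= inE.
split.
- by rewrite den_sub sv_set e4 ec (proj1 c4) // h0.
- exact: calm_trans c4 (core_calm (core_setv _ _ _)).
move=> i; rewrite -[sa _ 1 _]/(sa st4 1 i) m4; case: ifP => // _.
exact: ltn_eqF (l3 i).
Qed.

(** Either the successor has been found, or the remaining prefix has the same successor as the whole
    path and is shorter by the steps made, or empty. *)
Definition backs (q0 : seq bool) (st0 : store) (j : nat) (st : store) : Prop :=
  [/\ sv st 0 = sv st0 0, forall a i, a \in [:: 0; 2] -> sa st a i = sa st0 a i
  & if sv st 7 == 0 then exists q,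
      [/\ forall i, sa st 3 i = code q i, sv st 5 = size q, nextp q = nextp q0
        & (size q + j <= size q0) || (size q == 0)]
    else exists2 p, nextp q0 = Some p & forall i, sa st 3 i = code p i].

Lemma bstepP q0 st0 j st : backs q0 st0 j st -> backs q0 st0 j.+1 (den bstep st).
Proof.
move=> [h0 ha h]; case: (eqVneq (sv st 7) 0) => [e7|n7]; last first.
  rewrite /bstep denI n7; rewrite (negPf n7) in h.
  by split; rewrite //= (negPf n7).
rewrite e7 eqxx /= in h; rewrite /bstep (den_bit (b := false) _ _ _ e7).
case: h => q [hq e5 hn hs].
case/lastP: q hq e5 hn hs => [|q b] hq e5 hn hs.
  rewrite (den_bit (b := false) _ _ _ e5); split=> //=; rewrite e7 /=; exists [::].
  by split=> //; rewrite orbT.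
rewrite size_rcons in e5 hs; rewrite denI ifT ?e5 // 3!denS.
have hb : sa st 3 (size q) = b.+1 by rewrite hq code_rcons eqxx.
have -> : den (decr 5) st = setv (setv st 10 1) 5 (size q).
  by rewrite /= e5 subn1.
rewrite /= hb; case: b hq hn hb => hq hn hb /=.
  split=> //=; first by move=> a i; rewrite !inE => h; rewrite ifF ?ha ?inE //; case/orP: h => /eqP->.
  rewrite e7 /=; exists q; split=> //=.
  - move=> i; case: (eqVneq i (size q)) => [->|ni].
      by rewrite /code nth_default ?size_map.
    by rewrite hq code_rcons (negPf ni).
  - by rewrite -hn nextp_true.
  by move: hs => /=; rewrite orbF addSnnS => ->.
split=> //=; first by move=> a i; rewrite !inE => h; rewrite ifF ?ha ?inE //; case/orP: h => /eqP->.
exists (rcons q true); first by rewrite -hn nextp_false.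
move=> i; rewrite code_rcons; case: eqVneq => // ni.
by rewrite hq code_rcons (negPf ni).
Qed.

Lemma backP q st : (forall i, sa st 3 i = code q i) -> sv st 5 = size q -> size q <= 4 * n ->
  backs q st (4 * n) (den backC st).
Proof.
move=> hq e5 le; have run j st' : backs q st j st' -> backs q st (j + n) (den (CFor 11 bstep) st').
  move=> h; apply: (@for_ind n (inpm e) (fun i => backs q st (j + i))).
    by rewrite addn0.
  move=> i s _ hs; rewrite addnS; apply: bstepP.
  by case: hs => h0 ha h7; split.
have b0 : backs q st 0 (setv st 7 0).
  by split=> //=; exists q; rewrite addn0 leqnn.
rewrite /backC 4!denS den_set (_ : 4 * n = 0 + n + n + n + n); last by lia.
exact: (run _ _ (run _ _ (run _ _ (run _ _ b0)))).
Qed.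

Local Notation tr := (algo e X k).

Definition ready (p : seq bool) (st : store) : Prop :=
  [/\ setup X k st, forall i, sa st 3 i = code p i & fits tr p].

Lemma bodyP p st st' : ready p st -> st' = den BODY st ->
  let q := (walk tr p).1 in
  if good e k (walk tr p).2 then sv st' 1 = 0 /\ sv st' 2 = 1
  else sv st' 2 = 0 /\ if nextp q is Some p' then sv st' 1 = 1 /\ ready p' st' else sv st' 1 = 0.
Proof.
move=> [hs hp ft] -> q; rewrite /BODY 3!denS.
have [r0 [e50 p0]] := resetP e hs; set st0 := den resetC st in r0 e50 p0 *.
have hp' i : sa st0 3 (sv st0 5 + i) = code p i by rewrite e50 p0 hp.
have [r1 e5 _ h3 h3'] := tree_follows sym_e r0 hp'.
set st1 := den treeC st0 in r1 e5 h3 h3' *; rewrite -/q in e5 h3 h3'.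
rewrite e50 add0n in e5.
have p1 i : sa st1 3 i = code q i.
  have [lt|le] := ltnP i (size q); first by rewrite -(h3 i lt) e50.
  have -> : i = sv st1 5 + (i - size q) by rewrite e5 subnKC.
  rewrite h3' fits_drop // code_nil /code nth_default ?size_map //.
  by rewrite e5 leq_addr.
set m := (walk tr p).2 in r1 *.
have [[k1 s1] l1 _ _] := r1.
have ro1 : rows st1 by move=> i; case: (s1 i).
have [e13 c2 _] := leafP k1 ro1 l1.
have [q5 q3] : quiet st1 (den leafC st1) by apply: nopath_quiet.
set st2 := den leafC st1 in e13 c2 q5 q3 *.
have su st3 : sv st3 0 = sv st2 0 -> (forall a i, a \in [:: 0; 2] -> sa st3 a i = sa st2 a i) ->
    setup X k st3.
  move=> g0 ga; split; first by rewrite g0 (proj1 c2).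
  by move=> i; rewrite !ga // !(proj2 c2).
have <- : (sv st2 13 == 0) = good e k m by rewrite e13 subn_eq0.
clearbody st2; rewrite denI; case: (eqVneq (sv st2 13) 0) => [e13'|n13]; first by split.
rewrite [~~ false]/=.
have p2 i : sa st2 3 i = code q i by rewrite q3.
have le : size q <= 4 * n.
  by rewrite -[n in 4 * n]card_ord; apply: leq_trans (walk_depth _ _) (depth_algo _ _ _).
have e52 : sv st2 5 = size q by rewrite q5.
have [b0 ba] := backP p2 e52 le; rewrite 2!denS den_set; set st3 := den backC st2 in b0 ba *.
rewrite denI !den_set sv_setN //; case: eqP => [e7|n7] /=.
  (* After [4 * n] steps without success the word is empty, and the empty word has no successor. *)
  case=> r [hr er <- /orP[hl|hl]]; split=> //.
    by rewrite (_ : r = [::]) //; apply/nilP; rewrite /nilp; lia.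
  by rewrite (_ : r = [::]) //; apply/nilP.
case=> p' np hq'; rewrite np; split=> //; split=> //; split=> //; last exact: fits_next np.
by apply: su.
Qed.
End Body.

(** * The whole run and its bound *)

Section Main.
Variables (n : nat) (e : rel 'I_n) (k : nat).
Hypotheses (sym_e : symmetric e) (irr_e : irreflexive e).
Local Notation den := (den n (inpm e)).
Let X : {set 'I_n} := greedy e set0 set0.
Local Notation tr := (algo e X k).

Lemma init_rows st :
  let st' := den (CFor 11 (CSeq (CStv 0 11 12) (CFor 7 (incr 12)))) (setv st 12 0) in
  [/\ sv st' 0 = sv st 0, rows n st' & forall a j, a != 0 -> sa st' a j = sa st a j].
Proof.
move=> st'; pose Inv i t := [/\ sv t 0 = sv st 0, sv t 12 = i * n,
  forall j, j < i -> sa t 0 j = j * n & forall a j, a != 0 -> sa t a j = sa st a j].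
have [h0 _ hr h] : Inv n st'.
  apply: for_ind => [|i t li [t0 t12 tr tz]]; first by split.
  rewrite denS; set u := den (CStv 0 11 12) _.
  have eu : u = seta (setv t 11 i) 0 i (i * n) by rewrite -t12.
  pose Inv2 l w := [/\ sv w 0 = sv st 0, sv w 12 = i * n + l & forall a j, sa w a j = sa u a j].
  have [w0 w12 wa] : Inv2 n (den (CFor 7 (incr 12)) u).
    apply: for_ind => [|l w ll [w0 w12 wa]]; first by split; rewrite ?addn0 ?eu.
    by split=> //=; rewrite w12 addn1 addnS.
  split=> //; first by rewrite w12 mulSn addnC.
    move=> j; rewrite wa eu sa_seta ltnS leq_eqVlt; case: eqVneq => [->//|_] /= ji.
    exact: tr.
  by move=> a j na; rewrite wa eu /= (negPf na) /= tz.
by split=> // i; apply: hr.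
Qed.

Lemma initP st' : st' = den INIT (start k) ->
  [/\ setup X k st', forall i, sa st' 3 i = 0
    & if k <= #|~: X| then sv st' 1 = 0 /\ sv st' 2 = 1 else sv st' 1 = 1].
Proof.
move=> est; have q3 : forall i, sa st' 3 i = 0.
  by move=> i; rewrite est (proj2 (@nopath_quiet n (inpm e) INIT (start k) isT)).
rewrite {}est in q3 *; move: q3; rewrite /INIT 5!denS den_set => q3.
have [] := init_rows (start k).
set st1 := den _ (setv (start k) 12 0) in q3 * => a1 b1 c1.
pose Inv1 (s : seq 'I_n) st := [/\ sv st 0 = k, forall a j, a != 1 -> sa st a j = sa st1 a j
  & forall i : 'I_n, i \in s -> sa st 1 i = 2].
have : Inv1 (enum 'I_n) (den (CFor 11 (CSt 1 11 2)) st1).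
  apply: for_enum; first by split.
  move=> s i st [h0 ha h2]; rewrite den_st sv_set; split=> //.
    by move=> a j na; rewrite /= (negPf na) /= ha.
  move=> j; rewrite sa_seta mem_rcons inE (_ : (j == i :> nat) = (j == i)) //.
  by case: (eqVneq j i) => // _ /h2.
set st2 := den _ st1 in q3 *; case=> a2 b2 c2.
have r2 : rows n st2 by move=> i; rewrite b2.
have l2 : @labels n set0 set0 st2.
  by move=> i; rewrite c2 ?mem_enum // !inE.
have [e13 [cv ca] l3] := leafP sym_e a2 r2 l2; rewrite -/X in e13 l3.
set st3 := den leafC st2 in q3 e13 cv ca l3 *; clearbody st3 st2 st1.
pose Inv (s : seq 'I_n) st := [/\ sv st 0 = k, sv st 13 = k - #|~: X|,
  forall a j, a < 2 -> sa st a j = sa st3 a j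
  & forall i : 'I_n, (sa st 2 i != 0) = (i \in s) && (i \in X)].
have : Inv (enum 'I_n) (den (CFor 11 (test (TLab 3 11) (CSt 2 11 1) nop)) st3).
  apply: for_enum.
    split=> //; first by rewrite cv.
    by move=> i; rewrite ca // b2 // c1.
  move=> s i st [h0 h13 ha h2]; set s1 := setv st 11 _.
  have [//|z|s2 [k2 ->]] := @den_test n e (TLab 3 11) (CSt 2 11 1) nop s1.
    by rewrite !inE => /eqP->; rewrite sv_set ltn_ord.
  have -> : ev n (inpm e) (sa s1 0) (sa s1 1) (TLab 3 11) (sv s1) = (i \in X).
    by rewrite -l3 /= ha.
  have e11 : sv s2 11 = i by rewrite (proj1 k2) // sv_set.
  have f0 : sv s2 0 = k by rewrite (proj1 k2).
  have f13 : sv s2 13 = k - #|~: X| by rewrite (proj1 k2).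
  have fa a j : a < 2 -> sa s2 a j = sa st3 a j.
    by move=> a2'; rewrite (proj2 k2) ?ha //; apply/eqP; lia.
  have f2 (j : 'I_n) : (sa s2 2 j != 0) = (j \in s) && (j \in X).
    by rewrite (proj2 k2) // -h2.
  rewrite eqb0 negbK; case: ifP => iX; split=> //.
  - by move=> a j a2'; rewrite den_st /= ifF ?fa //; apply/eqP; lia.
  - move=> j; rewrite den_st e11 sa_seta mem_rcons inE (_ : (j == i :> nat) = (j == i)) //.
    by case: (eqVneq j i) => [->|_]; rewrite ?iX ?f2.
  move=> j; rewrite -[sa _ 2 _]/(sa s2 2 j) f2 mem_rcons inE.
  by case: (eqVneq j i) => [->|_]; rewrite ?iX ?andbF.
set st4 := den (CFor 11 (test _ _ _)) st3 in q3 *; clearbody st4; case=> h0 h13 ha h2.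
have su st : sv st 0 = sv st4 0 -> (forall a j, sa st a j = sa st4 a j) -> setup X k st.
  move=> g0 ga; split; first by rewrite g0 h0.
  by move=> i; rewrite !ga (ha 0) // ca // r2 h2 mem_enum.
move: q3; rewrite denI h13 subn_eq0; case: (k <= #|~: X|) => q3.
  by split=> //; apply: su.
by split=> //; apply: su.
Qed.

Local Notation iter_body := (iterate BODY 1 2 e).

Lemma ready_retain p st : ready e X k p st -> ready e X k p (retain [:: 0; 1; 2] st).
Proof. by case=> -[h0 hs] hp ft; split. Qed.

Lemma sv_retain1 s : sv (retain [:: 0; 1; 2] s) 1 = sv s 1. Proof. by []. Qed.
Lemma sv_retain2 s : sv (retain [:: 0; 1; 2] s) 2 = sv s 2. Proof. by []. Qed.

Lemma iter1_body st : iter 1 iter_body st = retain [:: 0; 1; 2] (den BODY st).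
Proof. by []. Qed.

Lemma sweep_iter p N b st : sweep (good e k) tr p N b -> ready e X k p st -> sv st 1 != 0 ->
  [/\ forall i, i < N -> sv (iter i iter_body st) 1 != 0,
      sv (iter N iter_body st) 1 = 0 & (sv (iter N iter_body st) 2 != 0) = b].
Proof.
move=> d; elim: d st => {p N b} [p ok|p nok nx|p p' N b nok nx _ IH] st rd run;
  have e1 := iter1_body st; have := bodyP sym_e rd (erefl _); cbv zeta.
- rewrite ok; set st' := den BODY st => -[h1 h2].
  by split; [case|rewrite e1 sv_retain1 h1|rewrite e1 sv_retain2 h2].
- rewrite (negPf nok) nx; set st' := den BODY st => -[h2 h1].
  by split; [case|rewrite e1 sv_retain1 h1|rewrite e1 sv_retain2 h2].
rewrite (negPf nok) nx; set st' := den BODY st => -[h2 [h1 rd']].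
have [|g1 g2 g3] := IH _ (ready_retain rd'); first by rewrite sv_retain1 h1.
by split=> [[|i] li| |] //; rewrite iterSr // g1.
Qed.

(** The loop is entered only when fewer than [k] vertices lie outside [X], the condition under which
    [leaves_algo] bounds the turns. *)
Lemma run_total : exists N b,
  [/\ forall i, i < N -> sv (iter i iter_body (first INIT 1 2 e k)) 1 != 0,
      sv (iter N iter_body (first INIT 1 2 e k)) 1 = 0,
      (sv (iter N iter_body (first INIT 1 2 e k)) 2 != 0) = b,
      b <-> max_min_fvs e k
    & N = 0 \/ (#|~: X| < k /\ N <= leaves tr)].
Proof.
have [su p0] := initP (erefl _); rewrite /first; set st := den INIT (start k) in su p0 *.
case: leqP => [le [h1 h2]|lt h1].
  exists 0, true; split; [by []|by rewrite sv_retain1|by rewrite sv_retain2 h2| |by left].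
  by split=> // _; apply: (greedy_sound sym_e le).
have [N [lN d]] := sweep_complete (good e k) tr.
have rd : ready e X k [::] st.
  by split=> // [i|]; [rewrite p0 code_nil|case: (tr)].
have [|g1 g2 g3] := sweep_iter d (ready_retain rd); first by rewrite /= h1.
exists N, (hasok (good e k) tr); split=> //; last by right.
apply: hasok_algo => //; last by have [] := greedy_maximal sym_e set0 set0.
Qed.
End Main.

Import Order.TTheory GRing.Theory Num.Theory.
Local Open Scope ring_scope.

(** The constant 4203 is 3 times the 1401 of [power_slack]. *)
Lemma budget (F : realFieldType) k (a c : F) : 0 <= c -> a <= 3 * (28 / 3) ^+ k ->
  c * a * k.+1%:R <= c * 4203%:R * (934%:R / 100%:R) ^+ k.
Proof.
move=> c0 ha; have sl := power_slack F k; rewrite -!mulrA; apply: ler_wpM2l => //.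
apply: le_trans (ler_wpM2r (ler0n _ _) ha) _.
have -> : 3 * (28 / 3) ^+ k * k.+1%:R = 3 * (k.+1%:R * (28 / 3) ^+ k) :> F by ring.
have -> : 4203%:R * (934%:R / 100%:R) ^+ k = 3 * (1401 * (934 / 100) ^+ k) :> F.
  by rewrite mulrA; congr (_ * _); ring.
by apply: ler_wpM2l sl.
Qed.

Theorem theorem9 :
  exists (p : program) (C d : nat),
    forall (n : nat) (e : rel 'I_n) (k : nat),
      symmetric e -> irreflexive e ->
      exists (b : bool) (t : nat),
        [/\ halts_with p (input e k) b t,
            b <-> max_min_fvs e k
          & t%:R <= C%:R * (934%:R / 100%:R) ^+ k * n.+1%:R ^+ d :> rat].
Proof.
have [C [D hT]] := program_time wf_init wf_body tame_body.
exists (prog INIT BODY 1 2), (C * 4203)%N, D => n e k sym_e irr_e.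
have [N [b [run stop ans bP hN]]] := run_total k sym_e irr_e.
have [t [ht tle]] := hT n e k N run stop.
exists b, t; split=> //; first by rewrite -ans.
(* Twice the power for the leaves, once more for the additional unit. *)
have hN' : N.+1%:R <= 3 * (28 / 3) ^+ k :> rat.
  have p1 : 1 <= (28 / 3) ^+ k :> rat by apply: exprn_ege1.
  rewrite -natr1; case: hN => [->|[lt le]].
    by move: p1; move: (_ ^+ k) => x x1; lra.
  have h1 := leaves_algo e (ltnW lt).
  have h2 : N%:R <= (leaves (algo e (greedy e set0 set0) k))%:R :> rat by rewrite ler_nat.
  by move: (le_trans h2 h1) p1; move: (_ ^+ k) (N%:R) => x y; lra.
have le1 : t%:R <= C%:R * N.+1%:R * k.+1%:R * n.+1%:R ^+ D :> rat.
  by rewrite -natrX -!natrM ler_nat.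
apply: le_trans le1 _; apply: ler_wpM2r; first by apply: exprn_ge0; apply: ler0n.
by rewrite natrM; apply: budget => //; apply: ler0n.
Qed.
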